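(* Let $k>0$, $\alpha>0$ and $1<p<\frac{2k+1}{\alpha}$, and define $q$ by $\frac1q=\frac1p-\frac{\alpha}{2k+1}$. There is a constant $C=C(\alpha,p)$ such that for every $f\in L^2([-\pi,\pi],dm_k)\cap L^p([-\pi,\pi],dm_k)$, $$\|I_k^\alpha(f)\|_{q,k}\le C\,\|f\|_{p,k}.$$
   Context: Fix $k>0$. The Cherednik operator of type $A_1$ is $T^k f(x)=f'(x)+2k\,\frac{f(x)-f(-x)}{1-e^{-2x}}-k f(x)$. On $\mathbb{Z}$ define the partial order $j\triangleleft n$ iff either ($|j|<|n|$ and $|n|-|j|$ is a positive even integer) or ($|j|=|n|$ and $n<j$). Let $dm_k(x)=|\sin x|^{2k}dx$ on $[-\pi,\pi]$, $(f,g)_k=\int_{-\pi}^{\pi}f\bar g\,dm_k$, and $\|\cdot\|_{p,k}$ the norm of $L^p([-\pi,\pi],dm_k)$. For $n\in\mathbb{Z}$, $E_n^k$ is the unique function $E_n^k(z)=e^{nz}+\sum_{j\triangleleft n}c_{n,j}e^{jz}$ ($z\in\mathbb{C}$) with $(E_n^k(i\cdot),e^{ij\cdot})_k=0$ for all $j\triangleleft n$; the $c_{n,j}$ are real and nonnegative, $T^kE_n^k=n_kE_n^k$ ($n_k=n+k$ for $n>0$, $n_k=n-k$ for $n\le0$), $E_n^k(0)>0$, and $\{E_n^k(i\cdot)\}_{n\in\mathbb{Z}}$ is an orthogonal basis of $L^2([-\pi,\pi],dm_k)$. Set $\mathcal{E}_n^k(ix)=E_n^k(ix)/E_n^k(0)$.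 For $f=\sum_{n\in\mathbb{Z}}a_n\mathcal{E}_n^k(i\cdot)\in L^2([-\pi,\pi],dm_k)$ and $\alpha>0$, the fractional integral is $I_k^\alpha(f)=\sum_{n\in\mathbb{Z},\,n\ne0}|n|^{-\alpha}a_n\mathcal{E}_n^k(i\cdot)$. *)

(* Defs.v *)
From mathcomp Require Import all_boot all_order all_algebra.
From mathcomp Require Import all_classical all_reals all_analysis.
From mathcomp Require Import complex.
Import Order.TTheory GRing.Theory Num.Theory.

Set Implicit Arguments.
Unset Strict Implicit.
Unset Printing Implicit Defensive.

Local Open Scope classical_set_scope.
Local Open Scope ring_scope.

Section CherednikDefs.
Context {R : realType}.

Definition Dpi : set R := `[(- pi)%R, pi].

Definition wk (k x : R) : R := `|sin x| `^ (2 * k).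

Definition cabs (z : R[i]) : R :=
  Num.sqrt (complex.Re z ^+ 2 + complex.Im z ^+ 2).

Definition Lpint (k p : R) (h : R -> R[i]) : \bar R :=
  (\int[lebesgue_measure]_(x in Dpi) ((cabs (h x) `^ p * wk k x)%:E))%E.

Definition Lpnorm (k p : R) (h : R -> R[i]) : \bar R :=
  (Lpint k p h `^ p^-1)%E.

Definition inLp (k p : R) (h : R -> R[i]) : Prop :=
  [/\ measurable_fun Dpi (fun x => complex.Re (h x)),
      measurable_fun Dpi (fun x => complex.Im (h x)) &
      (Lpint k p h < +oo)%E].

Definition ipk (k : R) (h e : R -> R[i]) : R[i] :=
  Complex
    (Rintegral lebesgue_measure Dpi
       (fun x => complex.Re (h x * conjc (e x)) * wk k x))
    (Rintegral lebesgue_measure Dpi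
       (fun x => complex.Im (h x * conjc (e x)) * wk k x)).

Definition expi (j : int) (x : R) : R[i] :=
  Complex (cos (j%:~R * x)) (sin (j%:~R * x)).

Definition tri (j n : int) : bool :=
  ((absz j < absz n)%N && ~~ odd (absz n - absz j)%N)
  || ((absz j == absz n) && (n < j)).

(* the (finite) list of all j with j <| n (all such j satisfy |j| <= |n|) *)
Definition trirange (n : int) : seq int :=
  [seq j <- [seq (i%:Z - (absz n)%:Z) | i <- iota 0 (2 * absz n).+1] | tri j n].

(* x |-> e^{inx} + sum_{j <| n} c_j e^{ijx}   (i.e. E(ix) for the candidate E) *)
Definition Efun (n : int) (c : int -> R) (x : R) : R[i] :=
  expi n x + \sum_(j <- trirange n) Complex (c j) 0 * expi j x.

Definition Econd (k : R) (n : int) (c : int -> R) : Prop :=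
  forall j, tri j n -> ipk k (Efun n c) (expi j) = 0.

(* the coefficients c_{n,j} (chosen among the solutions; unique on j <| n) *)
Definition Ecoef (k : R) (n : int) : int -> R :=
  xget (fun _ => 0) [set c | Econd k n c].

Definition Ek (k : R) (n : int) : R -> R[i] := Efun n (Ecoef k n).

(* g = I_k^alpha(f), characterised through its coefficients in the orthogonal
   basis {E_n^k(i.)}:  (g, E_n) = |n|^{-alpha} (f, E_n) for n <> 0,
   (g, E_0) = 0. *)
Definition isFracInt (k alpha : R) (f g : R -> R[i]) : Prop :=
  forall n : int,
    ipk k g (Ek k n) =
    if n == 0 then 0
    else Complex (((absz n)%:R : R) `^ (- alpha)) 0 * ipk k f (Ek k n).

End CherednikDefs.

(* Main.v *)
(** Write [W = |sin|^(2k)] on [-pi, pi].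

    The span of [E_n] and [E_(-n)] is spanned by [R_n(cos x)] and
    [sin x R_n'(cos x)], where [R_n] is the Gegenbauer polynomial with
    [R_n(1) = 1], so [I^alpha] multiplies both of these families by
    [n^(-alpha)].  Let [P_r] be the kernel of the operator multiplying them by
    [r^n].  It is at most [B (1 - r)^(-2k-1)] by Sonin's bound on [R_n], and its
    [L^1(W)] norm is 1: it is nonnegative, because [U(t, x) = (P_(exp(-t)) v)(x)]
    solves [U_tt - 2k U_t + L U = 0] with [L] the Dunkl Laplacian on the circle,
    so that a maximum principle gives [U >= 0] for every trigonometric polynomial
    [v >= 0].

    Since [n^(-alpha)] is a constant times the integral of [r(u)^n] over [u > 0],
    with [r(u) = exp(-u^(1/alpha))], the function [I^alpha f] is, up to a bounded
    term, the integral over [0 < u < 1] of [P_(r(u)) f].  The two kernel bounds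
    [|P_(r(u))| <= B u^(-D)], [D = (2k+1)/alpha], and [||P_(r(u))||_1 <= 1] give
    the [L^p -> L^q] estimate by splitting, at each level [lam] of the integral,
    both the variable [u] at [a lam^(-q/D)] and the values of [f] at
    [b lam^(q/p)], and integrating over the level sets. *)

(* The multiplier depends only on [|n|], so the individual [E_n] need not be computed: it suffices
   that [E_n] and [E_(-n)] are independent combinations of the two Gegenbauer functions of level
   [n], and the analysis can then be done with real functions and real kernels. Positivity is the
   delicate point, since the kernel is a series of terms of varying sign. The equation for [U]
   contains [- 2k U_t] because [exp(-n t)] then matches the eigenvalue [n (n + 2k)]. The maximum
   principle gives positivity only in the integrated sense, against trigonometric polynomials;
   approximating indicators of arcs by such polynomials and applying Lebesgue differentiation makes
   it pointwise almost everywhere. The same passage serves a second time: [g] is given only by its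
   coefficients, so it is compared with an explicit integral having the same coefficients, by
   testing the difference and its opposite. Large [u] is harmless once the mean is removed, since
   all remaining terms carry a factor [r(u)], which is integrable. *)
Require Import Defs.
From mathcomp Require Import all_boot all_order all_algebra.
From mathcomp Require Import all_classical all_reals all_analysis.
From mathcomp Require Import measurable_realfun complex polyrcf ring lra zify.
Import Order.TTheory GRing.Theory Num.Theory.
Import numFieldNormedType.Exports.

Set Implicit Arguments.
Unset Strict Implicit.
Unset Printing Implicit Defensive.
Local Open Scope classical_set_scope.
Local Open Scope ring_scope.

(** * Gegenbauer polynomials *)

Section Gegenbauer.
Variables (R : realFieldType) (k : R).
Hypothesis k_gt0 : 0 < k.

(** The raising ladder of the Gegenbauer polynomials, scaled to take the value 1 at 1. Unlike the
    three-term recursion it involves a single previous index and yields the derivative and the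
    differential equation in the same induction. *)
Fixpoint geg (n : nat) : {poly R} :=
  if n is m.+1 then
    'X * geg m - ((m%:R + 2 * k)^-1)%:P * ((1 - 'X^2) * (geg m)^`())
  else 1.

(** Eigenvalue of [- (1 - x^2) y'' + (2k + 1) x y'] at [y = geg n]. *)
Definition glam (n : nat) : R := n%:R * (n%:R + 2 * k).

Lemma n2k_gt0 n : 0 < n%:R + 2 * k.
Proof. by rewrite ltr_wpDl// mulr_gt0. Qed.

Lemma glam_ge0 n : 0 <= glam n.
Proof. by rewrite mulr_ge0// ltW// n2k_gt0. Qed.

Lemma glam_gt0 n : 0 < glam n.+1.
Proof. by rewrite mulr_gt0// n2k_gt0. Qed.

Lemma glam_inj : injective glam.
Proof.
move=> n m; rewrite /glam => /eqP.
have -> : (n%:R * (n%:R + 2 * k) == m%:R * (m%:R + 2 * k)) =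
  ((n%:R - m%:R) * (n%:R + m%:R + 2 * k) == 0).
  by rewrite -subr_eq0; congr (_ == _); ring.
rewrite mulf_eq0 subr_eq0 eqr_nat => /orP[/eqP//|].
by rewrite -natrD gt_eqF// n2k_gt0.
Qed.

(** The equation for [P] removes [P''] from [Q']; the lowering relation follows by algebra, and
    differentiating it gives the equation for [Q] once [P'] is expressed through [Q] and [Q']. *)
Lemma deriv_geg_step (P : {poly R}) (n : nat) :
  (1 - 'X^2) * P^`()^`() = (2 * k + 1)%:P * 'X * P^`() - (glam n)%:P * P ->
  let Q := 'X * P - ((n%:R + 2 * k)^-1)%:P * ((1 - 'X^2) * P^`()) in
  [/\ Q^`() = n.+1%:R%:P * (P + ((n%:R + 2 * k)^-1)%:P * 'X * P^`()),
      (1 - 'X^2) * Q^`() = n.+1%:R%:P * (P - 'X * Q) &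
      (1 - 'X^2) * Q^`()^`() = (2 * k + 1)%:P * 'X * Q^`() - (glam n.+1)%:P * Q].
Proof.
set a := (n%:R + 2 * k)^-1; move=> H Q0.
have [Q EQ] : exists Q, Q = Q0 by exists Q0.
rewrite -EQ; rewrite /Q0 in EQ; clear Q0.
set b := (n%:R + 2 * k)%:P : {poly R}.
have ab : a%:P * b = 1.
  by rewrite -polyCM mulVf// gt_eqF// n2k_gt0.
have kb : (2 * k)%:P = b - n%:R%:P by rewrite /b -polyCB; congr (_%:P); ring.
have lb m : (glam m)%:P = m%:R%:P * (m%:R%:P + (2 * k)%:P) :> {poly R}.
  by rewrite /glam polyCM polyCD.
have k1 : (2 * k + 1)%:P = (2 * k)%:P + 1 :> {poly R} by rewrite polyCD.
have sn : n.+1%:R%:P = n%:R%:P + 1 :> {poly R} by rewrite -natr1 polyCD.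
have dQ0 : Q^`() = P + 'X * P^`() - a%:P * ((1 - 'X^2) * P^`()^`() - 2 * 'X * P^`()).
  rewrite EQ derivB !derivM derivX derivB derivC derivXn /= derivC. ring.
have dQ : Q^`() = n.+1%:R%:P * (P + a%:P * 'X * P^`()).
  rewrite dQ0 H sn k1 lb kb.
  transitivity (P + 'X * P^`() - (a%:P * b) * 'X * P^`()
    + a%:P * n%:R%:P * 'X * P^`() + a%:P * 'X * P^`() + (a%:P * b) * n%:R%:P * P).
    by ring.
  by rewrite ab; ring.
have dQ1 : (1 - 'X^2) * Q^`() = n.+1%:R%:P * (P - 'X * Q).
  rewrite dQ EQ; ring.
split => //.
have : ((1 - 'X^2) * Q^`())^`() = (n.+1%:R%:P * (P - 'X * Q))^`() by rewrite dQ1.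
rewrite !derivM derivB derivC derivXn /= derivC derivB derivM derivX sub0r expr1 => E.
have -> : (1 - 'X^2) * Q^`()^`() = 2 * 'X * Q^`() + n.+1%:R%:P * (P^`() - (Q + 'X * Q^`())).
  rewrite (_ : n.+1%:R%:P * _ = 0 * (P - 'X * Q) +
     n.+1%:R%:P * (P^`() - (1 * Q + 'X * Q^`()))); last by ring.
  by rewrite -E; ring.
have {E} F : n.+1%:R%:P * P^`() = b * 'X * Q^`() - n.+1%:R%:P * b * Q.
  rewrite dQ EQ.
  transitivity (n.+1%:R%:P * ((a%:P * b) * P^`())); first by rewrite ab mul1r.
  by ring.
by rewrite mulrBr F lb sn k1 kb; ring.
Qed.

Lemma geg_ode n : (1 - 'X^2) * (geg n)^`()^`() =
  (2 * k + 1)%:P * 'X * (geg n)^`() - (glam n)%:P * geg n.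
Proof.
elim: n => [|n /deriv_geg_step[]//].
by rewrite /glam/= derivC deriv0 !mulr0 mul0r polyC0 mul0r subrr.
Qed.

Lemma geg_lower n : (1 - 'X^2) * (geg n.+1)^`() =
  n.+1%:R%:P * (geg n - 'X * geg n.+1).
Proof. by have /deriv_geg_step[] := geg_ode n. Qed.

Lemma geg_raise n : (1 - 'X^2) * (geg n)^`() =
  (n%:R + 2 * k)%:P * ('X * geg n - geg n.+1).
Proof.
rewrite /= opprB addrCA subrr addr0 mulrA -polyCM divff ?mul1r//.
by rewrite gt_eqF// n2k_gt0.
Qed.

Lemma geg_at1 n : (geg n).[1] = 1.
Proof. by elim: n => [|n IH] /=; rewrite !hornerE//= IH; ring. Qed.

(** Value and derivative have opposite parities and enter each other's recursion, hence the joint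
    induction. *)
Lemma geg_atN x n : (geg n).[- x] = (-1) ^+ n * (geg n).[x] /\
   (geg n)^`().[- x] = (-1) ^+ n.+1 * (geg n)^`().[x].
Proof.
elim: n => [|n [IH1 IH2]].
  by rewrite /= derivC !hornerE; split => //; ring.
have /deriv_geg_step[d1 _ _] := geg_ode n.
split; last first.
  by rewrite [geg n.+1]/= d1 !hornerE /= IH1 IH2 !exprS; ring.
by rewrite /= !hornerE /= IH1 IH2 !exprS; ring.
Qed.

(** The top coefficient is multiplied by [1 + n / (n + 2k)] at each step: the [- X^2] in the ladder
    turns the subtraction into a positive contribution. *)
Lemma geg_coef n : (size (geg n) <= n.+1)%N /\ 0 < (geg n)`_n.
Proof.
elim: n => [|n [IH1 IH2]]; first by rewrite size_poly1 coef1.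
have sd : (size (geg n)^`() <= n)%N.
  case: (eqVneq (geg n) 0) => [->|n0]; first by rewrite deriv0 size_poly0.
  by rewrite -ltnS (leq_trans (lt_size_deriv n0)).
split.
  rewrite /= (leq_trans (size_polyD _ _))// geq_max size_polyN; apply/andP; split.
    by rewrite mulrC (leq_trans (size_polyMleq _ _))// size_polyX addn2.
  rewrite mul_polyC (leq_trans (size_scale_leq _ _))//.
  rewrite (leq_trans (size_polyMleq _ _))//.
  have s2 : (size (1 - 'X^2 : {poly R})%R <= 3)%N.
    by rewrite (leq_trans (size_polyD _ _))// size_polyN size_polyXn size_poly1.
  by apply: (@leq_trans (3 + n).-1) => //; rewrite -!subn1 leq_sub2r// leq_add.
rewrite /= coefB coefXM /= mul_polyC coefZ mulrBl mul1r coefB coefXnM.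
have -> : (geg n)^`()`_n.+1 = 0 by rewrite nth_default// (leq_trans sd).
rewrite sub0r.
have -> : (if (n.+1 < 2)%N then 0 else (geg n)^`()`_(n.+1 - 2)) = n%:R * (geg n)`_n.
  case: n {IH1 IH2 sd} => [|n]; first by rewrite mul0r.
  by move: (geg n.+1) => q; rewrite ltnS /= !subSS subn0 coef_deriv mulr_natl.
rewrite mulrN opprK mulrA -{1}[(geg n)`_n]mul1r -mulrDl mulr_gt0//.
by rewrite ltr_wpDr// mulr_ge0// invr_ge0 ltW// n2k_gt0.
Qed.

Arguments geg : simpl never.

Lemma size_geg n : size (geg n) = n.+1.
Proof.
have [s c] := geg_coef n; apply/eqP; rewrite eqn_leq s/=.
by apply: contraTT c; rewrite -leqNgt => ?; rewrite nth_default// ltxx.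
Qed.

Lemma size_geg_deriv n : size (geg n.+1)^`() = n.+1.
Proof.
have g0 : geg n.+1 != 0 by rewrite -size_poly_gt0 size_geg.
have s : (size (geg n.+1)^`() <= n.+1)%N.
  by rewrite -ltnS -[X in (_ < X)%N](size_geg n.+1) lt_size_deriv.
apply/eqP; rewrite eqn_leq s /=.
have : (geg n.+1)^`()`_n != 0.
  by rewrite coef_deriv mulrn_eq0 /= gt_eqF// (geg_coef n.+1).2.
by apply: contraNT; rewrite -leqNgt => ?; rewrite nth_default.
Qed.

(* Sonin's function: increasing in [x^2], so it bounds [geg n] by its value at 1 *)
Definition sonin n : {poly R} :=
  (1 - 'X^2) * (geg n)^`() ^+ 2 + (glam n)%:P * geg n ^+ 2.

(** The equation replaces [(1 - x^2) y'' + glam y] by [(2k + 1) x y'], and the derivative of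
    [1 - x^2] takes one [x y'] away: [2 (2k + 1 - 1) = 4k]. *)
Lemma deriv_sonin n : (sonin n)^`() = (4 * k)%:P * 'X * (geg n)^`() ^+ 2.
Proof.
have E := geg_ode n; move: E; rewrite /sonin !expr2 => E.
rewrite derivD !derivM derivB !derivM !derivC derivX.
transitivity (2 * (geg n)^`() * ((1 - 'X * 'X) * (geg n)^`()^`() +
   (glam n)%:P * geg n - 'X * (geg n)^`())); first by ring.
rewrite E polyCD !polyCM; have -> : 4%:P = 2%:P * 2%:P :> {poly R}.
  by rewrite -polyCM; congr (_%:P); ring.
have -> : 2%:P = 2 :> {poly R} by rewrite polyCMn.
ring.
Qed.

End Gegenbauer.

Lemma size_basis_expand (R : fieldType) (F : nat -> {poly R}) :
  (forall j, size (F j) = j.+1) -> forall n (p : {poly R}), (size p <= n)%N ->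
  exists c : nat -> R, p = \sum_(j < n) (c j)%:P * F j.
Proof.
move=> sF; elim=> [|n IH] p sp.
  exists (fun=> 0); rewrite big_ord0.
  by apply/eqP; rewrite -size_poly_leq0.
have c0 : (F n)`_n != 0.
  by have := lead_coef_eq0 (F n); rewrite lead_coefE sF /= => ->; rewrite -size_poly_gt0 sF.
pose b := p`_n / (F n)`_n.
have [|c Ec] := IH (p - b%:P * F n).
  apply/leq_sizeP => j; rewrite leq_eqVlt => /predU1P[<-|nj].
    by rewrite coefB coefCM /b divfK// subrr.
  rewrite coefB coefCM !nth_default ?mulr0 ?subrr// ?sF//.
  exact: leq_trans sp nj.
exists (fun j => if j == n then b else c j).
rewrite big_ord_recr /= eqxx.
rewrite (eq_bigr (fun j : 'I_n => (c j)%:P * F j)) => [|j _]; last first.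
  by rewrite ltn_eqF.
by rewrite -Ec subrK.
Qed.

(** * The weight and orthogonality *)

Definition hE {R : comNzRingType} :=
  (@hornerD R, @hornerN R, @hornerM R, @hornerX R, @hornerC R, @hornerXn R,
   @horner_exp R).

Section Weight.
Variables (R : realType) (k : R).
Hypothesis k_gt0 : 0 < k.
Local Notation mu := (@lebesgue_measure R).

(** The weight is extended by zero, so that every integral runs over the whole line and no domain
    has to be carried along. *)
Definition wgt (x : R) : R := wk k x * \1_(@Dpi R) x.

Lemma measurable_Dpi : measurable (@Dpi R).
Proof. exact: measurable_itv. Qed.

Lemma measurable_wk : measurable_fun [set: R] (wk k).
Proof.
apply: (measurableT_comp (measurable_powR _)) => //.
by apply: (measurableT_comp) => //; apply: continuous_measurable_fun; exact: continuous_sin.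
Qed.

Lemma measurable_wgt : measurable_fun [set: R] wgt.
Proof.
apply: measurable_funM; first exact: measurable_wk.
by apply/measurable_indicP; exact: measurable_Dpi.
Qed.

Lemma measurable_Mwgt (h : R -> R) : measurable_fun setT h ->
  measurable_fun setT (fun x => h x * wgt x).
Proof. by move=> mh; apply: measurable_funM; [exact: mh|exact: measurable_wgt]. Qed.

Lemma measurable_powMwgt (h : R -> R) (r : R) : measurable_fun setT h ->
  measurable_fun setT (fun x => `|h x| `^ r * wgt x).
Proof.
move=> mh; apply: measurable_Mwgt; apply: (measurableT_comp (measurable_powR _)).
exact: measurableT_comp.
Qed.

Lemma wk_ge0 x : 0 <= wk k x. Proof. exact: powR_ge0. Qed.

Lemma wgt_ge0 x : 0 <= wgt x. Proof. by rewrite mulr_ge0// powR_ge0. Qed.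

Lemma norm_sin_le1 (x : R) : `|sin x| <= 1.
Proof. by rewrite ler_norml sin_geN1 sin_le1. Qed.

Lemma wk_le1 x : wk k x <= 1.
Proof.
rewrite /wk [leRHS](_ : 1 = 1 `^ (2 * k)); last by rewrite powR1.
rewrite ge0_ler_powR ?nnegrE ?norm_sin_le1//.
by rewrite mulr_ge0// ltW.
Qed.

Lemma wgt_out x : ~ Dpi x -> wgt x = 0.
Proof. by move=> Dx; rewrite /wgt indicE memNset// mulr0. Qed.

Lemma wgt_in x : Dpi x -> wgt x = wk k x.
Proof. by move=> Dx; rewrite /wgt indicE mem_set// mulr1. Qed.

Definition intW (h : R -> R) := mu.-integrable setT (fun x => (h x * wgt x)%:E).

Definition IW (h : R -> R) : R := \int[mu]_x (h x * wgt x).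

Lemma IWE h : IW h = \int[mu]_(x in @Dpi R) (h x * wk k x).
Proof.
rewrite [RHS]Rintegral_mkcond; apply: eq_Rintegral => x _ /=.
rewrite patchE /wgt indicE; case: ifPn => /= _; rewrite ?mulr1// !mulr0//.
Qed.

Lemma bounded_intW (h : R -> R) (M : R) : measurable_fun setT h ->
  (forall x, `|h x| <= M) -> intW h.
Proof.
move=> mh hM; apply: (@le_integrable _ _ _ mu _ measurableT _
  (fun x => (M * \1_(@Dpi R) x)%:E)).
- apply/measurable_EFinP/measurable_funM => //; exact: measurable_wgt.
- move=> x _ /=; rewrite lee_fin !normrM.
  rewrite /wgt indicE; case: (_ \in _); rewrite ?mulr0 ?normr0 ?mulr0 ?mulr1//.
  rewrite normr1 !mulr1 (@le_trans _ _ M)// ?ler_norm// -[leRHS]mulr1 ler_pM//.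
  by rewrite ger0_norm ?wk_ge0 ?wk_le1.
- under eq_fun do rewrite EFinM.
  by apply: integrableZl => //; exact: integrable_indic_itv.
Qed.

Lemma intWM (h g : R -> R) (M : R) : measurable_fun setT g -> (forall x, `|g x| <= M) ->
  intW h -> intW (fun x => g x * h x).
Proof.
move=> mg gM hh; apply: (@le_integrable _ _ _ mu _ measurableT _
  (fun x => M%:E * (h x * wgt x)%:E)%E).
- have := measurable_int _ hh; rewrite /= => /measurable_EFinP mh.
  apply/measurable_EFinP; under eq_fun do rewrite -mulrA.
  exact: measurable_funM.
- move=> x _ /=; rewrite lee_fin -mulrA normrM [leRHS]normrM ler_wpM2r//.
  by rewrite (le_trans (gM x))// ler_norm.
- exact: integrableZl.
Qed.

Lemma intWD h g : intW h -> intW g -> intW (fun x => h x + g x).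
Proof.
move=> hh hg; have := integrableD measurableT hh hg.
by apply: eq_integrable => // x _; rewrite /= mulrDl.
Qed.

Lemma intWZ c h : intW h -> intW (fun x => c * h x).
Proof.
move=> hh; have := integrableZl measurableT c hh.
by apply: eq_integrable => // x _; rewrite /= -mulrA.
Qed.

Lemma eq_intW h g : h =1 g -> intW h -> intW g.
Proof. by move=> /funext ->. Qed.

Lemma eq_IW h g : h =1 g -> IW h = IW g.
Proof. by move=> /funext ->. Qed.

Lemma IWD h g : intW h -> intW g -> IW (fun x => h x + g x) = IW h + IW g.
Proof.
move=> hh hg; rewrite /IW -RintegralD//.
by apply: eq_Rintegral => x _; rewrite mulrDl.
Qed.

Lemma IWZ c h : intW h -> IW (fun x => c * h x) = c * IW h.
Proof.
move=> hh; rewrite /IW -RintegralZl//.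
by apply: eq_Rintegral => x _; rewrite mulrA.
Qed.

Lemma IW_sum n (F : 'I_n -> R -> R) : (forall i, intW (F i)) ->
  intW (fun x => \sum_i F i x) /\ IW (fun x => \sum_i F i x) = \sum_i IW (F i).
Proof.
elim: n F => [|n IH] F hF.
  split.
    apply: (@bounded_intW _ 0) => [|x]; last by rewrite big_ord0 normr0.
    by under eq_fun do rewrite big_ord0; exact: measurable_cst.
  rewrite big_ord0 /IW; under eq_Rintegral do rewrite big_ord0 mul0r.
  by rewrite Rintegral_cst// mul0r.
have [h1 h2] := IH (fun i => F (widen_ord (leqnSn n) i)) (fun i => hF _).
have E x : \sum_i F i x = \sum_(i < n) F (widen_ord (leqnSn n) i) x + F ord_max x.
  by rewrite big_ord_recr.
split; first by apply: eq_intW (intWD h1 (hF ord_max)) => x; rewrite E.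
by rewrite (eq_IW E) IWD// h2 big_ord_recr.
Qed.

Lemma IW_ge0 h : (forall x, 0 <= h x) -> 0 <= IW h.
Proof. by move=> h0; apply: Rintegral_ge0 => x _; rewrite mulr_ge0// wgt_ge0. Qed.

(** The general real trigonometric polynomial: [p] carries the even part, [sin * q] the odd part. *)
Definition tp (p q : {poly R}) (x : R) : R := p.[cos x] + sin x * q.[cos x].

Lemma continuous_hcos (p : {poly R}) : continuous (fun x : R => p.[cos x]).
Proof.
move=> x; apply: (@continuous_comp _ _ _ (@cos R) (horner p)).
  exact: continuous_cos.
exact: continuous_horner.
Qed.

Lemma continuous_tp p q : continuous (tp p q).
Proof.
move=> x; apply: cvgD; first exact: continuous_hcos.
by apply: cvgM; [exact: continuous_sin|exact: continuous_hcos].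
Qed.

Lemma measurable_tp p q : measurable_fun setT (tp p q).
Proof. apply: continuous_measurable_fun; exact: continuous_tp. Qed.

Lemma bounded_tp p q : exists M, forall x, `|tp p q x| <= M.
Proof.
pose B (p : {poly R}) := \sum_(i < size p) `|p`_i|.
have hB r (x : R) : `|r.[cos x]| <= B r.
  rewrite horner_coef (le_trans (ler_norm_sum _ _ _))// ler_sum// => i _.
  rewrite normrM normrX -[leRHS]mulr1 ler_wpM2l// exprn_ile1//.
  by rewrite ler_norml cos_geN1 cos_le1.
exists (B p + B q) => x; rewrite (le_trans (ler_normD _ _))// lerD// normrM.
by rewrite -[leRHS]mul1r ler_pM// norm_sin_le1.
Qed.

Lemma intW_tp p q : intW (tp p q).
Proof. have [M hM] := bounded_tp p q; exact: bounded_intW (measurable_tp p q) hM. Qed.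

Lemma tpE p x : tp p 0 x = p.[cos x].
Proof. by rewrite /tp horner0 mulr0 addr0. Qed.

Lemma tp0E q x : tp 0 q x = sin x * q.[cos x].
Proof. by rewrite /tp horner0 add0r. Qed.

Lemma sin2cos2' (x : R) : sin x * sin x = 1 - cos x * cos x.
Proof. by have := cos2Dsin2 x; rewrite !expr2 => <-; ring. Qed.

Lemma tpM p q p' q' x : tp p q x * tp p' q' x =
  tp (p * p' + (1 - 'X^2) * (q * q')) (p * q' + q * p') x.
Proof.
rewrite /tp !hE ?expr2.
transitivity (p.[cos x] * p'.[cos x] + (sin x * sin x) * (q.[cos x] * q'.[cos x])
  + sin x * (p.[cos x] * q'.[cos x] + q.[cos x] * p'.[cos x])); first by ring.
by rewrite sin2cos2'; ring.
Qed.

(** The weighted integral as a linear functional on polynomials in [cos]. Odd parts integrate to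
    zero, so all inner products below reduce to it. *)
Definition Mp (p : {poly R}) : R := IW (fun x => p.[cos x]).

Lemma intW_hcos p : intW (fun x => p.[cos x]).
Proof. by apply: eq_intW (intW_tp p 0) => x; rewrite tpE. Qed.

Lemma MpD p q : Mp (p + q) = Mp p + Mp q.
Proof.
rewrite /Mp -IWD; [|exact: intW_hcos..].
by apply: eq_IW => x; rewrite hornerD.
Qed.

Lemma MpZ c p : Mp (c%:P * p) = c * Mp p.
Proof.
rewrite /Mp -IWZ; last exact: intW_hcos.
by apply: eq_IW => x; rewrite hornerCM.
Qed.

Lemma MpN p : Mp (- p) = - Mp p.
Proof. by rewrite -mulN1r -polyCN MpZ mulN1r. Qed.

Lemma MpB p q : Mp (p - q) = Mp p - Mp q.
Proof. by rewrite MpD MpN. Qed.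

Lemma Mp0 : Mp 0 = 0.
Proof. by rewrite -[0](mul0r 0) -polyC0 MpZ mul0r. Qed.

Lemma Mp_sum n (F : 'I_n -> {poly R}) : Mp (\sum_i F i) = \sum_i Mp (F i).
Proof. by apply: (big_morph _ MpD Mp0). Qed.

Lemma abspow_cvg0 (a : R) : 0 < a -> (`|y| `^ a @[y --> (0 : R)] --> (0 : R)).
Proof.
move=> a0; apply/cvgrPdist_lt => e e0; near=> y.
rewrite sub0r normrN ger0_norm ?powR_ge0//.
have -> : e = (e `^ a^-1) `^ a by rewrite -powRrM mulVf ?gt_eqF// powRr1// ltW.
rewrite gt0_ltr_powR ?nnegrE ?powR_ge0//.
near: y; apply: (@nbhs0_lt _ (R : normedModType R)); exact: powR_gt0.
Unshelve. all: by end_near. Qed.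

Lemma continuous_abspow (a : R) : 0 < a -> continuous (fun y : R => `|y| `^ a).
Proof.
move=> a0 y; have [->|y0] := eqVneq y 0.
  by rewrite /continuous_at normr0 powR0 ?gt_eqF//; exact: abspow_cvg0.
apply: (@continuous_comp _ _ _ (fun y : R => `|y|) (@powR R ^~ a)); first exact: norm_continuous.
apply/differentiable_continuous/derivable1_diffP.
by apply: derivable_powR; rewrite in_itv/= normr_gt0 y0.
Qed.

(** The extra factor [y] gives differentiability at 0 too, where [|y|^a] alone may have a cusp; the
    exponent used later is [2k], which can be less than 1. *)
Lemma is_derive_abspow (a y : R) : 0 < a ->
  is_derive y 1 (fun y : R => y * `|y| `^ a) ((a + 1) * `|y| `^ a).
Proof.
move=> a0.
have pos (z : R) : 0 < z -> is_derive z 1 (fun y : R => y * y `^ a) ((a + 1) * z `^ a).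
  move=> z0.
  have d := is_deriveM (is_derive_id z 1) (is_derive1_powR a z0).
  refine (is_derive_eq d _); rewrite /GRing.scale/=.
  have -> : z * (a * z `^ (a - 1)) = a * (z * z `^ (a - 1)) by ring.
  by rewrite mulr_powRB1 ?(ltW z0)//; ring.
have [y0|y0|->] := ltgtP y 0.
- have Ny0 : 0 < - y by rewrite oppr_gt0.
  have d2 := is_deriveN (is_derive1_comp (pos _ Ny0) (is_deriveNid y 1)).
  rewrite ltr0_norm//; apply: near_eq_is_derive; last first.
    by refine (is_derive_eq d2 _); rewrite mulrN1 opprK.
  near=> z; rewrite /= [in RHS]ltr0_norm; last by near: z; exact: lt_nbhsl.
  by rewrite fctE /= mulNr opprK.
- rewrite gtr0_norm//; apply: near_eq_is_derive (pos _ y0).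
  by near=> z; rewrite gtr0_norm//; near: z; exact: lt_nbhsr.
- rewrite normr0 powR0 ?gt_eqF// mulr0.
  have C : h^-1 *: (((fun y : R => y * `|y| `^ a) \o shift 0) (h *: (1 : R)) - (0 : R) * `|(0 : R)| `^ a)
      @[h --> (0 : R)^'] --> (0 : R).
    have H : `|h| `^ a @[h --> (0 : R)^'] --> (0 : R).
      by apply: cvg_trans (abspow_cvg0 a0); apply: cvg_app; exact: nbhs_dnbhs.
    apply: cvg_trans H; apply: near_eq_cvg; near=> h.
    rewrite /= mul0r subr0 addr0 [h *: 1]mulr1 /GRing.scale/= mulrA mulVf ?mul1r//.
    by near: h; exact: nbhs_dnbhs_neq.
  by apply: DeriveDef; [exact: cvgP C|exact: cvg_lim C].
Unshelve. all: by end_near. Qed.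

Lemma continuous_wk : continuous (wk k).
Proof.
move=> x; apply: (@continuous_comp _ _ _ (@sin R) (fun y => `|y| `^ (2 * k))).
  exact: continuous_sin.
by apply: continuous_abspow; rewrite mulr_gt0.
Qed.

Lemma Npi_lt_pi : - pi < pi :> R.
Proof. by have := pi_gt0 R; lra. Qed.

(** [sin |sin|^(2k) q(cos)] vanishes at both ends of the interval, so its derivative integrates to
    zero. *)
Lemma Mp_byparts q : Mp ((2 * k + 1)%:P * ('X * q)) = Mp ((1 - 'X^2) * q^`()).
Proof.
apply/eqP; rewrite -subr_eq0 -MpB; apply/eqP.
pose F (x : R) := (sin x * `|sin x| `^ (2 * k)) * q.[cos x].
pose f (x : R) := ((2 * k + 1)%:P * ('X * q) - (1 - 'X^2) * q^`()).[cos x] * wk k x.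
have k2 : 0 < 2 * k by rewrite mulr_gt0.
have dF (x : R) : is_derive x 1 F (f x).
  have d1 := is_derive1_comp (is_derive_abspow (sin x) k2) (is_derive_sin x).
  have d2 := is_derive1_comp (is_derive_poly q (cos x)) (is_derive_cos x).
  have d := is_deriveM d1 d2; refine (is_derive_eq d _).
  rewrite /f /wk !hE /GRing.scale/= ?expr2.
  set w := _ `^ _.
  transitivity ((2 * k + 1) * cos x * q.[cos x] * w -
    (sin x * sin x) * (q^`().[cos x] * w)); first by ring.
  by rewrite sin2cos2'; ring.
rewrite /Mp IWE /Rintegral (@continuous_FTC2 _ f F); first last.
- by move=> x _; rewrite derive1E; apply: derive_val.
- have cF x : {for x, continuous F}.
    by apply/differentiable_continuous/derivable1_diffP; exact: ex_derive.
  split.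
  + by move=> x _; exact: ex_derive.
  + apply: cvg_at_right_filter; exact: cF.
  + apply: cvg_at_left_filter; exact: cF.
- apply: continuous_subspaceT => x; apply: cvgM; first exact: continuous_hcos.
  exact: continuous_wk.
- exact: Npi_lt_pi.
by rewrite /F sinN sinpi oppr0 !mul0r subee.
Qed.

Lemma IW_odd (h : R -> R) : continuous h -> (forall x, h (- x) = - h x) -> IW h = 0.
Proof.
move=> ch oh; have cf : continuous (fun x => h x * wk k x).
  by move=> x; apply: cvgM; [exact: ch|exact: continuous_wk].
have := @integration_by_substitution_oppr _ (fun x => h x * wk k x) (- pi) pi.
rewrite opprK => /(_ (ltW Npi_lt_pi) (continuous_subspaceT cf)) E.
have E2 : IW h = - IW h.
  rewrite !IWE -[RHS]mulN1r -RintegralZl; last 2 first.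
  - exact: measurable_Dpi.
  - apply: continuous_compact_integrable; first exact: segment_compact.
    exact: continuous_subspaceT.
  rewrite /Rintegral {1}/Dpi E; congr fine; apply: eq_integral => x _.
  by rewrite fctE /= oh /wk sinN normrN mulNr mulN1r.
by apply/eqP; move/eqP: E2; rewrite -addr_eq0 -mulr2n mulrn_eq0.
Qed.

Lemma IW_tp p q : IW (tp p q) = Mp p.
Proof.
rewrite /tp IWD; [|exact: intW_hcos|]; last first.
  by apply: eq_intW (intW_tp 0 q) => x; rewrite tp0E.
rewrite [X in _ + X]IW_odd ?addr0//.
  by move=> x; apply: cvgM; [exact: continuous_sin|exact: continuous_hcos].
by move=> x; rewrite sinN cosN mulNr.
Qed.

Local Notation geg := (geg k).
Local Notation glam := (glam k).

(** Green's formula: integrate by parts with [geg' p] and substitute the differential equation. For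
    [p = geg m] the left side is symmetric in [n] and [m], which is the source of orthogonality. *)
Lemma Mp_deriv_geg n p :
  Mp ((1 - 'X^2) * ((geg n)^`() * p^`())) = glam n * Mp (geg n * p).
Proof.
have := Mp_byparts ((geg n)^`() * p); rewrite derivM mulrDr MpD.
rewrite [X in _ = Mp X + _]mulrA geg_ode// -MpZ => E.
have -> : Mp ((1 - 'X^2) * ((geg n)^`() * p^`())) =
   Mp ((2 * k + 1)%:P * ('X * ((geg n)^`() * p))) -
   Mp (((2 * k + 1)%:P * 'X * (geg n)^`() - (glam n)%:P * geg n) * p).
  by rewrite E addrAC subrr add0r.
by rewrite -MpB; congr Mp; ring.
Qed.

Lemma Mp_orth n m : n != m -> Mp (geg n * geg m) = 0.
Proof.
move=> nm; have := Mp_deriv_geg n (geg m).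
have -> : (geg n)^`() * (geg m)^`() = (geg m)^`() * (geg n)^`() by rewrite mulrC.
rewrite Mp_deriv_geg (mulrC (geg m)) => /eqP; rewrite -subr_eq0 -mulrBl mulf_eq0.
by rewrite subr_eq0 (inj_eq (glam_inj k_gt0)) eq_sym (negbTE nm) => /eqP.
Qed.

Definition hn n := Mp (geg n * geg n).

(** With [Y] the integral of [x geg_n geg_(n+1)], the raising and lowering relations evaluate one
    integral in two ways, and integrating by parts with [geg_n geg_(n+1)] gives a further equation.
    Eliminating [Y] leaves the ratio of the squared norms. *)
Lemma hnS n : (n%:R + 2 * k) * (n.+1%:R + k) * hn n.+1 = (n%:R + k) * n.+1%:R * hn n.
Proof.
pose Y := Mp ('X * (geg n * geg n.+1)).
have Ea : Mp ((1 - 'X^2) * ((geg n)^`() * geg n.+1)) = (n%:R + 2 * k) * (Y - hn n.+1).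
  rewrite mulrA geg_raise// -MpB -MpZ; congr Mp; ring.
have Ea' : Mp ((1 - 'X^2) * ((geg n)^`() * geg n.+1)) = - n%:R * Y.
  case: n {Ea} @Y => [|n] Y; first by rewrite derivC mul0r mulr0 Mp0 oppr0 mul0r.
  rewrite mulrA geg_lower// -mulrA MpZ mulrBl MpB Mp_orth ?ltn_eqF// sub0r.
  by rewrite mulrN mulNr /Y -mulrA.
have Eb : Mp ((1 - 'X^2) * (geg n * (geg n.+1)^`())) = n.+1%:R * (hn n - Y).
  rewrite (mulrC (geg n)) mulrA geg_lower// -MpB -MpZ; congr Mp; ring.
have := Mp_byparts (geg n * geg n.+1).
rewrite derivM [(1 - 'X^2) * (_ + _)]mulrDr MpD Ea Eb MpZ -/Y.
have {Ea Ea'} : (n%:R + 2 * k) * (Y - hn n.+1) = - n%:R * Y by rewrite -Ea.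
move: Y (hn n) (hn n.+1) {Eb} => Y h h' E1 E2.
have {}E1 : Y * (2 * (n%:R + k)) = (n%:R + 2 * k) * h'.
  apply/eqP; rewrite -subr_eq0; apply/eqP.
  transitivity ((n%:R + 2 * k) * (Y - h') - (- n%:R * Y)); first by ring.
  by rewrite E1 subrr.
have {}E2 : n.+1%:R * h - (n%:R + 2 * k) * h' = 2 * Y.
  apply/eqP; rewrite -subr_eq0; apply/eqP.
  transitivity ((n%:R + 2 * k) * (Y - h') + n.+1%:R * (h - Y) - (2 * k + 1) * Y).
    by rewrite -natr1; ring.
  by rewrite -E2 subrr.
have : (n%:R + k) * (n.+1%:R * h - (n%:R + 2 * k) * h') = (n%:R + 2 * k) * h'.
  by rewrite E2 -E1; ring.
move=> E; apply/eqP; rewrite -subr_eq0; apply/eqP.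
transitivity ((n%:R + 2 * k) * h' - (n%:R + k) * (n.+1%:R * h - (n%:R + 2 * k) * h')).
  by rewrite -natr1; ring.
by rewrite E subrr.
Qed.

(** The weight is bounded below by a positive constant on [[pi/4, pi/2]], where [sin] increases. *)
Lemma hn0_gt0 : 0 < hn 0.
Proof.
pose a : R := pi / 4; pose b : R := pi / 2.
have p0 := pi_gt0 R.
have ab : a < b by rewrite /a /b; lra.
pose h0 : R := sin a `^ (2 * k).
have sa : 0 < sin a by apply: sin_gt0_pi; rewrite /a; lra.
have h00 : 0 < h0 by rewrite powR_gt0.
apply: (@lt_le_trans _ _ (h0 * (b - a))); first by rewrite mulr_gt0// subr_gt0.
rewrite /hn /Mp /IW.
have -> : h0 * (b - a) = \int[mu]_x (h0 * \1_(`[a, b] : set R) x).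
  rewrite RintegralZl//; last first.
    exact: integrable_indic_itv.
  have H : mu `[a, b]%classic = (b - a)%:E.
    by rewrite lebesgue_measure_itv/= lte_fin ab -EFinB.
  by congr (_ * _); rewrite /Rintegral integral_indic// setIT; exact: esym (congr1 fine H).
apply: le_Rintegral => //.
- have := integrableZl measurableT h0 (integrable_indic_itv a b true false).
  by apply: eq_integrable => // x _; rewrite /= -EFinM.
- exact: intW_hcos.
move=> x _; rewrite !hE mul1r indicE mul1r; case: (boolP (x \in _)); last first.
  by rewrite mulr0 wgt_ge0.
rewrite inE /= in_itv/= mulr1 => /andP[ax xb].
rewrite wgt_in; last by rewrite /Dpi /= in_itv/=; move: ax xb; rewrite /a /b; lra.
rewrite /wk /h0 ge0_ler_powR ?nnegrE ?(ltW sa)//; first by rewrite mulr_ge0// ltW.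
rewrite ger0_norm ?sin_ge0_pi//; last by move: ax xb; rewrite /a /b; lra.
by rewrite leNgt ltr_sin ?in_itv/= -?leNgt//; move: ax xb; rewrite /a /b; lra.
Qed.

Lemma hn_gt0 n : 0 < hn n.
Proof.
elim: n => [|n IH]; first exact: hn0_gt0.
have nk (m : nat) : 0 < m%:R + k by rewrite ltr_wpDl.
have := hnS n; have := mulr_gt0 (mulr_gt0 (nk n) (ltr0Sn R n)) IH => + E.
rewrite -E pmulr_rgt0// mulr_gt0// n2k_gt0//.
Qed.

Lemma Mp_orth_deriv n m : n != m -> Mp ((1 - 'X^2) * ((geg n)^`() * (geg m)^`())) = 0.
Proof. by move=> nm; rewrite Mp_deriv_geg Mp_orth// mulr0. Qed.

Lemma Mp_deriv_sqr n : Mp ((1 - 'X^2) * ((geg n)^`() * (geg n)^`())) = glam n * hn n.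
Proof. exact: Mp_deriv_geg. Qed.

Lemma sonin_le n (x : R) : -1 <= x <= 1 ->
  (1 - x ^+ 2) * (geg n)^`().[x] ^+ 2 + glam n * (geg n).[x] ^+ 2 <= glam n.
Proof.
have H (y : R) : 0 <= y <= 1 ->
  (1 - y ^+ 2) * (geg n)^`().[y] ^+ 2 + glam n * (geg n).[y] ^+ 2 <= glam n.
  move=> /andP[y0]; rewrite le_eqVlt => /predU1P[->|y1].
    by rewrite expr1n subrr mul0r add0r geg_at1 expr1n mulr1.
  have [c /andP[yc c1] E] := poly_mvt (sonin k n) y1.
  have : 0 <= (sonin k n).[1] - (sonin k n).[y].
    rewrite E mulr_ge0 ?subr_ge0 ?(ltW y1)// deriv_sonin// !hE.
    rewrite bnd_simp in yc.
    by rewrite mulr_ge0 ?sqr_ge0// mulr_ge0 ?mulr_ge0 ?(ltW k_gt0)// (le_trans y0)// ltW.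
  have -> : (sonin k n).[1] = glam n by rewrite /sonin !hE geg_at1; ring.
  have -> : (sonin k n).[y] = (1 - y ^+ 2) * (geg n)^`().[y] ^+ 2 + glam n * (geg n).[y] ^+ 2.
    by rewrite /sonin !hE; ring.
  by rewrite subr_ge0.
move=> /andP[xN x1]; have [x0|x0] := leP 0 x; first by apply: H; rewrite x0.
have := H (- x); rewrite !sqrrN; have [-> ->] := geg_atN k_gt0 x n.
rewrite !exprMn -!exprM ![(_ * 2)%N]mulnC !exprM !sqrrN !expr1n !mul1r; apply.
by rewrite oppr_ge0 ltW//= lerNl.
Qed.

(* [bn n] is the binomial coefficient [(2k+1)_n / n!] of [(1 - r)^(-2k-1)] *)
Fixpoint bn n : R := if n is m.+1 then bn m * (m%:R + 2 * k + 1) / m.+1%:R else 1.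

Lemma bn_gt0 n : 0 < bn n.
Proof.
elim: n => [|n IH]/=; first by [].
by rewrite divr_gt0// mulr_gt0// ltr_wpDl// ltW// n2k_gt0.
Qed.

(** The recursion for [hn] telescopes to the exact value [(bn n / hn 0) (2 (n + k) / (n + 2k))],
    whose last factor is at most 2. *)
Lemma hnV n : (hn n)^-1 <= 2 * (hn 0)^-1 * bn n.
Proof.
have h0 : hn 0 != 0 by rewrite gt_eqF// hn_gt0.
have nk (m : nat) : 0 < m%:R + k by rewrite ltr_wpDl.
have -> : (hn n)^-1 = (hn 0)^-1 * bn n * (2 * (n%:R + k) / (n%:R + 2 * k)).
  elim: n => [|n IH].
    rewrite /= mulr1 !add0r mulrV ?mulr1// unitfE mulf_neq0// gt_eqF//.
  have E : hn n.+1 = (n%:R + k) * n.+1%:R * hn n / ((n%:R + 2 * k) * (n.+1%:R + k)).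
    rewrite -hnS mulrAC divff ?mul1r// mulf_neq0 ?gt_eqF//.
    exact: n2k_gt0.
  rewrite E !invfM invrK IH /=.
  have e1 : n%:R + k != 0 by rewrite gt_eqF.
  have e2 : n%:R + 2 * k != 0 by rewrite gt_eqF// n2k_gt0.
  have e3 : n.+1%:R != 0 :> R by [].
  have e4 : n.+1%:R + 2 * k != 0 by rewrite gt_eqF// n2k_gt0.
  have -> : n%:R + 2 * k + 1 = n.+1%:R + 2 * k by rewrite -natr1; ring.
  have e5 : n.+1%:R + k != 0 by rewrite gt_eqF.
  move: (n.+1%:R : R) (n%:R : R) (bn n) (hn 0) h0 e1 e2 e3 e4 e5 => N1 N b h h0 e1 e2 e3 e4 e5.
  by clear IH E; field; rewrite h0 e1 e2 e3 e4 e5.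
rewrite [leRHS](_ : _ = (hn 0)^-1 * bn n * 2); last by ring.
rewrite ler_wpM2l//; first by rewrite mulr_ge0// ?invr_ge0 ltW// ?hn_gt0 ?bn_gt0.
rewrite ler_pdivrMr ?n2k_gt0// ler_pM2l// lerD2l.
by have := k_gt0; lra.
Qed.

(** A truncation of [(1 - x) S' = (2k + 1) S], the equation of [(1 - x)^(-2k-1)]. The truncation
    error is a monomial with a negative sign, which decides the inequality that follows. *)
Lemma sum_bn_deriv n (S := fun n => \sum_(i < n) (bn i)%:P * 'X^i) :
  (1 - 'X) * (S n.+1)^`() =
  (2 * k + 1)%:P * S n.+1 - ((n%:R + 2 * k + 1) * bn n)%:P * 'X^n.
Proof.
elim: n => [|n IH].
  rewrite /S big_ord_recr big_ord0 /= add0r expr0 mulr1 derivC mulr0 mulr1.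
  by rewrite add0r mulr1 polyC1 mulr1 subrr.
have -> : S n.+2 = S n.+1 + (bn n.+1)%:P * 'X^(n.+1) by rewrite /S big_ord_recr.
rewrite derivD derivM derivC mul0r add0r derivXn /= mulrDr IH.
have -> : (bn n.+1)%:P * ('X^n *+ n.+1) = ((n%:R + 2 * k + 1) * bn n)%:P * 'X^n.
  rewrite -mulr_natl mulrA; congr (_ * _).
  rewrite -polyC1 -polyCMn -polyCM /= [in RHS]mulrC.
  by rewrite divfK.
rewrite (_ : bn n * (n%:R + 2 * k + 1) / n.+1%:R = bn n.+1)//.
have -> : ((n%:R + 2 * k + 1) * bn n)%:P = n.+1%:R%:P * (bn n.+1)%:P :> {poly R}.
  by rewrite -polyCM /= [in RHS]mulrC divfK// mulrC.
have -> : ((n.+1%:R + 2 * k + 1) * bn n.+1)%:P =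
    (n.+1%:R%:P + (2 * k + 1)%:P) * (bn n.+1)%:P :> {poly R}.
  by rewrite -polyCD -polyCM addrA.
by rewrite exprS; ring.
Qed.

(** By the truncated equation [(1 - x)^(2k+1) S(x)] has nonpositive derivative for [0 < x < 1], and
    it equals 1 at 0. This bounds the partial sums directly, without summing the binomial series. *)
Lemma sum_bn_le r n : 0 <= r < 1 ->
  \sum_(i < n) bn i * r ^+ i <= (1 - r) `^ (- (2 * k + 1)).
Proof.
case: n => [|n] /andP[r0 r1]; first by rewrite big_ord0 powR_ge0.
pose S := \sum_(i < n.+1) (bn i)%:P * 'X^i.
have SE x : S.[x] = \sum_(i < n.+1) bn i * x ^+ i.
  by rewrite horner_sum; apply: eq_bigr => i _; rewrite !hE.
pose c := 2 * k + 1.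
have [->|r0'] := eqVneq r 0.
  rewrite subr0 powR1 big_ord_recl expr0 mulr1 big1 ?addr0// => i _.
  by rewrite exprS mul0r mulr0.
have {}r0 : 0 < r by rewrite lt_neqAle eq_sym r0'.
pose f x := (1 - x) `^ c * S.[x].
pose df x := (1 - x) `^ c * S^`().[x] - c * (1 - x) `^ (c - 1) * S.[x].
have dfx (x : R) : x < 1 -> is_derive x 1 f (df x).
  move=> x1; have x1' : 0 < 1 - x by rewrite subr_gt0.
  have d0 : is_derive x 1 (fun x => 1 - x : R) (0 - 1).
    exact: is_deriveB.
  have d1 := @is_derive1_comp _ (@powR R ^~ c) (fun x => 1 - x) x _ _ (is_derive1_powR c x1') d0.
  have d := is_deriveM d1 (is_derive_poly S x).
  by refine (is_derive_eq d _); rewrite /df /GRing.scale/=; ring.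
have [||x + E] := @MVT _ f df 0 r r0.
- by move=> x; rewrite in_itv/= => /andP[_ xr]; apply: dfx; exact: lt_trans xr r1.
- apply: derivable_within_continuous => x; rewrite in_itv/= => /andP[_ xr].
  by have dx := dfx _ (le_lt_trans xr r1); exact: ex_derive.
rewrite in_itv/= => /andP[x0 xr].
have x1 : 0 < 1 - x by rewrite subr_gt0 (lt_trans xr).
have df0 : df x <= 0.
  rewrite /df -(@mulr_powRB1 _ (1 - x) c) ?(ltW x1)//; last first.
    by rewrite /c; have := k_gt0; lra.
  rewrite [leLHS](_ : _ = (1 - x) `^ (c - 1) * (((1 - 'X) * S^`()).[x] - c * S.[x])); last first.
    by rewrite !hE; ring.
  rewrite sum_bn_deriv !hE -/S mulr_ge0_le0 ?powR_ge0//.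
  rewrite /c addrAC subrr sub0r oppr_le0 mulr_ge0 ?exprn_ge0 ?(ltW x0)//.
  by rewrite mulr_ge0 ?(ltW (bn_gt0 n))// -addrA addr_ge0// /c ltW//; have := k_gt0; lra.
have : f r <= f 0.
  by rewrite -subr_le0 E mulr_le0_ge0// subr0 ltW.
have S0 : S.[0] = 1.
  rewrite SE big_ord_recl expr0 mulr1 big1 ?addr0// => i _.
  by rewrite exprS mul0r mulr0.
rewrite /f subr0 powR1 mul1r S0 SE.
have p0 : 0 < (1 - r) `^ c by rewrite powR_gt0// subr_gt0.
by move=> H; rewrite powRN -(ler_pM2l p0) mulfV ?gt_eqF.
Qed.

End Weight.

(** * The maximum principle *)

Lemma is_derive_sumf (R : realType) n (F : 'I_n -> R -> R) (dF : 'I_n -> R) (x : R) :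
  (forall i, is_derive x 1 (F i) (dF i)) ->
  is_derive x 1 (fun x => \sum_i F i x) (\sum_i dF i).
Proof.
move=> h; have -> : (fun x => \sum_i F i x) = \sum_i F i.
  by apply/funext => y; rewrite fct_sumE.
exact: is_derive_sum.
Qed.

(** A negative second derivative at [c] would make [f'] negative just to the right of [c], and the
    mean value theorem would give a value below the minimum there. *)
Lemma deriv2_at_min (R : realType) (f f' f'' : R -> R) (c d : R) : 0 < d ->
  (forall x : R, is_derive x 1 f (f' x)) ->
  (forall x : R, is_derive x 1 f' (f'' x)) ->
  (forall x, `|x - c| < d -> f c <= f x) -> f' c = 0 /\ 0 <= f'' c.
Proof.
move=> d0 df df' fc.
have inI t : t \in `](c - d), (c + d)[%R -> `|t - c| < d.
  by rewrite in_itv/= ltr_distl.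
have cI : c \in `](c - d), (c + d)[%R by rewrite in_itv/=; lra.
have f'c : f' c = 0.
  have [||||_ <-] := @derive1_at_min _ f (c - d) (c + d) c => //.
  - by lra.
  - by move=> t /inI; exact: fc.
  - by rewrite derive_val.
split => //; rewrite leNgt; apply/negP => f''c.
have H : h^-1 *: ((f' \o shift c) (h *: (1 : R)) - f' c) @[h --> (0 : R)^'] --> f'' c.
  have [dc <-] := df' c; exact: dc.
have {H} : \forall h \near (0 : R)^', h^-1 *: ((f' \o shift c) (h *: (1 : R)) - f' c) < 0.
  by move/cvgrPdist_lt : H => /(_ (- f'' c)); rewrite oppr_gt0 => /(_ f''c);
  apply: filterS => h; rewrite ltr_distl => /andP[]; lra.
rewrite /dnbhs /within /= nearE => /nbhs_ballP[e /= e0 He].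
pose h := Num.min e d / 2.
have me : 0 < Num.min e d by rewrite lt_min e0 d0.
have h0 : 0 < h by rewrite divr_gt0.
have hd : h < d.
  have m : Num.min e d <= d by rewrite ge_min lexx orbT.
  by rewrite /h; lra.
have he : h < e.
  have m : Num.min e d <= e by rewrite ge_min lexx.
  by rewrite /h; lra.
have [||x] := @MVT _ f f' c (c + h).
- by lra.
- by apply: derivable_within_continuous => z _; exact: ex_derive.
rewrite in_itv/= => /andP[cx xh].
have := fc (c + h); rewrite addrAC subrr add0r gtr0_norm// => /(_ hd).
rewrite -subr_ge0 => + E; rewrite E pmulr_lge0//.
have xc0 : 0 < x - c by lra.
have xb : ball (0 : R) e (x - c).
  by rewrite -ball_normE /ball_ /= sub0r normrN gtr0_norm//; lra.
have := He _ xb; rewrite gt_eqF// => /(_ isT); rewrite f'c subr0 /= [_ *: 1]mulr1 subrK.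
by rewrite /GRing.scale/= pmulr_rlt0 ?invr_gt0// ltNge => /negbTE ->.
Qed.

Section MaxPrinciple.
Variables (R : realType) (k : R).
Hypothesis k_gt0 : 0 < k.
Local Notation geg := (geg k).
Local Notation glam := (glam k).
Implicit Types p q : {poly R}.

Lemma is_derive_tp p q (x : R) :
  is_derive x 1 (tp p q) (tp ('X * q - (1 - 'X^2) * q^`()) (- p^`()) x).
Proof.
have d1 := is_derive1_comp (is_derive_poly p (cos x)) (is_derive_cos x).
have d2 := is_derive1_comp (is_derive_poly q (cos x)) (is_derive_cos x).
have d := is_deriveD d1 (is_deriveM (is_derive_sin x) d2).
refine (is_derive_eq d _); rewrite /tp !hE /GRing.scale/= ?expr2 -sin2cos2'; ring.
Qed.

(* the angular part of the Dunkl Laplacian on [p(cos) + sin * q(cos)] *)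
Definition Lop p q : R -> R :=
  tp ((1 - 'X^2) * p^`()^`() - (2 * k + 1)%:P * 'X * p^`())
     ((1 - 'X^2) * q^`()^`() - (2 * k + 3)%:P * 'X * q^`() - (2 * k + 1)%:P * q).

(** Away from the zeros of [sin], [L u = u'' + 2k cot(x) u' - k (u(x) - u(-x)) / sin(x)^2]. At a
    global minimum the first term is nonnegative, the second vanishes, and [u(-x)] is no smaller
    than [u(x)], so the nonlocal term has the right sign too. *)
Lemma Lop_at_min p q x : (forall y, tp p q x <= tp p q y) -> 0 <= Lop p q x.
Proof.
move=> xmin.
have [u1 u2] := deriv2_at_min (ltr01 : 0 < 1 :> R) (is_derive_tp p q)
  (is_derive_tp ('X * q - (1 - 'X^2) * q^`()) (- p^`())) (fun y _ => xmin y).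
have u3 := xmin (- x); move: u1 u2 u3; rewrite /Lop /tp sinN cosN.
rewrite !derivB !derivN !derivM !derivB !derivX !derivC ?derivXn.
rewrite !hE ?derivC ?hE ?expr2 ?horner0.
have := sin2cos2' x.
have := k_gt0.
move: (sin x) (cos x) => s c k0 sc.
rewrite -sc => u1 u2 u3.
set L := (X in 0 <= X).
set U2 := (X in 0 <= X) in u2.
set U1 := (X in X = 0) in u1.
have key : (s * s) * L = (s * s) * U2 + (2 * k) * (- (s * q.[c])) + 2 * k * c * s * U1
    - 2 * k * s * q.[c] * (c * c + s * s - 1).
  by rewrite /L /U2 /U1; ring.
(* At a zero of [sin] the quotients degenerate and [L u] is [(2k + 1) u'']. *)
have [s0|s0] := eqVneq s 0.
  have := mulr_ge0 (_ : 0 <= 2 * k + 1) u2.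
  rewrite /L /U2 s0 => H; rewrite [leRHS](_ : _ = (2 * k + 1) * U2).
    by rewrite mulr_ge0//; lra.
  by rewrite /U2 s0; ring.
have ss : 0 < s * s by rewrite -expr2 exprn_even_gt0.
rewrite -(pmulr_rge0 _ ss) key u1 mulr0 addr0 sc.
have -> : c * c + (1 - c * c) - 1 = 0 by ring.
rewrite mulr0 subr0 addr_ge0// mulr_ge0//; first by rewrite -sc ltW.
  by rewrite ltW// mulr_gt0.
by lra.
Qed.

Lemma derivZ_C (c : R) p : (c%:P * p)^`() = c%:P * p^`().
Proof. by rewrite derivM derivC mul0r add0r. Qed.

(** * The flow of damped Gegenbauer expansions *)

Section Flow.
Variables (N : nat) (a b : nat -> R).

Definition flowE (t : R) : {poly R} := \sum_(n < N) (expR (- (n%:R * t)) * a n)%:P * geg n.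
Definition flowO (t : R) : {poly R} :=
  \sum_(n < N) (expR (- (n%:R * t)) * b n)%:P * (geg n)^`().
Definition flow (t x : R) : R := \sum_(n < N) expR (- (n%:R * t)) *
  (a n * (geg n).[cos x] + b n * (sin x * (geg n)^`().[cos x])).

Lemma flowEO t x : flow t x = tp (flowE t) (flowO t) x.
Proof.
rewrite /flow /tp /flowE /flowO !horner_sum mulr_sumr -big_split /=.
by apply: eq_bigr => n _; rewrite !hE; ring.
Qed.

Lemma LopD p q p' q' x : Lop (p + p') (q + q') x = Lop p q x + Lop p' q' x.
Proof. by rewrite /Lop /tp !derivD !hE; ring. Qed.

(** The differentiated Gegenbauer equation: the odd family is built on [geg'], so its Laplacian
    involves the third derivative. *)
Lemma geg_ode_deriv n : (1 - 'X^2) * (geg n)^`()^`()^`() =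
  (2 * k + 3)%:P * 'X * (geg n)^`()^`() +
  (2 * k + 1)%:P * (geg n)^`() - (glam n)%:P * (geg n)^`().
Proof.
have : ((1 - 'X^2) * (geg n)^`()^`())^`() =
  ((2 * k + 1)%:P * 'X * (geg n)^`() - (glam n)%:P * geg n)^`() by rewrite geg_ode.
rewrite derivM derivB derivC derivXn /= derivB derivZ_C -mulrA derivZ_C derivM derivX expr1.
have -> : (2 * k + 3)%:P = (2 * k + 1)%:P + 2 :> {poly R}.
  have -> : 2 = 2%:P :> {poly R} by rewrite polyCMn polyC1.
  by rewrite -polyCD; congr (_%:P); ring.
move: ((2 * k + 1)%:P : {poly R}) => K E.
have -> : (1 - 'X^2) * (geg n)^`()^`()^`() = (0 - 'X *+ 2) * (geg n)^`()^`() +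
   (1 - 'X^2) * (geg n)^`()^`()^`() + 2 * 'X * (geg n)^`()^`() by ring.
by rewrite E; ring.
Qed.

Lemma Lop_term c d n x : Lop (c%:P * geg n) (d%:P * (geg n)^`()) x =
  - (glam n * (c * (geg n).[cos x] + d * (sin x * (geg n)^`().[cos x]))).
Proof.
have e1 := congr1 (horner ^~ (cos x)) (geg_ode k_gt0 n).
have e2 := congr1 (horner ^~ (cos x)) (geg_ode_deriv n).
move: e1 e2; rewrite /Lop /tp !derivZ_C !hE ?expr2 => e1 e2.
set A := (1 - _) * _ in e1; set B := (1 - _) * _ in e2.
rewrite [LHS](_ : _ = c * A + d * sin x * B - c * ((2 * k + 1) * cos x * (geg n)^`().[cos x])
  - d * sin x * ((2 * k + 3) * cos x * (geg n)^`()^`().[cos x])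
  - d * sin x * ((2 * k + 1) * (geg n)^`().[cos x])); last by rewrite /A /B; ring.
by rewrite e1 e2; ring.
Qed.

Lemma Lop_flow t x : Lop (flowE t) (flowO t) x =
  - \sum_(n < N) glam n * (expR (- (n%:R * t)) *
  (a n * (geg n).[cos x] + b n * (sin x * (geg n)^`().[cos x]))).
Proof.
rewrite /flowE /flowO; elim: N => [|M IH].
  by rewrite !big_ord0 /Lop /tp !deriv0 !mulr0 !subrr !horner0 mulr0 addr0 oppr0.
by rewrite !big_ord_recr /= LopD IH Lop_term opprD; congr (_ + _); ring.
Qed.

Definition flow1 (t x : R) : R := \sum_(n < N) - n%:R * (expR (- (n%:R * t)) *
  (a n * (geg n).[cos x] + b n * (sin x * (geg n)^`().[cos x]))).
Definition flow2 (t x : R) : R := \sum_(n < N) n%:R ^+ 2 * (expR (- (n%:R * t)) *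
  (a n * (geg n).[cos x] + b n * (sin x * (geg n)^`().[cos x]))).

Lemma is_derive_expNn (n : nat) (t : R) :
  is_derive t 1 (fun t => expR (- (n%:R * t))) (- n%:R * expR (- (n%:R * t))).
Proof.
have d0 : is_derive t 1 (fun t : R => - (n%:R * t)) (- n%:R).
  have d := is_deriveN (is_deriveZ (n%:R : R) (is_derive_id t 1)).
  by refine (is_derive_eq d _); rewrite /GRing.scale/= mulr1.
have d := @is_derive1_comp _ expR (fun t => - (n%:R * t)) t _ _ (is_derive_expR _) d0.
by refine (is_derive_eq d _); rewrite mulrC.
Qed.

Lemma is_derive_cM (c t df : R) (f : R -> R) : is_derive t 1 f df ->
  is_derive t 1 (fun t => f t * c) (df * c).
Proof.
move=> d; have d' := is_deriveZ c d.
rewrite (_ : (fun t => _) = c *: f); last by apply/funext => y; rewrite fctE mulrC.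
by refine (is_derive_eq d' _); rewrite /GRing.scale/= mulrC.
Qed.

Lemma is_derive_flow x (t : R) : is_derive t 1 (flow ^~ x) (flow1 t x).
Proof.
apply: is_derive_sumf => n; have d := is_derive_cM (a n * (geg n).[cos x] +
  b n * (sin x * (geg n)^`().[cos x])) (is_derive_expNn n t).
by refine (is_derive_eq d _); ring.
Qed.

Lemma is_derive_flow1 x (t : R) : is_derive t 1 (flow1 ^~ x) (flow2 t x).
Proof.
apply: is_derive_sumf => n; set c := a n * _ + _.
have d := is_derive_cM (- n%:R * c) (is_derive_expNn n t).
rewrite (_ : (fun x => _) = (fun t => expR (- (n%:R * t)) * (- n%:R * c))).
  by refine (is_derive_eq d _); ring.
by apply/funext => y; ring.
Qed.

(** Level by level this is [n^2 + 2 k n - glam n = 0]. *)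
Lemma flow_pde t x : flow2 t x - 2 * k * flow1 t x + Lop (flowE t) (flowO t) x = 0.
Proof.
rewrite Lop_flow /flow2 /flow1 mulr_sumr -!sumrB; apply: big1 => n _.
by rewrite /glam; ring.
Qed.

(** The bound is uniform in [t >= 0], so that a growing barrier dominates the flow beyond a fixed
    time. *)
Lemma flow_bounded : exists B : R, 0 <= B /\ forall t x, 0 <= t -> `|flow t x| <= B.
Proof.
have H n : exists B, forall x, `|tp ((a n)%:P * geg n) ((b n)%:P * (geg n)^`()) x| <= B.
  exact: bounded_tp.
pose B n := sval (cid (H n)).
have HB n x : `|a n * (geg n).[cos x] + b n * (sin x * (geg n)^`().[cos x])| <= B n.
  rewrite /B; case: cid => /= M /(_ x); rewrite /tp !hE.
  by rewrite [sin x * (_ * _)]mulrCA.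
have B0 n : 0 <= B n by exact: le_trans (HB n 0).
exists (\sum_(n < N) B n); split; first by apply: sumr_ge0.
move=> t x t0; apply: le_trans (ler_norm_sum _ _ _) _; apply: ler_sum => n _.
rewrite normrM -[leRHS]mul1r ler_pM// ger0_norm ?expR_ge0// -expR0 ler_expR.
by rewrite oppr_le0 mulr_ge0.
Qed.

(** A minimum over the compact interval is then a minimum over the whole line, as the reflection
    argument at a minimum requires. *)
Lemma angle_repr (x : R) : exists2 y, (- pi <= y <= pi) & cos y = cos x /\ sin y = sin x.
Proof.
have cx : -1 <= cos x <= 1 by rewrite cos_geN1 cos_le1.
have a1 := acos_ge0 cx; have a2 := acos_lepi cx; have p0 := pi_gt0 R.
have ss : sin (acos (cos x)) = `|sin x|.
  rewrite sin_acos// -sqrtr_sqr; congr Num.sqrt.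
  by have := cos2Dsin2 x => <-; ring.
have [s0|s0] := leP 0 (sin x).
  exists (acos (cos x)); first by lra.
  by rewrite acosK// ss ger0_norm.
exists (- acos (cos x)); first by lra.
by rewrite cosN sinN acosK// ss ltr0_norm// opprK.
Qed.

Lemma flow_angle t x y : cos x = cos y -> sin x = sin y -> flow t x = flow t y.
Proof. by rewrite /flow => -> ->. Qed.

Lemma continuous_flow : continuous (fun z : R * R => flow z.1 z.2).
Proof.
rewrite /flow; move: (N) => M; elim: M => [|M IH].
  rewrite (_ : (fun _ => _) = cst 0); last by apply/funext => z; rewrite big_ord0.
  exact: cst_continuous.
under eq_fun do rewrite big_ord_recr /=.
move=> z; apply: cvgD; first exact: IH.
apply: cvgM.
  apply: (@continuous_comp _ _ _ (fun z : R * R => z.1) (fun t => expR (- (M%:R * t)))).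
    exact: cvg_fst.
  have d := is_derive_expNn M z.1.
  by apply/differentiable_continuous/derivable1_diffP; exact: ex_derive.
apply: (@continuous_comp _ _ _ (fun z : R * R => z.2)
  (fun x => a M * (geg M).[cos x] + b M * (sin x * (geg M)^`().[cos x]))).
  exact: cvg_snd.
rewrite (_ : (fun x => _) = tp ((a M)%:P * geg M) ((b M)%:P * (geg M)^`())).
  exact: continuous_tp.
by apply/funext => x; rewrite /tp !hE; ring.
Qed.

(* The flow solves [U_tt - 2k U_t + L U = 0]. Adding [e * exp (k t)] makes it a strict
   supersolution that is positive for large [t], so it has no negative interior minimum. *)
Lemma flow_barrier (e : R) : 0 < e -> (forall x, 0 <= flow 0 x) ->
  forall t x : R, 0 <= t -> 0 <= flow t x + e * expR (k * t).
Proof.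
move=> e0 v0 t1 x1 t10; rewrite leNgt; apply/negP => neg.
have [B [B0 HB]] := flow_bounded.
(* Beyond [T] the barrier wins: [e exp(k t) >= e (1 + k t) > B]. *)
pose T := B / (e * k).
have T0 : 0 <= T by rewrite divr_ge0// mulr_ge0// ?(ltW e0)// ltW.
pose V (z : R * R) := flow z.1 z.2 + e * expR (k * z.1).
have Vpos t x : T <= t -> 0 < V (t, x).
  move=> Tt; have t0 : 0 <= t := le_trans T0 Tt.
  have := HB t x t0; rewrite ler_norml => /andP[+ _]; rewrite /V /=.
  have : e * (1 + k * t) <= e * expR (k * t).
    by rewrite ler_pM2l// expR_ge1Dx.
  have : B <= e * k * t by rewrite -ler_pdivrMl ?mulr_gt0// mulrC.
  by lra.
pose A := (`[0, T] `*` `[- pi, pi] : set (R * R)).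
have [||| [t0 x0] /=] := @compact_EVT_min _ _ V A.
- exists (0, 0); split; rewrite /= in_itv/= ?lexx ?T0//.
  by rewrite oppr_le0 pi_ge0.
- by apply: compact_setX; exact: segment_compact.
- apply: continuous_subspaceT => z; apply: cvgD; first exact: continuous_flow.
  apply: cvgM; first exact: cvg_cst.
  apply: (@continuous_comp _ _ _ (fun z : R * R => k * z.1) expR); last exact: continuous_expR.
  by apply: cvgM; [exact: cvg_cst|exact: cvg_fst].
rewrite inE => -[/=]; rewrite !in_itv/= => /andP[t00 t0T] x0I mn.
have gmin t x : 0 <= t <= T -> V (t0, x0) <= V (t, x).
  move=> tI; have [y yI [cy sy]] := angle_repr x.
  have -> : V (t, x) = V (t, y) by rewrite /V /= (@flow_angle t x y).
  by apply: mn; rewrite inE; split; rewrite /= in_itv.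
have t1T : t1 <= T.
  by rewrite leNgt; apply/negP => /ltW /(Vpos _ x1); rewrite ltNge (ltW neg).
have Vneg : V (t0, x0) < 0.
  by apply: le_lt_trans neg; apply: gmin; rewrite t10.
have t0p : 0 < t0.
  rewrite lt_neqAle t00 andbT; apply/eqP => E; move: Vneg; rewrite -E /V /=.
  by rewrite mulr0 expR0 mulr1 ltNge addr_ge0// ltW.
have t0T' : t0 < T.
  by rewrite ltNge; apply/negP => /(Vpos _ x0); rewrite ltNge (ltW Vneg).
have Lge : 0 <= Lop (flowE t0) (flowO t0) x0.
  apply: Lop_at_min => y; rewrite -!flowEO.
  by have := gmin t0 y; rewrite t00 t0T => /(_ isT); rewrite /V /= lerD2r.
pose E1 (t : R) := e * k * expR (k * t); pose E2 (t : R) := e * k ^+ 2 * expR (k * t).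
have dk (t : R) : is_derive t 1 (fun t : R => k * t) k.
  by have d := is_deriveZ k (is_derive_id t 1); refine (is_derive_eq d _); rewrite /GRing.scale/= mulr1.
have dexp c (t : R) : is_derive t 1 (fun t : R => c * expR (k * t)) (c * k * expR (k * t)).
  have d := is_deriveZ c (@is_derive1_comp _ expR (fun t => k * t) t _ _ (is_derive_expR _) (dk t)).
  by refine (is_derive_eq d _); rewrite /GRing.scale/=; ring.
have dV (t : R) : is_derive t 1 (fun t => V (t, x0)) (flow1 t x0 + E1 t).
  exact: is_deriveD (is_derive_flow x0 t) (dexp e t).
have dV1 (t : R) : is_derive t 1 (fun t => flow1 t x0 + E1 t) (flow2 t x0 + E2 t).
  have d := is_deriveD (is_derive_flow1 x0 t) (dexp (e * k) t).
  by refine (is_derive_eq d _); rewrite /E2; ring.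
pose d := Num.min t0 (T - t0).
have d0 : 0 < d by rewrite lt_min t0p subr_gt0.
have [|V1 V2] := deriv2_at_min d0 dV dV1 (c := t0).
- move=> t; rewrite ltr_distl => /andP[h1 h2]; apply: gmin.
  have : d <= t0 by rewrite ge_min lexx.
  have : d <= T - t0 by rewrite ge_min lexx orbT.
  by lra.
have := flow_pde t0 x0; have ep : 0 < e * k ^+ 2 * expR (k * t0).
  by rewrite !mulr_gt0 ?expR_gt0.
have : flow1 t0 x0 = - E1 t0 by apply/eqP; rewrite -addr_eq0 V1.
move: V2; rewrite /E2 => V2 ->; rewrite /E1 => E.
(* At the minimum [V_tt - 2k V_t + L U] is nonnegative, yet the flow contributes zero to it and the
   barrier [e k^2 (1 - 2) exp(k t)]. *)
have : 2 * k * - (e * k * expR (k * t0)) = - 2 * (e * k ^+ 2 * expR (k * t0)) by ring.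
by lra.
Qed.

Lemma flow_ge0 : (forall x, 0 <= flow 0 x) -> forall t x : R, 0 <= t -> 0 <= flow t x.
Proof.
move=> v0 t x t0; rewrite leNgt; apply/negP => neg.
have ep := expR_gt0 (k * t).
pose e := - flow t x / (2 * expR (k * t)).
have e0 : 0 < e by rewrite divr_gt0 ?mulr_gt0// oppr_gt0.
have := flow_barrier e0 v0 x t0; rewrite /e invfM mulrA mulrVK ?unitfE ?gt_eqF//.
by lra.
Qed.

End Flow.
End MaxPrinciple.

(** * Positivity tested on trigonometric polynomials *)

Lemma dominated_Rcvg d (T : measurableType d) (R : realType)
    (mu : {measure set T -> \bar R}) (f_ : nat -> T -> R) (f g : T -> R) :
  (forall n, measurable_fun setT (f_ n)) -> measurable_fun setT f ->
  {ae mu, forall x, f_ ^~ x @ \oo --> f x} ->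
  mu.-integrable setT (EFin \o g) -> (forall n x, `|f_ n x| <= g x) ->
  mu.-integrable setT (EFin \o f) /\
  (\int[mu]_x f_ n x) @[n --> \oo] --> \int[mu]_x f x.
Proof.
move=> mf_ mf cf ig fg.
have [] := @dominated_convergence _ _ _ mu setT measurableT (fun n x => (f_ n x)%:E)
  (fun x => (f x)%:E) (fun x => (g x)%:E).
- by move=> n; exact/measurable_EFinP.
- exact/measurable_EFinP.
- by apply: filterS cf => x cx _; apply: cvg_EFin; [exact: nearW|exact: cx].
- exact: ig.
- by apply: aeW => x n _; rewrite /= lee_fin.
move=> intf _ c; split; first exact: intf.
have fin : (\int[mu]_x (f x)%:E)%E \is a fin_num by exact: integrable_fin_num.
by move: c; rewrite -(fineK fin) => /fine_cvg.
Qed.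

Section Arc.
Variable R : realType.
Local Notation mu := (@lebesgue_measure R).

Lemma bernoulli_sub (z : R) m : 0 <= z <= 1 -> 1 - m%:R * z <= (1 - z) ^+ m.
Proof.
move=> /andP[z0 z1]; elim: m => [|m IH]; first by rewrite mul0r subr0 expr0.
have := ler_wpM2l (_ : 0 <= 1 - z) IH; rewrite subr_ge0 => /(_ z1); rewrite -exprS.
apply: le_trans; rewrite -natr1 -subr_ge0.
rewrite [leRHS](_ : _ = m%:R * (z * z)); last by ring.
by rewrite !mulr_ge0.
Qed.

Lemma bernoulli_add (z : R) m : 0 <= z -> 1 + m%:R * z <= (1 + z) ^+ m.
Proof.
move=> z0; elim: m => [|m IH]; first by rewrite mul0r addr0 expr0.
have := ler_wpM2l (_ : 0 <= 1 + z) IH; rewrite addr_ge0// => /(_ isT); rewrite -exprS.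
apply: le_trans; rewrite -natr1 -subr_ge0.
rewrite [leRHS](_ : _ = m%:R * (z * z)); last by ring.
by rewrite !mulr_ge0.
Qed.

(* these polynomials converge to the indicator of [y < 1/2] on [0, 1] *)
Definition stepn n (y : R) : R := (1 - y ^+ n) ^+ (2 ^ n)%N.

Lemma stepn_bounds n y : 0 <= y <= 1 -> 0 <= stepn n y <= 1.
Proof.
move=> /andP[y0 y1]; have h : 0 <= 1 - y ^+ n <= 1.
  by rewrite subr_ge0 exprn_ile1//= gerBl exprn_ge0.
by move/andP : h => [h0 h1]; rewrite exprn_ge0//= exprn_ile1.
Qed.

(** Bernoulli: [(1 - y^n)^(2^n) >= 1 - (2 y)^n]. *)
Lemma stepn_cvg1 (y : R) : 0 <= y < 1 / 2 -> stepn n y @[n --> \oo] --> (1 : R).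
Proof.
move=> /andP[y0 y1].
have c : 1 - (2 * y) ^+ n @[n --> \oo] --> (1 : R).
  rewrite -[X in _ --> X]subr0; apply: cvgB; first exact: cvg_cst.
  by apply: cvg_expr; rewrite ger0_norm ?mulr_ge0//; lra.
apply: (@squeeze_cvgr _ _ _ _ (fun n => 1 - (2 * y) ^+ n) (fun=> 1));
  [|exact: c|exact: cvg_cst].
near=> n.
have yn : 0 <= y <= 1 by apply/andP; split; lra.
have /andP[_ ->] := stepn_bounds n yn; rewrite andbT.
rewrite exprMn -natrX; apply: bernoulli_sub.
by rewrite exprn_ge0//= exprn_ile1//; lra.
Unshelve. all: by end_near. Qed.

(** With [z = y^n] and [N = 2^n], [(1 - z)^N (1 + z)^N <= 1] while [(1 + z)^N >= N z]; hence the
    value is at most [(2 y)^(-n)]. *)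
Lemma stepn_cvg0 y : 1 / 2 < y <= 1 -> stepn n y @[n --> \oo] --> (0 : R).
Proof.
move=> /andP[y1 y2].
have c : (2 * y)^-1 ^+ n @[n --> \oo] --> (0 : R).
  by apply: cvg_expr; rewrite ger0_norm ?invr_ge0 ?invf_lt1; lra.
apply: (squeeze_cvgr _ (cvg_cst 0) c); near=> n.
have yn : 0 <= y <= 1 by apply/andP; split; lra.
have /andP[-> _] := stepn_bounds n yn; rewrite /=.
have z0 : 0 < y ^+ n by rewrite exprn_gt0; lra.
have z1 : y ^+ n <= 1 by rewrite exprn_ile1; lra.
rewrite exprVn -[leRHS]mul1r ler_pdivlMr; last by rewrite exprn_gt0; lra.
apply: (@le_trans _ _ (stepn n y * (1 + y ^+ n) ^+ (2 ^ n)%N)).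
  rewrite ler_wpM2l//; first by have /andP[] := stepn_bounds n yn.
  apply: le_trans (bernoulli_add _ (ltW z0)).
  by rewrite exprMn -natrX lerDr.
rewrite /stepn -exprMn exprn_ile1//.
  by rewrite mulr_ge0//; lra.
rewrite [leLHS](_ : _ = 1 - (y ^+ n) * (y ^+ n)); last by ring.
by rewrite gerBl mulr_ge0// ltW.
Unshelve. all: by end_near. Qed.

Definition trigpoly (f : R -> R) := exists p q, f = tp p q.

Lemma trigpoly_cst c : trigpoly (cst c).
Proof. by exists c%:P, 0; apply/funext => x; rewrite tpE !hE. Qed.

Lemma trigpolyM f g : trigpoly f -> trigpoly g -> trigpoly (fun x => f x * g x).
Proof.
move=> [p [q ->]] [p' [q' ->]].
exists (p * p' + (1 - 'X^2) * (q * q')), (p * q' + q * p').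
by apply/funext => x; rewrite tpM.
Qed.

Lemma trigpolyX f n : trigpoly f -> trigpoly (fun x => f x ^+ n).
Proof.
move=> tf; elim: n => [|n IH]; first by under eq_fun do rewrite expr0; exact: trigpoly_cst.
by under eq_fun do rewrite exprS; exact: trigpolyM.
Qed.

Lemma trigpolyB f g : trigpoly f -> trigpoly g -> trigpoly (fun x => f x - g x).
Proof.
move=> [p [q ->]] [p' [q' ->]]; exists (p - p'), (q - q').
by apply/funext => x; rewrite /tp !hE; ring.
Qed.

Variable h : R -> R.
Hypothesis inth : mu.-integrable setT (EFin \o h).
Hypothesis supp_h : forall x, ~ Dpi x -> h x = 0.
Hypothesis pos_h : forall p q, (forall x, 0 <= tp p q x) -> 0 <= \int[mu]_x (h x * tp p q x).

(** An arc is a superlevel set of the cosine centred at its midpoint. For a point outside, the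
    distance [|z|] to the midpoint may exceed [pi]; it is then reflected to [2 pi - |z|], which
    still exceeds the half-length. *)
Lemma arc_cos (a b x : R) : - pi < a -> a < b -> b < pi -> - pi <= x <= pi ->
  (a < x < b -> cos ((b - a) / 2) < cos (x - (a + b) / 2)) /\
  ((x < a) || (b < x) -> cos (x - (a + b) / 2) < cos ((b - a) / 2)).
Proof.
move=> a1 ab b1 /andP[x1 x2]; set d := (b - a) / 2; set z := x - _.
have p0 := pi_gt0 R.
have d0 : d \in `[0, pi]%R by rewrite in_itv/= /d; apply/andP; split; lra.
have cz : cos z = cos `|z|.
  by have [z0|z0] := leP 0 z; [rewrite ger0_norm|rewrite ltr0_norm// cosN].
split=> H.
  rewrite cz ltr_cos//; last by rewrite in_itv/= normr_ge0 ler_norml /z; apply/andP; split; lra.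
  by rewrite ltr_norml /z /d; apply/andP; split; lra.
have zd : d < `|z|.
  by rewrite ltr_normr /z /d; case/orP : H => H; apply/orP; [right|left]; lra.
have zp : `|z| < pi *+ 2 - d.
  by rewrite ltr_norml mulr2n /z /d; apply/andP; split; lra.
rewrite cz; have [zpi|zpi] := leP `|z| pi.
  by rewrite ltr_cos// in_itv/= normr_ge0.
have -> : cos `|z| = cos (pi *+ 2 - `|z|).
  by rewrite -[RHS]cosN opprB -(cosD2pi (`|z| - pi *+ 2)) subrK.
rewrite ltr_cos//; first by lra.
have dge : 0 <= d by rewrite /d; lra.
by rewrite in_itv/= mulr2n; rewrite mulr2n in zp; apply/andP; split; lra.
Qed.

(** [stepn n] of an affine function of [cos(x - phi)] is a nonnegative trigonometric polynomial, and
    these tend to the indicator of the arc except at its two ends; dominated convergence carries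
    [pos_h] over. *)
Lemma arc_ge0 (a b : R) : - pi < a -> a < b -> b < pi ->
  0 <= \int[mu]_x (h x * \1_(`]a, b[ : set R) x).
Proof.
move=> a1 ab b1; pose phi := (a + b) / 2; pose c : R := cos ((b - a) / 2).
(* Values lie in [[0, 1]], and on [[-pi, pi]] they are below [1/2] exactly inside the arc. *)
pose y x := (1 / 2 + c / 4) - 4^-1 * cos (x - phi).
have ty : trigpoly y.
  apply: trigpolyB; first exact: trigpoly_cst.
  apply: trigpolyM; first exact: trigpoly_cst.
  exists ((cos phi)%:P * 'X), (sin phi)%:P.
  by apply/funext => x; rewrite /tp !hE cosB; ring.
have y01 x : 0 <= y x <= 1.
  have := cos_geN1 (x - phi); have := cos_le1 (x - phi).
  have := cos_geN1 ((b - a) / 2); have := cos_le1 ((b - a) / 2).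
  by rewrite /y -/c => *; apply/andP; split; lra.
have tq n : trigpoly (fun x => stepn n (y x)).
  apply: trigpolyX; apply: trigpolyB; first exact: trigpoly_cst.
  exact: trigpolyX.
have mh : measurable_fun setT h by apply/measurable_EFinP; exact: measurable_int inth.
have [] := @dominated_Rcvg _ _ _ mu (fun n x => h x * stepn n (y x))
  (fun x => h x * \1_(`]a, b[ : set R) x) (fun x => `|h x|).
- move=> n; apply: measurable_funM => //.
  by have [p [q ->]] := tq n; exact: measurable_tp.
- by apply: measurable_funM => //.
- have ngl : mu.-negligible [set a; b].
    exists [set a; b]; split => //.
    + by apply: measurableU; exact: measurable_set1.
    + apply/eqP; rewrite eq_le measure_ge0 andbT.
      rewrite (le_trans (measureU2 _ _ _))//; try exact: measurable_set1.
      by rewrite /= !lebesgue_measure_set1 adde0.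
  apply: (negligibleS _ ngl) => x /= nP; apply: contrapT => /not_orP[xa xb]; apply: nP.
  have [Dx|Dx] := pselect (Dpi x); last first.
    by rewrite supp_h// mul0r; under eq_fun do rewrite mul0r; exact: cvg_cst.
  apply: cvgM; first exact: cvg_cst.
  have [c1 c2] := arc_cos a1 ab b1 Dx; rewrite -/c -/phi in c1 c2.
  rewrite indicE; have [/= xI|/= xI] := boolP (x \in `]a, b[%classic).
    apply: stepn_cvg1; have /andP[-> _] := y01 x.
    rewrite inE /= in_itv/= in xI; have := c1 xI; rewrite /y /=; lra.
  apply: stepn_cvg0; have /andP[_ ->] := y01 x; rewrite andbT.
  have : (x < a) || (b < x).
    move: xI; rewrite notin_setE /= in_itv/= => /negP; rewrite negb_and -!leNgt !le_eqVlt.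
    by move: xa xb => /eqP/negbTE -> /eqP; rewrite eq_sym => /negbTE ->.
  by move/c2; rewrite /y /=; lra.
- by have := integrable_abse inth.
- move=> n x; rewrite normrM -[leRHS]mulr1 ler_wpM2l//.
  by have /andP[s0 s1] := stepn_bounds n (y01 x); rewrite ger0_norm.
move=> _ C; rewrite -(cvg_lim _ C)//; apply: limr_ge; first exact: cvgP C.
apply: nearW => n; have [p [q E]] := tq n.
have := @pos_h p q; rewrite -E; apply => x.
by have /andP[] := stepn_bounds n (y01 x).
Qed.

(** Small balls around an interior point are arcs, so the averages of [h] over them are nonnegative,
    and Lebesgue differentiation recovers [h] almost everywhere. The two ends of the interval form a
    null set. *)
Lemma ae_ge0_of_trig : {ae mu, forall x, 0 <= h x}.
Proof.
have lh : locally_integrable setT h by apply: open_integrable_locally => //; exact: openT.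
have ngl : mu.-negligible [set - pi; pi : R].
  exists [set - pi; pi]; split => //.
  - by apply: measurableU; exact: measurable_set1.
  - apply/eqP; rewrite eq_le measure_ge0 andbT.
    rewrite (le_trans (measureU2 _ _ _))//; try exact: measurable_set1.
    by rewrite /= !lebesgue_measure_set1 adde0.
have ae1 : {ae mu, forall x : R, x <> - pi /\ x <> pi}.
  by apply: (negligibleS _ ngl) => x /= /not_andP[] /contrapT ->; [left|right].
have FF : Filter (nbhs (almost_everywhere mu)) by exact: ae_filter_ringOfSetsType.
apply: filterS2 (lebesgue_differentiation lh) ae1 => x lx [x1 x2].
have [Dx|Dx] := pselect (Dpi x); last by rewrite supp_h.
move: Dx; rewrite /Dpi /= in_itv/= => /andP[].
rewrite le_eqVlt => /predU1P[/esym//|x3]; rewrite le_eqVlt => /predU1P[//|x4].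
pose e := Num.min (x + pi) (pi - x).
have e0 : 0 < e by rewrite lt_min; apply/andP; split; lra.
have en n : 0 < e / n.+2%:R by rewrite divr_gt0.
(* The radius [e / (n + 2)] is strictly less than [e] already for [n = 0], which keeps the ends of
   the arc off [- pi] and [pi]. *)
pose E (y : R) (n : nat) : set R := ball y (e / n.+2%:R).
have hE y : nicely_shrinking y (E y).
  split; first by move=> n; exact: measurable_ball.
  exists (1, fun n => PosNum (en n)); split => //=.
  - rewrite -[X in _ --> X](mulr0 e); apply: cvgM; first exact: cvg_cst.
    have H : (fun n => @harmonic R n.+1) @ \oo --> (0 : R).
      by rewrite (cvg_shiftS (@harmonic R)); exact: cvg_harmonic.
    exact: H.
  - by move=> n; rewrite /E.
  - by move=> n; rewrite mul1e.
have C := nice_lebesgue_differentiation hE lh lx.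
rewrite -lee_fin -(cvg_lim _ C)//; apply: lime_ge; first exact: cvgP C.
apply: nearW => n; rewrite mule_ge0 ?inve_ge0//.
have e1 : e / n.+2%:R < e.
  by rewrite ltr_pdivrMr// ltr_pMr// ltr1n.
have e2 : e <= x + pi by rewrite ge_min lexx.
have e3 : e <= pi - x by rewrite ge_min lexx orbT.
move: (en n) e1; rewrite /E ball_itv; move: (e / n.+2%:R) => dl d0 e1.
set a := x - dl; set b := x + dl.
have H : 0 <= \int[mu]_x (h x * \1_(`]a, b[ : set R) x).
  by apply: arc_ge0; rewrite /a /b; lra.
have fin : (\int[mu]_(y in `]a, b[) (h y)%:E)%E \is a fin_num.
  apply: integrable_fin_num => //; exact: integrableS inth.
rewrite -(fineK fin) lee_fin; apply: le_trans H _.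
rewrite -/(Rintegral _ _ _) [leRHS]Rintegral_mkcond le_eqVlt; apply/orP; left; apply/eqP.
apply: eq_Rintegral => y _; rewrite patchE indicE.
by case: ifPn => _; rewrite ?mulr1 ?mulr0.
Qed.

End Arc.

(** * The Poisson kernel *)

Section Kernel.
Variables (R : realType) (k : R).
Hypothesis k_gt0 : 0 < k.
Local Notation mu := (@lebesgue_measure R).
Local Notation geg := (geg k).
Local Notation glam := (glam k).
Local Notation hn := (hn k).
Local Notation bn := (bn k).
Local Notation wgt := (wgt k).
Local Notation intW := (intW k).
Local Notation IW := (IW k).
Local Notation Mp := (Mp k).

Definition gE n (x : R) : R := (geg n).[cos x].
Definition gO n (x : R) : R := sin x * (geg n)^`().[cos x].

(** Reproducing kernel of level [n]; [glam n * hn n] is the squared norm of [gO n]. At [n = 0] the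
    inverse of [glam 0 = 0] is 0 by convention, in accordance with [gO 0 = 0]. *)
Definition Zn n (x y : R) : R :=
  (hn n)^-1 * (gE n x * gE n y + (glam n)^-1 * (gO n x * gO n y)).

Lemma gO0 x : gO 0 x = 0.
Proof. by rewrite /gO derivC horner0 mulr0. Qed.

Lemma gE0 x : gE 0 x = 1.
Proof. by rewrite /gE !hE. Qed.

Lemma gEtp n : gE n =1 tp (geg n) 0.
Proof. by move=> x; rewrite tpE. Qed.

Lemma gOtp n : gO n =1 tp 0 (geg n)^`().
Proof. by move=> x; rewrite tp0E. Qed.

Lemma measurable_gE n : measurable_fun setT (gE n).
Proof. by rewrite (funext (gEtp n)); exact: measurable_tp. Qed.

Lemma measurable_gO n : measurable_fun setT (gO n).
Proof. by rewrite (funext (gOtp n)); exact: measurable_tp. Qed.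

(** Sonin's bound divided by [glam n]; level 0 is separate because [glam 0 = 0]. *)
Lemma gEO_le1 n x : gE n x ^+ 2 + (glam n)^-1 * gO n x ^+ 2 <= 1.
Proof.
case: n => [|n]; first by rewrite gO0 gE0 expr0n mulr0 addr0 expr1n.
have l0 := glam_gt0 k_gt0 n.
have := @sonin_le _ _ k_gt0 n.+1 (cos x); rewrite cos_geN1 cos_le1 => /(_ isT) S.
rewrite -(ler_pM2l l0) mulr1; apply: le_trans S.
rewrite [leLHS](_ : _ = gO n.+1 x ^+ 2 + glam n.+1 * gE n.+1 x ^+ 2); last first.
  by field; rewrite gt_eqF.
rewrite /gE /gO.
by rewrite exprMn [sin x ^+ 2]expr2 sin2cos2' -expr2.
Qed.

(** Cauchy-Schwarz for the form with weights 1 and [l], read off from the squares of the sum and of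
    the difference. *)
Lemma ler_norm_mulD (l a b c d : R) : 0 <= l -> a ^+ 2 + l * b ^+ 2 <= 1 ->
  c ^+ 2 + l * d ^+ 2 <= 1 -> `|a * c + l * (b * d)| <= 1.
Proof.
move=> l0 h1 h2.
have s1 : 0 <= (a - c) ^+ 2 + l * (b - d) ^+ 2.
  by rewrite addr_ge0 ?sqr_ge0// mulr_ge0// sqr_ge0.
have s2 : 0 <= (a + c) ^+ 2 + l * (b + d) ^+ 2.
  by rewrite addr_ge0 ?sqr_ge0// mulr_ge0// sqr_ge0.
rewrite ler_norml; apply/andP; split; rewrite -subr_ge0.
  have -> : a * c + l * (b * d) - -1 = (((a + c) ^+ 2 + l * (b + d) ^+ 2) +
    (1 - (a ^+ 2 + l * b ^+ 2)) + (1 - (c ^+ 2 + l * d ^+ 2))) / 2 by field.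
  by apply: divr_ge0 => //; apply: addr_ge0; [apply: addr_ge0|]; rewrite ?subr_ge0.
have -> : 1 - (a * c + l * (b * d)) = (((a - c) ^+ 2 + l * (b - d) ^+ 2) +
  (1 - (a ^+ 2 + l * b ^+ 2)) + (1 - (c ^+ 2 + l * d ^+ 2))) / 2 by field.
by apply: divr_ge0 => //; apply: addr_ge0; [apply: addr_ge0|]; rewrite ?subr_ge0.
Qed.

Lemma Zn_le n x y : `|Zn n x y| <= (hn n)^-1.
Proof.
have h0 := hn_gt0 k_gt0 n.
rewrite normrM ger0_norm ?invr_ge0 ?(ltW h0)// -[leRHS]mulr1 ler_wpM2l ?invr_ge0 ?(ltW h0)//.
apply: ler_norm_mulD; [|exact: gEO_le1..].
by rewrite invr_ge0 glam_ge0.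
Qed.

Lemma Zn_sym n x y : Zn n x y = Zn n y x.
Proof. by rewrite /Zn; ring. Qed.

Definition Zc : R := 2 * (hn 0)^-1.

Lemma Zc_gt0 : 0 < Zc.
Proof. by rewrite mulr_gt0// invr_gt0 hn_gt0. Qed.

Definition Br (r : R) : R := Zc * (1 - r) `^ (- (2 * k + 1)).

Lemma sum_hnV_le r N : 0 <= r < 1 -> \sum_(n < N) r ^+ n * (hn n)^-1 <= Br r.
Proof.
move=> r01; have /andP[r0 r1] := r01.
apply: (@le_trans _ _ (\sum_(n < N) Zc * (bn n * r ^+ n))).
  apply: ler_sum => n _; rewrite mulrA [leRHS]mulrC ler_wpM2l ?exprn_ge0//.
  exact: hnV.
by rewrite -mulr_sumr ler_wpM2l ?(ltW Zc_gt0)// sum_bn_le.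
Qed.

(** One majorant for several series: the kernel, the projections of [f], and the comparison for
    large [u] are all of this shape. *)
Lemma dom_series r (u : nat -> R) (C : R) : 0 <= r < 1 -> 0 <= C ->
  (forall n, `|u n| <= r ^+ n * (hn n)^-1 * C) ->
  [/\ cvgn (fun N => \sum_(n < N) u n), forall N, `|\sum_(n < N) u n| <= Br r * C &
      `|limn (fun N => \sum_(n < N) u n)| <= Br r * C].
Proof.
move=> r01 C0 hu; have /andP[r0 r1] := r01.
pose v n := r ^+ n * (hn n)^-1 * C.
have v0 n : 0 <= v n by rewrite mulr_ge0// mulr_ge0 ?exprn_ge0// invr_ge0 ltW// hn_gt0.
have B N : \sum_(n < N) v n <= Br r * C.
  by rewrite -mulr_suml ler_wpM2r// sum_hnV_le.
have cv : cvgn (series v).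
  apply: nondecreasing_is_cvgn.
    by apply/nondecreasing_seqP => n; rewrite seriesSr lerDl.
  by exists (Br r * C) => _ [n _ <-]; rewrite /series /= big_mkord.
have cu : cvgn (fun N => \sum_(n < N) u n).
  rewrite (_ : (fun N => _) = series u); last first.
    by apply/funext => N; rewrite /series /= big_mkord.
  by apply: normed_cvg; apply: (series_le_cvg _ _ _ cv) => n /=; rewrite ?normr_ge0 ?v0//; exact: hu.
have b N : `|\sum_(n < N) u n| <= Br r * C.
  apply: le_trans (B N); apply: le_trans (ler_norm_sum _ _ _) _.
  by apply: ler_sum => n _; exact: hu.
split => //.
rewrite -lim_norm//; apply: limr_le; first exact: is_cvg_norm.
by apply: nearW => N; exact: b.
Qed.

Definition Pk (r x y : R) : R := limn (fun N => \sum_(n < N) r ^+ n * Zn n x y).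

Lemma Zn_term r n x y : 0 <= r < 1 -> `|r ^+ n * Zn n x y| <= r ^+ n * (hn n)^-1 * 1.
Proof.
move=> /andP[r0 r1]; rewrite mulr1 normrM ger0_norm ?exprn_ge0//.
by rewrite ler_wpM2l ?exprn_ge0// Zn_le.
Qed.

Lemma Pk_cvg r x y : 0 <= r < 1 ->
  (fun N => \sum_(n < N) r ^+ n * Zn n x y) @ \oo --> Pk r x y.
Proof. by move=> r01; have [] := dom_series r01 ler01 (fun n => Zn_term n x y r01). Qed.

Lemma Pk_part r x y N : 0 <= r < 1 -> `|\sum_(n < N) r ^+ n * Zn n x y| <= Br r.
Proof.
move=> r01; have [_ /(_ N)] := dom_series r01 ler01 (fun n => Zn_term n x y r01).
by rewrite mulr1.
Qed.

Lemma Pk_le r x y : 0 <= r < 1 -> `|Pk r x y| <= Br r.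
Proof.
move=> r01; have [_ _] := dom_series r01 ler01 (fun n => Zn_term n x y r01).
by rewrite mulr1.
Qed.

Lemma Pk_sym r x y : Pk r x y = Pk r y x.
Proof.
by rewrite /Pk; congr (limn _); apply/funext => N; apply: eq_bigr => n _; rewrite Zn_sym.
Qed.

Lemma measurable_Zn d (T : measurableType d) n (X Y : T -> R) :
  measurable_fun setT X -> measurable_fun setT Y ->
  measurable_fun setT (fun t => Zn n (X t) (Y t)).
Proof.
move=> mX mY; apply: measurable_funM => //; apply: measurable_funD.
  by apply: measurable_funM; apply: (measurableT_comp (measurable_gE n)).
apply: measurable_funM => //.
by apply: measurable_funM; apply: (measurableT_comp (measurable_gO n)).
Qed.

Lemma measurable_Zsum d (T : measurableType d) N (r X Y : T -> R) :
  measurable_fun setT r -> measurable_fun setT X -> measurable_fun setT Y ->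
  measurable_fun setT (fun t => \sum_(n < N) r t ^+ n * Zn n (X t) (Y t)).
Proof.
move=> mr mX mY; apply: measurable_sum => n; apply: measurable_funM.
  exact: measurable_funX.
exact: measurable_Zn.
Qed.

(** Stated along measurable maps from an arbitrary space, so that it covers joint measurability in
    [(u, x, y)] as well as sections. *)
Lemma measurable_Pk d (T : measurableType d) (r X Y : T -> R) :
  (forall t, 0 <= r t < 1) ->
  measurable_fun setT r -> measurable_fun setT X -> measurable_fun setT Y ->
  measurable_fun setT (fun t => Pk (r t) (X t) (Y t)).
Proof.
move=> r01 mr mX mY.
apply: (measurable_fun_cvg (fun N => measurable_Zsum N mr mX mY)) => t _.
exact: Pk_cvg.
Qed.

Definition cE n (f : R -> R) : R := IW (fun y => gE n y * f y).
Definition cO n (f : R -> R) : R := IW (fun y => gO n y * f y).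
Definition Znf (f : R -> R) n (x : R) : R :=
  (hn n)^-1 * (gE n x * cE n f + (glam n)^-1 * (gO n x * cO n f)).

Lemma intW_gE n f : intW f -> intW (fun y => gE n y * f y).
Proof.
move=> hf; have [M hM] := bounded_tp (geg n) 0.
by apply: (intWM (measurable_gE n) _ hf) => x; rewrite gEtp; exact: hM.
Qed.

Lemma intW_gO n f : intW f -> intW (fun y => gO n y * f y).
Proof.
move=> hf; have [M hM] := bounded_tp 0 (geg n)^`().
by apply: (intWM (measurable_gO n) _ hf) => x; rewrite gOtp; exact: hM.
Qed.

Lemma intW_Zn n x f : intW f -> intW (fun y => Zn n x y * f y).
Proof.
move=> hf; apply: (intWM (M := (hn n)^-1) _ _ hf); last by move=> y; exact: Zn_le.
exact: measurable_Zn.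
Qed.

Lemma IW_Zn n x f : intW f -> IW (fun y => Zn n x y * f y) = Znf f n x.
Proof.
move=> hf.
have -> : IW (fun y => Zn n x y * f y) = IW (fun y =>
  ((hn n)^-1 * gE n x) * (gE n y * f y) +
  ((hn n)^-1 * (glam n)^-1 * gO n x) * (gO n y * f y)).
  by apply: eq_IW => y; rewrite /Zn; ring.
rewrite IWD ?IWZ; [|exact: intW_gO|exact: intW_gE|exact/intWZ/intW_gE|exact/intWZ/intW_gO].
by rewrite /Znf -/(cE n f) -/(cO n f); ring.
Qed.

Definition N1 (f : R -> R) : R := IW (fun y => `|f y|).

Lemma intW_norm f : intW f -> intW (fun y => `|f y|).
Proof.
move=> hf; have := integrable_abse hf; apply: eq_integrable => // x _ /=.
by rewrite normrM (ger0_norm (wgt_ge0 k x)).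
Qed.

Lemma N1_ge0 f : 0 <= N1 f. Proof. exact: IW_ge0. Qed.

Lemma IW_norm_le f : intW f -> `|IW f| <= N1 f.
Proof.
move=> hf; apply: le_trans (le_normr_Rintegral measurableT hf) _.
rewrite /N1 /IW le_eqVlt; apply/orP; left; apply/eqP; apply: eq_Rintegral => x _.
by rewrite normrM (ger0_norm (wgt_ge0 k x)).
Qed.

Lemma le_IW f g : intW f -> intW g -> (forall x, f x <= g x) -> IW f <= IW g.
Proof.
by move=> hf hg fg; apply: le_Rintegral => // x _; rewrite ler_wpM2r// wgt_ge0.
Qed.

Lemma Znf_le f n x : intW f -> `|Znf f n x| <= (hn n)^-1 * N1 f.
Proof.
move=> hf; rewrite -IW_Zn//; apply: le_trans (IW_norm_le (intW_Zn n x hf)) _.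
rewrite /N1 -IWZ; last exact: intW_norm.
apply: le_IW; [exact/intW_norm/intW_Zn|exact/intWZ/intW_norm|].
by move=> y; rewrite normrM ler_wpM2r// Zn_le.
Qed.

(** The partial sums of the kernel are bounded by [Br r], so [Br r |f| W] dominates and the integral
    is taken term by term. *)
Lemma Pk_int r x f : 0 <= r < 1 -> intW f ->
  intW (fun y => Pk r x y * f y) /\
  (fun N => \sum_(n < N) r ^+ n * Znf f n x) @ \oo --> IW (fun y => Pk r x y * f y).
Proof.
move=> r01 hf.
have mf : measurable_fun setT (fun y => f y * wgt y).
  by apply/measurable_EFinP; exact: measurable_int hf.
have [] := @dominated_Rcvg _ _ _ mu
  (fun N y => (\sum_(n < N) r ^+ n * Zn n x y) * f y * wgt y)
  (fun y => Pk r x y * f y * wgt y) (fun y => Br r * `|f y * wgt y|).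
- move=> N; under eq_fun do rewrite -mulrA.
  by apply: measurable_funM => //; exact: measurable_Zsum.
- under eq_fun do rewrite -mulrA.
  by apply: measurable_funM => //; exact: measurable_Pk.
- apply: aeW => y; apply: cvgM; last exact: cvg_cst.
  by apply: cvgM; [exact: Pk_cvg|exact: cvg_cst].
- have := integrableZl measurableT (Br r) (integrable_abse hf).
  by apply: eq_integrable.
- by move=> N y; rewrite -mulrA normrM ler_wpM2r// Pk_part.
move=> i c; split; first exact: i.
apply: cvg_trans c; apply: near_eq_cvg; apply: nearW => N.
have h n : intW (fun y => r ^+ n * (Zn n x y * f y)) by exact/intWZ/intW_Zn.
have [_ E] := IW_sum k_gt0 (fun n : 'I_N => h n).
rewrite (eq_bigr (fun n : 'I_N => IW (fun y => r ^+ n * (Zn n x y * f y)))).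
  rewrite -E; apply: eq_Rintegral => y _; congr (_ * _).
  by rewrite mulr_suml; apply: eq_bigr => n _; rewrite -mulrA.
by move=> n _; rewrite IWZ ?IW_Zn//; exact: intW_Zn.
Qed.

Lemma trig_expand (p q : {poly R}) : exists (N : nat) (a b : nat -> R),
  p = \sum_(n < N) (a n)%:P * geg n /\ q = \sum_(n < N) (b n)%:P * (geg n)^`().
Proof.
pose M := maxn (size p) (size q).
have [|a Ea] := @size_basis_expand _ geg (size_geg k_gt0) M.+1 p.
  by rewrite leqW// leq_maxl.
have [|b Eb] := @size_basis_expand _ (fun n => (geg n.+1)^`()) (size_geg_deriv k_gt0) M q.
  by rewrite leq_maxr.
(* The odd coefficients are shifted by one, with value 0 at level 0, because [geg 0] is constant and
   [geg_(j+1)'] has degree [j]. *)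
exists M.+1, a, (fun n => if n is m.+1 then b m else 0); split => //.
by rewrite big_ord_recl /= polyC0 mul0r add0r.
Qed.

Lemma cE_tp n p q : cE n (tp p q) = Mp (geg n * p).
Proof.
rewrite -(IW_tp k_gt0 _ (geg n * q)); apply: eq_IW => x.
by rewrite gEtp tpM !mul0r mulr0 !addr0.
Qed.

Lemma cO_tp n p q : cO n (tp p q) = Mp ((1 - 'X^2) * ((geg n)^`() * q)).
Proof.
rewrite -(IW_tp k_gt0 _ ((geg n)^`() * p)); apply: eq_IW => x.
by rewrite gOtp tpM !mul0r add0r add0r.
Qed.

Section Expanded.
Variables (N : nat) (a b : nat -> R).
Let p := \sum_(n < N) (a n)%:P * geg n.
Let q := \sum_(n < N) (b n)%:P * (geg n)^`().

Lemma cE_sum n : cE n (tp p q) = if (n < N)%N then a n * hn n else 0.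
Proof.
rewrite cE_tp /p mulr_sumr (Mp_sum k_gt0).
under eq_bigr do rewrite mulrCA (MpZ k_gt0).
case: ifPn => nN.
  rewrite (bigD1 (Ordinal nN)) //= big1 ?addr0// => m mn.
  by rewrite Mp_orth ?mulr0//; move: mn; apply: contra => /eqP e; apply/eqP/val_inj.
by rewrite big1// => m _; rewrite Mp_orth ?mulr0//; apply: contra nN => /eqP ->.
Qed.

Lemma cO_sum n : cO n (tp p q) = if (n < N)%N then b n * (glam n * hn n) else 0.
Proof.
rewrite cO_tp /q !mulr_sumr (Mp_sum k_gt0).
have E m : (1 - 'X^2) * ((geg n)^`() * ((b m)%:P * (geg m)^`())) =
  (b m)%:P * ((1 - 'X^2) * ((geg n)^`() * (geg m)^`())) by ring.
under eq_bigr do rewrite E (MpZ k_gt0).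
case: ifPn => nN.
  rewrite (bigD1 (Ordinal nN)) //= big1 ?addr0.
    by rewrite Mp_deriv_geg.
  move=> m mn; rewrite Mp_deriv_geg// Mp_orth ?mulr0//.
  by move: mn; apply: contra => /eqP e; apply/eqP/val_inj.
by rewrite big1// => m _; rewrite Mp_deriv_geg// Mp_orth ?mulr0//; apply: contra nN => /eqP ->.
Qed.

Lemma Znf_sum n x : Znf (tp p q) n x =
  if (n < N)%N then a n * gE n x + b n * gO n x else 0.
Proof.
rewrite /Znf cE_sum cO_sum; case: ifPn => nN; last by rewrite !mulr0 addr0 mulr0.
have h0 : hn n != 0 by rewrite gt_eqF// hn_gt0.
case: n h0 {nN} => [|n] h0.
  by rewrite gO0 mul0r !mulr0 !addr0 gE0 mul1r mulr1 mulrC mulfK.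
have l0 : glam n.+1 != 0 by rewrite gt_eqF// glam_gt0.
by field; rewrite h0 l0.
Qed.

(** Levels from [N] on do not see the polynomial, so the partial sums are stationary. *)
Lemma Pk_trig r x : 0 <= r < 1 ->
  IW (fun y => Pk r x y * tp p q y) = \sum_(n < N) r ^+ n * (a n * gE n x + b n * gO n x).
Proof.
move=> r01; have [_ c] := Pk_int x r01 (intW_tp k_gt0 p q).
rewrite -(cvg_lim _ c)//; apply: cvg_lim => //.
pose F n := r ^+ n * (a n * gE n x + b n * gO n x).
apply/cvgrPdist_lt => e e0; near=> M.
have NM : (N <= M)%N by near: M; exact: nbhs_infty_ge.
suff -> : \sum_(n < M) r ^+ n * Znf (tp p q) n x = \sum_(n < N) F n by rewrite subrr normr0.
rewrite (big_ord_widen M F NM) [RHS]big_mkcond; apply: eq_bigr => n _.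
by rewrite Znf_sum; case: ifPn; rewrite ?mulr0.
Unshelve. all: by end_near. Qed.
End Expanded.

Lemma Pk_mass r x : 0 <= r < 1 -> IW (Pk r x) = 1.
Proof.
move=> r01; have := @Pk_trig 1 (fun=> 1) (fun=> 0) r x r01.
have E : \sum_(n < 1) r ^+ n * (1 * gE n x + 0 * gO n x) = 1.
  by rewrite big_ord1 expr0 gE0 mul0r addr0 !mul1r.
rewrite E => <-; rewrite !big_ord1.
apply: eq_IW => y; rewrite /tp polyC0 mul0r horner0 mulr0 addr0 polyC1 mul1r.
by rewrite !hE mulr1.
Qed.

(** At [t = - ln r] the kernel integral is the flow, to which the maximum principle applies. *)
Lemma Pk_trig_ge0 r x p q : 0 < r < 1 -> (forall y, 0 <= tp p q y) ->
  0 <= IW (fun y => Pk r x y * tp p q y).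
Proof.
move=> /andP[r0 r1] pq0; have [N [a [b [Ep Eq]]]] := trig_expand p q.
rewrite Ep Eq Pk_trig ?(ltW r0)// ?r1//.
pose t := - ln r.
have t0 : 0 <= t by rewrite /t oppr_ge0 ln_le0// ltW.
have -> : \sum_(n < N) r ^+ n * (a n * gE n x + b n * gO n x) = flow k N a b t x.
  apply: eq_bigr => n _; congr (_ * _).
  by rewrite /t mulrN opprK expRM_natl lnK// posrE.
apply: flow_ge0 => // y; rewrite flowEO /flowE /flowO.
rewrite (_ : \sum_(n < N) _ = p); last first.
  by rewrite Ep; apply: eq_bigr => n _; rewrite mulr0 oppr0 expR0 mul1r.
rewrite (_ : \sum_(n < N) _ = q)// Eq.
by apply: eq_bigr => n _; rewrite mulr0 oppr0 expR0 mul1r.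
Qed.

Lemma intW_Pk r x : 0 <= r < 1 -> intW (Pk r x).
Proof.
move=> r01; apply: (@bounded_intW _ _ k_gt0 _ (Br r)); last by move=> y; exact: Pk_le.
exact: measurable_Pk.
Qed.

(** The mass is 1 because only level 0 sees the constant function. Positivity holds almost
    everywhere for [Pk r x y W(y)], which is enough to replace [Pk] by its absolute value under the
    integral. *)
Lemma Pk_L1 r x : 0 < r < 1 -> N1 (Pk r x) = 1.
Proof.
move=> r01; have r01' : 0 <= r < 1 by move/andP : r01 => [/ltW -> ->].
have hP := intW_Pk x r01'.
have ae : {ae mu, forall y, 0 <= Pk r x y * wgt y}.
  apply: ae_ge0_of_trig => //.
  - by move=> y Dy; rewrite wgt_out// mulr0.
  - move=> p q pq0; have := Pk_trig_ge0 x r01 pq0; congr (0 <= _).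
    by apply: eq_Rintegral => y _; rewrite mulrAC.
rewrite -(Pk_mass x r01') /N1 /IW /Rintegral; congr fine.
apply: ae_eq_integral => //.
- exact: measurable_int (intW_norm hP).
- exact: measurable_int hP.
- have FF : Filter (nbhs (almost_everywhere mu)) by exact: ae_filter_ringOfSetsType.
  apply: filterS ae => y y0 _; congr EFin.
  by rewrite -[in RHS](ger0_norm y0) normrM (ger0_norm (wgt_ge0 k y)).
Qed.

End Kernel.

(** * A Hardy-Littlewood-Sobolev inequality *)

Section RealIntegrals.
Context d (T : measurableType d) (R : realType) (mu : {measure set T -> \bar R}).
Implicit Types F G : T -> R.
Local Open Scope ereal_scope.

Lemma le_integral_EFin F G : measurable_fun setT F -> measurable_fun setT G ->
  (forall x, 0 <= F x)%R -> (forall x, F x <= G x)%R ->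
  \int[mu]_x (F x)%:E <= \int[mu]_x (G x)%:E.
Proof.
move=> mF mG F0 FG; apply: ge0_le_integral => //.
- by move=> x _; rewrite lee_fin.
- exact/measurable_EFinP.
- exact/measurable_EFinP.
- by move=> x _; rewrite lee_fin.
Qed.

Lemma integralZ_EFin (c : R) F : (0 <= c)%R -> measurable_fun setT F ->
  (forall x, 0 <= F x)%R -> \int[mu]_x (c * F x)%:E = c%:E * \int[mu]_x (F x)%:E.
Proof.
move=> c0 mF F0; under eq_integral do rewrite EFinM.
rewrite ge0_integralZl//; first exact/measurable_EFinP.
by move=> x _; rewrite lee_fin.
Qed.

Lemma integralD_ge0_EFin F G : measurable_fun setT F -> measurable_fun setT G ->
  (forall x, 0 <= F x)%R -> (forall x, 0 <= G x)%R ->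
  \int[mu]_x (F x + G x)%:E = \int[mu]_x (F x)%:E + \int[mu]_x (G x)%:E.
Proof.
move=> mF mG F0 G0; under eq_integral do rewrite EFinD.
rewrite ge0_integralD//.
- by move=> x _; rewrite lee_fin.
- exact/measurable_EFinP.
- by move=> x _; rewrite lee_fin.
- exact/measurable_EFinP.
Qed.
End RealIntegrals.

Section Powers.
Variable R : realType.

Lemma powRV (a r : R) : 0 <= a -> a^-1 `^ r = a `^ (- r).
Proof. by move=> a0; rewrite -(powR_inv1 a0) -powRrM mulN1r. Qed.

Lemma powR_cancel (m r : R) : 0 < m -> m `^ (1 - r) * m `^ (r - 1) = 1.
Proof.
move=> m0; rewrite -powRD ?(gt_eqF m0) ?implybT//.
have -> : 1 - r + (r - 1) = 0 by ring.
by rewrite powRr0.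
Qed.

Local Notation mu := (@lebesgue_measure R).

Lemma integral_indic_itv (s t : R) b0 b1 : (s <= t)%R ->
  (\int[mu]_u (\1_([set` Interval (BSide b0 s) (BSide b1 t)] : set R) u)%:E = (t - s)%:E)%E.
Proof.
move=> st; rewrite integral_indic// setIT.
transitivity (mu [set` Interval (BSide b0 s) (BSide b1 t)]) => //.
rewrite lebesgue_measure_itv/= lte_fin; case: ifPn => [_|]; first by rewrite EFinB.
rewrite -leNgt => ts; have -> : s = t by apply/le_anti/andP.
by rewrite subrr.
Qed.

(** The exact value for [s < 1] has a further [- 1 / (g - 1)], dropped here. For [s >= 1] the
    interval has at most one point. *)
Lemma integral_powN_le (s g : R) : 0 < s -> 1 < g ->
  (\int[mu]_u (\1_(`[s, 1] : set R) u * u `^ (- g))%:E <= (s `^ (1 - g) / (g - 1))%:E)%E.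
Proof.
move=> s0 g1; have g10 : 0 < g - 1 by rewrite subr_gt0.
have -> : (\int[mu]_u (\1_(`[s, 1%R] : set R) u * u `^ (- g))%:E =
  \int[mu]_(u in `[s, 1%R]) (u `^ (- g))%:E)%E.
  rewrite [RHS]integral_mkcond; apply: eq_integral => u _; rewrite patchE indicE.
  by case: ifPn => _; rewrite ?mul1r ?mul0r.
have [s1|s1] := leP 1 s.
  rewrite (@integral_Sset1 _ _ _ 1).
    by rewrite lee_fin divr_ge0 ?powR_ge0// ltW.
  by move=> u /=; rewrite in_itv/= => /andP[su u1]; apply/le_anti; rewrite u1 (le_trans s1).
pose F (u : R) := - (u `^ (1 - g) / (g - 1)).
have dF (u : R) : 0 < u -> is_derive u 1 F (u `^ (- g)).
  move=> u0.
  have d := is_deriveZ (- (g - 1)^-1) (is_derive1_powR (1 - g) u0).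
  rewrite (_ : F = (- (g - 1)^-1) *: (@powR R ^~ (1 - g))); last first.
    by apply/funext => v; rewrite /F fctE /GRing.scale/=; ring.
  refine (is_derive_eq d _); rewrite /GRing.scale/=.
  have -> : 1 - g - 1 = - g by ring.
  have -> : 1 - g = - (g - 1) by ring.
  by rewrite mulrA mulrNN mulVf ?mul1r// gt_eqF.
rewrite (@continuous_FTC2 _ (fun u => u `^ (- g)) F)//.
- rewrite /F powR1 -EFinB lee_fin opprK mul1r; have := ltW g10; rewrite -invr_ge0; lra.
- apply: derivable_within_continuous => u; rewrite in_itv/= => /andP[su _].
  by apply: derivable_powR; rewrite in_itv/= andbT (lt_le_trans s0).
- have cF (u : R) : 0 < u -> {for u, continuous F}.
    by move=> u0; have du := dF u u0; apply/differentiable_continuous/derivable1_diffP; exact: ex_derive.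
  split.
  + move=> u; rewrite in_itv/= => /andP[su _].
    by have du := dF u (lt_trans s0 su); exact: ex_derive.
  + by apply: cvg_at_right_filter; exact: cF.
  + by apply: cvg_at_left_filter; exact: cF.
- move=> u; rewrite in_itv/= => /andP[su _]; rewrite derive1E.
  by have du := dF u (lt_trans s0 su); rewrite derive_val.
Qed.
End Powers.

Section HLS.
Variables (R : realType) (W : R -> R) (Q : R -> R -> R -> R) (B D p q : R).
Local Notation mu := (@lebesgue_measure R).
Hypothesis mW : measurable_fun setT W.
Hypothesis W_ge0 : forall x, 0 <= W x.
Hypothesis mQ : measurable_fun setT (fun z : (R * R) * R => Q z.1.1 z.1.2 z.2).
Hypothesis Q_ge0 : forall u x y, 0 <= Q u x y.
Hypothesis Q_out : forall u x y, ~~ (0 < u <= 1) -> Q u x y = 0.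
Hypothesis B_ge0 : 0 <= B.
Hypothesis Q_le : forall u x y, 0 < u <= 1 -> Q u x y <= B * u `^ (- D).
Hypothesis Q_int2 : forall u x, (\int[mu]_y (Q u x y * W y)%:E <= 1)%E.
Hypothesis Q_int1 : forall u y, (\int[mu]_x (Q u x y * W x)%:E <= 1)%E.
Hypothesis p_gt1 : 1 < p.
Hypothesis pD : p < D.
Hypothesis pqD : q^-1 = p^-1 - D^-1.

Let p0 : 0 < p. Proof. exact: lt_trans p_gt1. Qed.
Let D0 : 0 < D. Proof. exact: lt_trans pD. Qed.
Let q0 : 0 < q. Proof. by rewrite -invr_gt0 pqD subr_gt0 ltf_pV2. Qed.
Let pq : p < q.
Proof. by rewrite -ltf_pV2 ?posrE// pqD gtrBl invr_gt0. Qed.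
Let q1 : 1 < q. Proof. exact: lt_trans pq. Qed.
Let pN : p != 0. Proof. by rewrite gt_eqF. Qed.
Let qN : q != 0. Proof. by rewrite gt_eqF. Qed.
Let DN : D != 0. Proof. by rewrite gt_eqF. Qed.

(** [hls_a] and [hls_b] are tuned so that, in the estimate at level [lam], the range
    [u >= a lam^(-q/D)] and the values of [f] below [b lam^(q/p)] contribute at most [lam / 3] each:
    [(1 + B) (q / D) a^(-D/q) = 1/3] and [a b = 1/3]. *)
Definition hls_a : R := (3 * (1 + B) * (q / D)) `^ (q / D).
Definition hls_b : R := (3 * hls_a)^-1.

Lemma hls_a_gt0 : 0 < hls_a.
Proof. by rewrite powR_gt0// !mulr_gt0 ?invr_gt0// ltr_wpDr. Qed.

Lemma hls_b_gt0 : 0 < hls_b.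
Proof. by rewrite invr_gt0 mulr_gt0 ?hls_a_gt0. Qed.

(* [Psi u v] dominates [lam ^ (q - 1)] whenever [u < a lam ^ (-q/D)] and [v > b lam ^ (q/p)] *)
Definition Psi (u v : R) : R :=
  (Num.min ((u / hls_a) `^ (- (D / q))) ((v / hls_b) `^ (p / q))) `^ (q - 1).

Lemma Psi_ge0 u v : 0 <= Psi u v. Proof. exact: powR_ge0. Qed.

Lemma measurable_Psi d (T : measurableType d) (u v : T -> R) :
  measurable_fun setT u -> measurable_fun setT v ->
  measurable_fun setT (fun t => Psi (u t) (v t)).
Proof.
move=> mu_ mv; apply: (measurableT_comp (measurable_powR _)).
by apply: measurable_minr; apply: (measurableT_comp (measurable_powR _)); apply: measurable_funM.
Qed.

Lemma Psi_lower lam u v : 0 < lam -> 0 < u -> u < hls_a * lam `^ (- (q / D)) ->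
  hls_b * lam `^ (q / p) < v -> lam `^ (q - 1) <= Psi u v.
Proof.
move=> l0 u0 ud vm; have a0 := hls_a_gt0; have b0 := hls_b_gt0.
have DQ : D / q * (q / D) = 1 by field; rewrite qN DN.
have PQ : p / q * (q / p) = 1 by field; rewrite qN pN.
apply: ge0_ler_powR; rewrite ?nnegrE ?(ltW l0)//.
- by rewrite subr_ge0 ltW.
- by rewrite le_min !powR_ge0.
rewrite le_min; apply/andP; split.
  have -> : lam = (lam `^ (- (q / D))) `^ (- (D / q)).
    by rewrite -powRrM mulrNN mulrC DQ powRr1// ltW.
  rewrite powRN [leRHS]powRN lef_pV2 ?posrE ?powR_gt0// ?divr_gt0//.
  apply: ge0_ler_powR; rewrite ?nnegrE ?powR_ge0 ?divr_ge0// ?(ltW q0) ?(ltW D0) ?(ltW u0) ?(ltW a0)//.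
  by rewrite ler_pdivrMr// mulrC ltW.
have -> : lam = (lam `^ (q / p)) `^ (p / q).
  by rewrite -powRrM mulrC PQ powRr1// ltW.
have v0 : 0 < v by apply: lt_trans vm; rewrite mulr_gt0// powR_gt0.
apply: ge0_ler_powR; rewrite ?nnegrE ?powR_ge0 ?divr_ge0// ?(ltW q0) ?(ltW p0) ?(ltW v0) ?(ltW b0)//.
by rewrite ler_pdivlMr// mulrC ltW.
Qed.

(** Decay exponent of [Psi] in [u]. Since [hls_g - 1 = (D / p) (p - 1)], the tail integral converges
    thanks to [p > 1]. *)
Definition hls_g : R := D / q * (q - 1).
Definition hls_C : R := hls_b `^ (- (p / q * (q - 1))) + hls_a `^ hls_g / (hls_g - 1).

Let hls_g1 : hls_g - 1 = D / p * (p - 1).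
Proof.
have E : D / q = D / p - 1.
  by rewrite pqD mulrBr divff.
rewrite /hls_g mulrBr mulr1 divfK// E; field; exact: pN.
Qed.

Let hls_g_gt1 : 1 < hls_g.
Proof. by rewrite -subr_gt0 hls_g1 mulr_gt0 ?divr_gt0// subr_gt0. Qed.

(** The two branches of the minimum cross, up to constants, at [u = v^(-p/D)]. Below it the
    [v]-branch is constant in [u], above it the [u]-branch is integrable, and by [1/q = 1/p - 1/D]
    both pieces come out as multiples of [v^p]. *)
Lemma Psi_int v : 0 <= v ->
  (\int[mu]_u (\1_(`]0%R, 1%R] : set R) u * (v * Psi u v))%:E <= (hls_C * v `^ p)%:E)%E.
Proof.
rewrite le_eqVlt => /predU1P[<-|v0].
  under eq_integral do rewrite mul0r mulr0.
  by rewrite integral0 powR0// mulr0.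
have a0 := hls_a_gt0; have b0 := hls_b_gt0.
pose u0 := v `^ (- (p / D)).
have u00 : 0 < u0 by rewrite powR_gt0.
pose c1 := (v / hls_b) `^ (p / q * (q - 1)).
have g10 : 0 < hls_g - 1 by rewrite subr_gt0.
have mI (A : set R) : measurable A -> measurable_fun setT (\1_A : R -> R).
  by move=> mA; exact: measurable_indic.
apply: (@le_trans _ _ (\int[mu]_u (v * (c1 * \1_(`]0%R, u0] : set R) u +
   hls_a `^ hls_g * (\1_(`[u0, 1%R] : set R) u * u `^ (- hls_g))))%:E)%E).
  apply: le_integral_EFin.
  - apply: measurable_funM; first exact: mI.
    by apply: measurable_funM => //; exact: measurable_Psi.
  - apply: measurable_funM => //; apply: measurable_funD.
      by apply: measurable_funM => //; exact: mI.
    by apply: measurable_funM => //; apply: measurable_funM => //; exact: mI.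
  - by move=> u; rewrite mulr_ge0// mulr_ge0 ?Psi_ge0 ?(ltW v0).
  - move=> u; rewrite mulrCA ler_wpM2l ?(ltW v0)//.
    have [uI|uI] := boolP (u \in (`]0%R, 1%R]%classic : set R)); last first.
      rewrite indicE (negbTE uI) mul0r addr_ge0// mulr_ge0 ?powR_ge0//.
      by rewrite mulr_ge0 ?powR_ge0.
    rewrite [in leLHS]indicE uI mul1r; move: uI; rewrite inE /= in_itv/= => /andP[up u1].
    have m0 : 0 <= Num.min ((u / hls_a) `^ (- (D / q))) ((v / hls_b) `^ (p / q)).
      by rewrite le_min !powR_ge0.
    have q10 : 0 <= q - 1 by rewrite subr_ge0 ltW.
    have [uu|uu] := leP u u0.
      apply: (@le_trans _ _ c1).
        rewrite /c1 powRrM; apply: ge0_ler_powR; rewrite ?nnegrE ?powR_ge0//.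
        by rewrite ge_min lexx orbT.
      rewrite indicE mem_set ?mulr1; last by rewrite /= in_itv/= up.
      by rewrite lerDl mulr_ge0 ?powR_ge0// mulr_ge0 ?powR_ge0.
    apply: (@le_trans _ _ (hls_a `^ hls_g * u `^ (- hls_g))).
      have -> : hls_a `^ hls_g * u `^ (- hls_g) = ((u / hls_a) `^ (- (D / q))) `^ (q - 1).
        rewrite -powRrM mulNr -/hls_g powRM ?invr_ge0 ?(ltW a0) ?(ltW up)// mulrC; congr (_ * _).
        by rewrite powRV ?(ltW a0)// opprK.
      apply: ge0_ler_powR; rewrite ?nnegrE ?powR_ge0//.
      by rewrite ge_min lexx.
    rewrite [X in _ <= _ + _ * (X * _)]indicE mem_set ?mul1r; last by rewrite /= in_itv/= ltW.
    by rewrite lerDr mulr_ge0// powR_ge0.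
rewrite integralZ_EFin ?(ltW v0)//; last 2 first.
- apply: measurable_funD.
    by apply: measurable_funM => //; exact: mI.
  by apply: measurable_funM => //; apply: measurable_funM => //; exact: mI.
- by move=> u; rewrite addr_ge0// mulr_ge0 ?powR_ge0// mulr_ge0 ?powR_ge0.
rewrite integralD_ge0_EFin; last 4 first.
- by apply: measurable_funM => //; exact: mI.
- by apply: measurable_funM => //; apply: measurable_funM => //; exact: mI.
- by move=> u; rewrite mulr_ge0 ?powR_ge0.
- by move=> u; rewrite mulr_ge0 ?powR_ge0// mulr_ge0 ?powR_ge0.
rewrite integralZ_EFin ?powR_ge0//.
rewrite integralZ_EFin ?powR_ge0//; last 2 first.
- by apply: measurable_funM => //; exact: mI.
- by move=> u; rewrite mulr_ge0 ?powR_ge0.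
rewrite integral_indic_itv ?(ltW u00)// subr0.
apply: (@le_trans _ _ (v%:E * ((c1 * u0)%:E + (hls_a `^ hls_g * (u0 `^ (1 - hls_g) / (hls_g - 1)))%:E))%E).
  rewrite lee_pmul2l ?lte_fin// leeD// EFinM lee_wpmul2l ?lee_fin ?powR_ge0//.
  exact: integral_powN_le.
rewrite -EFinD -EFinM lee_fin le_eqVlt; apply/orP; left; apply/eqP.
rewrite /hls_C mulrDl mulrDr; congr (_ + _).
  have bV : 0 <= hls_b^-1 by rewrite invr_ge0 ltW.
  rewrite /c1 /u0 (powRM _ (ltW v0) bV).
  rewrite (powRV _ (ltW b0)).
  set bb := hls_b `^ _.
  transitivity (bb * (v * (v `^ (p / q * (q - 1)) * v `^ (- (p / D))))); first by ring.
  congr (_ * _); rewrite -powRD; last by rewrite (gt_eqF v0) implybT.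
  rewrite -{1}(powRr1 (ltW v0)) -powRD; last by rewrite (gt_eqF v0) implybT.
  congr (_ `^ _).
  have -> : p / D = 1 - p / q by rewrite pqD mulrBr divff// opprB addrCA subrr addr0.
  by field; exact: qN.
rewrite /u0 -powRrM.
have -> : - (p / D) * (1 - hls_g) = p - 1.
  rewrite mulNr -mulrN opprB hls_g1; field; by rewrite pN DN.
transitivity (hls_a `^ hls_g / (hls_g - 1) * (v * v `^ (p - 1))); first by ring.
by rewrite mulr_powRB1// ltW.
Qed.

(** * The integral operator applied to a function of norm at most 1 *)

Section Operator.
Variable f : R -> R.
Hypothesis mf : measurable_fun setT f.
Hypothesis f_ge0 : forall x, 0 <= f x.
Hypothesis f_le1 : (\int[mu]_y (f y `^ p * W y)%:E <= 1)%E.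

Definition Pop (g : R -> R) (u x : R) : \bar R := (\int[mu]_y (Q u x y * g y * W y)%:E)%E.

Let mQy u x : measurable_fun setT (Q u x).
Proof.
apply: (measurableT_comp mQ (_ : measurable_fun setT (fun y => ((u, x), y)))).
exact: pair1_measurable.
Qed.

Let mQx u y : measurable_fun setT (fun x => Q u x y).
Proof.
apply: (measurableT_comp mQ (_ : measurable_fun setT (fun x => ((u, x), y)))).
exact: (measurable_fun_pair (pair1_measurable u) (measurable_cst y)).
Qed.

Let mQgW g u x : measurable_fun setT g -> measurable_fun setT (fun y => Q u x y * g y * W y).
Proof. by move=> mg; apply: measurable_funM => //; apply: measurable_funM. Qed.

Let mQWy u x : measurable_fun setT (fun y => Q u x y * W y).
Proof. exact: measurable_funM. Qed.

Let mQWx u y : measurable_fun setT (fun x => Q u x y * W x).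
Proof. exact: measurable_funM. Qed.

Lemma Pop_ge0 g u x : (forall y, 0 <= g y) -> (0 <= Pop g u x)%E.
Proof.
by move=> g0; apply: integral_ge0 => y _; rewrite lee_fin mulr_ge0// mulr_ge0.
Qed.

Lemma Pop_le (g h : R -> R) u x : measurable_fun setT g -> measurable_fun setT h ->
  (forall y, 0 <= g y) -> (forall y, g y <= h y) -> (Pop g u x <= Pop h u x)%E.
Proof.
move=> mg mh g0 gh; apply: le_integral_EFin.
- exact: mQgW.
- exact: mQgW.
- by move=> y; rewrite mulr_ge0// mulr_ge0.
- by move=> y; rewrite ler_wpM2r// ler_wpM2l.
Qed.

Lemma Pop_cstD (m : R) (h : R -> R) u x : 0 <= m -> measurable_fun setT h -> (forall y, 0 <= h y) ->
  (Pop (fun y => (m + h y)%R) u x <= m%:E + Pop h u x)%E.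
Proof.
move=> m0 mh h0.
have -> : Pop (fun y => (m + h y)%R) u x =
    (\int[mu]_y (m * (Q u x y * W y) + Q u x y * h y * W y)%:E)%E.
  by apply: eq_integral => y _; congr EFin; ring.
rewrite integralD_ge0_EFin; last 4 first.
- by apply: measurable_funM; [exact: measurable_cst|exact: mQWy].
- exact: mQgW.
- by move=> y; rewrite !mulr_ge0.
- by move=> y; rewrite !mulr_ge0.
rewrite leeD2r// integralZ_EFin//; last 2 first.
- exact: mQWy.
- by move=> y; rewrite mulr_ge0.
by rewrite -[leRHS]mule1 lee_wpmul2l.
Qed.

(** In place of Hoelder's inequality, [f <= m + m^(1-p) f^p]: the mass bound handles the constant,
    the sup bound [B u^(-D)] the integrable part, and [m = u^(-D/p)] balances the two. *)
Lemma Pop_f_le u x : 0 < u <= 1 -> (Pop f u x <= ((1 + B) * u `^ (- (D / p)))%:E)%E.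
Proof.
move=> u01; have /andP[u0 u1] := u01.
pose m := u `^ (- (D / p)).
have m0 : 0 < m by rewrite powR_gt0.
pose h y := m `^ (1 - p) * f y `^ p.
have mfp : measurable_fun setT (fun y => f y `^ p).
  exact: (measurableT_comp (measurable_powR _)).
have mh : measurable_fun setT h by apply: measurable_funM.
have h0 y : 0 <= h y by rewrite mulr_ge0 ?powR_ge0.
have fh y : f y <= m + h y.
  have [fm|fm] := leP (f y) m; first by rewrite (le_trans fm)// lerDl.
  have fy0 : 0 < f y := lt_trans m0 fm.
  rewrite (le_trans _ (_ : h y <= _))//; last by rewrite lerDr ltW.
  rewrite /h -(mulr_powRB1 (ltW fy0) p0) mulrCA -[leLHS]mulr1 ler_wpM2l ?(ltW fy0)//.
  rewrite -[leLHS](powR_cancel p m0).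
  rewrite ler_wpM2l ?powR_ge0// ge0_ler_powR ?nnegrE ?(ltW m0) ?(ltW fm) ?(ltW fy0)//.
  by rewrite subr_ge0 ltW.
apply: (le_trans (Pop_le u x mf _ f_ge0 fh)); first exact: measurable_funD.
apply: (le_trans (Pop_cstD u x (ltW m0) mh h0)).
rewrite mulrDl mul1r EFinD leeD//.
have -> : (B * u `^ (- (D / p)))%:E = ((B * u `^ (- D) * m `^ (1 - p))%:E * 1)%E.
  rewrite mule1 /m -powRrM -mulrA -powRD ?(gt_eqF u0) ?implybT//.
  by congr (_ * _ `^ _)%:E; field; exact: pN.
have c0 : 0 <= B * u `^ (- D) * m `^ (1 - p) by rewrite mulr_ge0 ?powR_ge0// mulr_ge0 ?powR_ge0.
apply: (@le_trans _ _ ((B * u `^ (- D) * m `^ (1 - p))%:E * \int[mu]_y (f y `^ p * W y)%:E)%E); last first.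
  by rewrite lee_wpmul2l// lee_fin.
rewrite -integralZ_EFin//; last 2 first.
- exact: measurable_funM.
- by move=> y; rewrite mulr_ge0 ?powR_ge0.
apply: le_integral_EFin.
- exact: mQgW.
- by apply: measurable_funM => //; apply: measurable_funM.
- by move=> y; rewrite mulr_ge0// mulr_ge0.
- move=> y; rewrite [leLHS](_ : _ = Q u x y * (m `^ (1 - p) * (f y `^ p * W y))); last first.
    by rewrite /h; ring.
  rewrite -[leRHS]mulrA ler_wpM2r; [by []|by rewrite !mulr_ge0 ?powR_ge0|].
  exact: Q_le.
Qed.

Definition PPsi (u x : R) : \bar R := Pop (fun y => f y * Psi u (f y)) u x.

(** Three regimes: outside []0, 1]] the kernel vanishes; for [u >= dl] the balanced bound [Pop_f_le]
    applies; for [u < dl] the values of [f] up to [m] cost at most [m] by the mass bound, and where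
    [f > m] the factor [lam^(1-q) Psi u (f y)] is at least 1. *)
Lemma Pop_pointwise lam u x (dl := hls_a * lam `^ (- (q / D))) (m := hls_b * lam `^ (q / p)) :
  0 < lam ->
  (Pop f u x <= (m * \1_(`]0%R, dl[ : set R) u +
    (1 + B) * (\1_(`[dl, 1%R] : set R) u * u `^ (- (D / p))))%:E +
    (lam `^ (1 - q))%:E * PPsi u x)%E.
Proof.
move=> l0; have a0 := hls_a_gt0; have b0 := hls_b_gt0.
have dl0 : 0 < dl by rewrite mulr_gt0// powR_gt0.
have m0 : 0 < m by rewrite mulr_gt0// powR_gt0.
have B1 : 0 <= 1 + B by rewrite addr_ge0.
have PP0 : (0 <= (lam `^ (1 - q))%:E * PPsi u x)%E.
  rewrite mule_ge0 ?lee_fin ?powR_ge0//; apply: Pop_ge0 => y.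
  by rewrite mulr_ge0// Psi_ge0.
have [u01|u01] := boolP (0 < u <= 1); last first.
  rewrite /Pop (eq_integral (fun=> 0%E)); last by move=> y _; rewrite Q_out// !mul0r.
  rewrite integral0 adde_ge0// lee_fin addr_ge0// mulr_ge0 ?(ltW m0)//.
  by rewrite mulr_ge0// powR_ge0.
have /andP[u0 u1] := u01.
have [du|ud] := leP dl u.
  rewrite -[leLHS]adde0 leeD//; apply: (le_trans (Pop_f_le x u01)).
  rewrite lee_fin [X in _ <= _ + _ * (X * _)]indicE mem_set ?mul1r; last first.
    by rewrite /= in_itv/= du.
  by rewrite lerDr mulr_ge0// ltW.
rewrite [\1_(`]0%R, dl[ : set R) u]indicE mem_set ?mulr1; last by rewrite /= in_itv/= u0.
pose h y := f y * \1_(`]m, +oo[ : set R) (f y).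
have mh : measurable_fun setT h.
  apply: measurable_funM => //; apply: (measurableT_comp _ mf).
  exact: measurable_indic.
have h0 y : 0 <= h y by rewrite mulr_ge0.
have fh y : f y <= m + h y.
  rewrite /h indicE; have [fy|fy] := boolP (f y \in _); first by rewrite mulr1 lerDr ltW.
  rewrite mulr0 addr0 leNgt; apply: contra fy => fm.
  by rewrite inE /= in_itv/= fm.
apply: (le_trans (Pop_le u x mf _ f_ge0 fh)); first exact: measurable_funD.
apply: (le_trans (Pop_cstD u x (ltW m0) mh h0)).
rewrite leeD//.
  by rewrite lee_fin lerDl mulr_ge0// mulr_ge0// powR_ge0.
have mPsi : measurable_fun setT (fun y => f y * Psi u (f y)).
  by apply: measurable_funM => //; exact: measurable_Psi.
rewrite /PPsi /Pop -integralZ_EFin ?powR_ge0//; last 2 first.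
- exact: mQgW.
- by move=> y; rewrite !mulr_ge0// Psi_ge0.
apply: le_integral_EFin.
- exact: mQgW.
- by apply: measurable_funM => //; exact: mQgW.
- by move=> y; rewrite !mulr_ge0.
move=> y; rewrite !mulrA ler_wpM2r// -!mulrA [leRHS]mulrCA ler_wpM2l//.
rewrite [leRHS]mulrCA ler_wpM2l// indicE; have [fy|_] := boolP (f y \in _); last first.
  by rewrite mulr_ge0 ?powR_ge0// Psi_ge0.
move: fy; rewrite inE /= in_itv/= andbT => fm.
rewrite [leLHS](_ : _ = lam `^ (1 - q) * lam `^ (q - 1)); last by rewrite powR_cancel.
by rewrite ler_wpM2l ?powR_ge0// Psi_lower.
Qed.

Definition Top (x : R) : \bar R := (\int[mu]_u Pop f u x)%E.

Let mK2 : measurable_fun setT (fun z : (R * R) * R =>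
  (Q z.1.1 z.1.2 z.2 * (f z.2 * Psi z.1.1 (f z.2)) * W z.2)%:E).
Proof.
apply/measurable_EFinP; apply: measurable_funM; last exact: (measurableT_comp mW).
apply: measurable_funM => //; apply: measurable_funM; first exact: (measurableT_comp mf).
apply: measurable_Psi; last exact: (measurableT_comp mf).
exact: (measurableT_comp measurable_fst).
Qed.

Let mK1 : measurable_fun setT (fun z : (R * R) * R =>
  (Q z.1.1 z.1.2 z.2 * f z.2 * W z.2)%:E).
Proof.
apply/measurable_EFinP; apply: measurable_funM; last exact: (measurableT_comp mW).
by apply: measurable_funM => //; exact: (measurableT_comp mf).
Qed.

Lemma measurable_Pop2 : measurable_fun setT (fun z : R * R => Pop f z.1 z.2).
Proof.
apply: (@measurable_fun_fubini_tonelli_F _ _ _ _ _ mu _ mK1) => z.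
by rewrite lee_fin !mulr_ge0.
Qed.

Lemma measurable_PPsi2 : measurable_fun setT (fun z : R * R => PPsi z.1 z.2).
Proof.
apply: (@measurable_fun_fubini_tonelli_F _ _ _ _ _ mu _ mK2) => z.
by rewrite lee_fin !mulr_ge0// Psi_ge0.
Qed.

Lemma PPsi_ge0 u x : (0 <= PPsi u x)%E.
Proof. by apply: Pop_ge0 => y; rewrite mulr_ge0// Psi_ge0. Qed.

Lemma measurable_Pop_u x : measurable_fun setT (fun u => Pop f u x).
Proof.
apply: (measurableT_comp measurable_Pop2 (_ : measurable_fun setT (fun u : R => (u, x)))).
exact: pair2_measurable.
Qed.

Lemma measurable_PPsi_u x : measurable_fun setT (fun u => PPsi u x).
Proof.
apply: (measurableT_comp measurable_PPsi2 (_ : measurable_fun setT (fun u : R => (u, x)))).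
exact: pair2_measurable.
Qed.

Definition GPsi (x : R) : \bar R := (\int[mu]_u PPsi u x)%E.

(** Integrating the pointwise estimate in [u] gives [lam <= 2 lam / 3 + lam^(1-q) GPsi x]. As [GPsi]
    is free of [lam], the level may be taken to be the value [Top x] itself, and the conclusion
    becomes a pointwise bound of [Top^q]. *)
Lemma Top_lower lam x : 0 < lam -> (lam%:E <= Top x)%E ->
  ((lam `^ q)%:E <= 3%:E * GPsi x)%E.
Proof.
move=> l0; pose dl := hls_a * lam `^ (- (q / D)); pose m := hls_b * lam `^ (q / p).
have a0 := hls_a_gt0; have b0 := hls_b_gt0.
have dl0 : 0 < dl by rewrite mulr_gt0// powR_gt0.
have m0 : 0 < m by rewrite mulr_gt0// powR_gt0.
have B1 : 0 <= 1 + B by rewrite addr_ge0.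
have Dp1 : 1 < D / p by rewrite ltr_pdivlMr// mul1r.
have mI (A : set R) : measurable A -> measurable_fun setT (\1_A : R -> R).
  by move=> mA; exact: measurable_indic.
pose F1 (u : R) := m * \1_(`]0%R, dl[ : set R) u.
pose F2 (u : R) := (1 + B) * (\1_(`[dl, 1%R] : set R) u * u `^ (- (D / p))).
have mF1 : measurable_fun setT F1 by apply: measurable_funM => //; exact: mI.
have mF2' : measurable_fun setT (fun u : R => \1_(`[dl, 1%R] : set R) u * u `^ (- (D / p))).
  by apply: measurable_funM => //; exact: mI.
have mF2 : measurable_fun setT F2 by apply: measurable_funM.
have F10 u : 0 <= F1 u by rewrite mulr_ge0// ltW.
have F20' u : 0 <= \1_(`[dl, 1%R] : set R) u * u `^ (- (D / p)) by rewrite mulr_ge0// powR_ge0.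
have F20 u : 0 <= F2 u by rewrite mulr_ge0.
have mP : measurable_fun setT (fun u => (lam `^ (1 - q))%:E * PPsi u x)%E.
  by apply: emeasurable_funM => //; exact: measurable_PPsi_u.
have P0 u : (0 <= (lam `^ (1 - q))%:E * PPsi u x)%E.
  by rewrite mule_ge0 ?PPsi_ge0// lee_fin powR_ge0.
have T1 : (Top x <= \int[mu]_u ((F1 u + F2 u)%:E + (lam `^ (1 - q))%:E * PPsi u x))%E.
  apply: ge0_le_integral => //.
  - by move=> u _; exact: Pop_ge0.
  - exact: measurable_Pop_u.
  - by apply: emeasurable_funD => //; apply/measurable_EFinP; exact: measurable_funD.
  - by move=> u _; exact: Pop_pointwise.
rewrite ge0_integralD// in T1; last 2 first.
- by move=> u _; rewrite lee_fin addr_ge0.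
- by apply/measurable_EFinP; exact: measurable_funD.
rewrite integralD_ge0_EFin// integralZ_EFin ?(ltW m0)// integralZ_EFin// in T1.
rewrite integral_indic_itv ?(ltW dl0)// subr0 ge0_integralZl// in T1; last 3 first.
- exact: measurable_PPsi_u.
- by move=> u _; exact: PPsi_ge0.
- by rewrite lee_fin powR_ge0.
have E1 : m * dl = lam / 3.
  rewrite /m /dl.
  transitivity ((hls_b * hls_a) * (lam `^ (q / p) * lam `^ (- (q / D)))); first by ring.
  rewrite -powRD ?(gt_eqF l0) ?implybT//.
  have -> : q / p - q / D = 1 by rewrite -mulrBr -pqD divff.
  rewrite powRr1 ?(ltW l0)// mulrC /hls_b invfM mulfVK ?gt_eqF//.
have E2 : (1 + B) * (dl `^ (1 - D / p) / (D / p - 1)) = lam / 3.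
  have DQ : D / q = D / p - 1 by rewrite pqD mulrBr divff.
  have -> : 1 - D / p = - (D / q) by rewrite DQ; ring.
  rewrite -DQ /dl powRM ?(ltW a0) ?powR_ge0// -powRrM mulrNN.
  have -> : q / D * (D / q) = 1 by field; rewrite DN qN.
  rewrite powRr1 ?(ltW l0)// /hls_a -powRrM.
  have -> : q / D * - (D / q) = -1 by field; rewrite DN qN.
  have B10 : 0 < 1 + B by rewrite ltr_wpDr.
  rewrite powR_inv1; last by rewrite !mulr_ge0// ?invr_ge0 ltW.
  by field; rewrite DN qN gt_eqF.
have T2 : (Top x <= (lam / 3 + lam / 3)%:E + (lam `^ (1 - q))%:E * GPsi x)%E.
  apply: (le_trans T1); apply: leeD; last exact: lexx.
  rewrite [leRHS]EFinD; apply: leeD.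
    by rewrite -EFinM E1.
  rewrite -E2 EFinM lee_wpmul2l ?lee_fin//.
  exact: integral_powN_le.
move=> lT; have {lT T1 T2} := le_trans lT T2.
have G0 : (0 <= GPsi x)%E by apply: integral_ge0 => u _; exact: PPsi_ge0.
move: (GPsi x) G0 => [g| |] // g0.
- rewrite -!EFinM -EFinD !lee_fin => H.
  have H2 : lam / 3 <= lam `^ (1 - q) * g by lra.
  have -> : lam `^ q = lam * lam `^ (q - 1) by rewrite mulr_powRB1// ltW.
  have E := powR_cancel q l0.
  have := ler_wpM2r (powR_ge0 lam (q - 1)) H2.
  have -> : lam `^ (1 - q) * g * lam `^ (q - 1) = g by rewrite mulrAC E mul1r.
  by lra.
- by move=> _; rewrite gt0_muley ?leey// lte_fin.
Qed.

Lemma Top_ge0 x : (0 <= Top x)%E.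
Proof. by apply: integral_ge0 => u _; exact: Pop_ge0. Qed.

Lemma Top_pow_le x : (Top x `^ q <= 3%:E * GPsi x)%E.
Proof.
have := Top_ge0 x; case E : (Top x) => [t| |] // t0.
- rewrite lee_fin in t0; rewrite poweR_EFin.
  have [t1|t1] := ltP 0 t; first by apply: Top_lower => //; rewrite E.
  have -> : t = 0 by apply/le_anti; rewrite t1.
  rewrite powR0// mule_ge0 ?lee_fin//.
  by apply: integral_ge0 => u _; exact: PPsi_ge0.
(* If [Top x] is infinite, every level is admissible; [lam = A^(1/q)] shows that [3 GPsi x] is at
   least any given [A > 0]. *)
- rewrite poweRyr// leye_eq; apply/eqP/eqyP => A A0.
  apply: le_trans (Top_lower (lam := A `^ q^-1) _ _).
  + by rewrite -powRrM mulVf// powRr1// ltW.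
  + exact: powR_gt0.
  + by rewrite E leey.
Qed.

Let mH : measurable_fun setT (fun z : (R * R) * R =>
  (Q z.1.1 z.1.2 z.2 * (f z.2 * Psi z.1.1 (f z.2)) * W z.2 * W z.1.2)%:E).
Proof.
apply/measurable_EFinP; apply: measurable_funM.
  exact/measurable_EFinP.
by apply: (measurableT_comp mW); apply: (measurableT_comp measurable_snd).
Qed.

Let H_ge0 u x y : (0 <= (Q u x y * (f y * Psi u (f y)) * W y * W x)%:E)%E.
Proof. by rewrite lee_fin !mulr_ge0// Psi_ge0. Qed.

(** Tonelli brings [x] innermost, where the mass bound [Q_int1] removes the kernel and leaves the
    indicator of []0, 1]]; then it brings [u] innermost, where [Psi_int] produces [hls_C f^p]. *)
Lemma hls_final : (\int[mu]_x (Top x `^ q * (W x)%:E) <= (3 * hls_C)%:E)%E.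
Proof.
have mG : measurable_fun setT GPsi.
  apply: (@measurable_fun_fubini_tonelli_G _ _ _ _ _ mu (fun z => PPsi z.1 z.2)).
    exact: measurable_PPsi2.
  by move=> z; exact: PPsi_ge0.
have mT : measurable_fun setT Top.
  apply: (@measurable_fun_fubini_tonelli_G _ _ _ _ _ mu (fun z => Pop f z.1 z.2)).
    exact: measurable_Pop2.
  by move=> z; exact: Pop_ge0.
have mWE : measurable_fun setT (fun x => (W x)%:E) by exact/measurable_EFinP.
have G0 x : (0 <= GPsi x)%E by apply: integral_ge0 => u _; exact: PPsi_ge0.
have C0 : 0 <= hls_C.
  by rewrite addr_ge0 ?powR_ge0// divr_ge0 ?powR_ge0// subr_ge0 ltW.
apply: (@le_trans _ _ (\int[mu]_x (3%:E * (GPsi x * (W x)%:E)))%E).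
  apply: ge0_le_integral; first exact: measurableT.
  - by move=> x _; rewrite mule_ge0 ?poweR_ge0 ?lee_fin.
  - by apply: emeasurable_funM => //; exact: (measurableT_comp (measurable_poweR _)).
  - apply: emeasurable_funM; [exact: measurable_cst|].
    by apply: emeasurable_funM; [exact: mG|exact: mWE].
  - by move=> x _; rewrite muleA lee_wpmul2r ?lee_fin// Top_pow_le.
rewrite ge0_integralZl//; last 2 first.
- by apply: emeasurable_funM; [exact: mG|exact: mWE].
- by move=> x _; rewrite mule_ge0 ?lee_fin.
rewrite EFinM lee_wpmul2l ?lee_fin//.
have -> : (\int[mu]_x (GPsi x * (W x)%:E) = \int[mu]_x \int[mu]_u \int[mu]_y
   (Q u x y * (f y * Psi u (f y)) * W y * W x)%:E)%E.
  apply: eq_integral => x _; rewrite /GPsi -ge0_integralZr//; last 3 first.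
  - exact: measurable_PPsi_u.
  - by move=> u _; exact: PPsi_ge0.
  - by rewrite lee_fin.
  apply: eq_integral => u _; rewrite /PPsi /Pop -ge0_integralZr//.
  - apply/measurable_EFinP; apply: mQgW; apply: measurable_funM => //.
    exact: measurable_Psi.
  - by move=> y _; rewrite lee_fin !mulr_ge0// Psi_ge0.
  - by rewrite lee_fin.
have mg : measurable_fun setT (fun z : R * R => (\int[mu]_y
   (Q z.1 z.2 y * (f y * Psi z.1 (f y)) * W y * W z.2)%:E)%E).
  by apply: (@measurable_fun_fubini_tonelli_F _ _ _ _ _ mu _ mH) => z; exact: H_ge0.
rewrite -(@fubini_tonelli _ _ _ _ _ mu mu _ mg); last by move=> z; exact: integral_ge0.
have mPsi2 : measurable_fun setT (fun z : R * R =>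
    (\1_(`]0%R, 1%R] : set R) z.1 * (f z.2 * Psi z.1 (f z.2)) * W z.2)%:E).
  apply/measurable_EFinP; apply: measurable_funM; last exact: (measurableT_comp mW).
  apply: measurable_funM.
    by apply: (measurableT_comp _ measurable_fst); exact: measurable_indic.
  apply: measurable_funM; first exact: (measurableT_comp mf).
  by apply: measurable_Psi; [exact: measurable_fst|exact: (measurableT_comp mf)].
have P2_ge0 z : (0 <= (\1_(`]0%R, 1%R] : set R) z.1 * (f z.2 * Psi z.1 (f z.2)) * W z.2)%:E)%E.
  by rewrite lee_fin !mulr_ge0// Psi_ge0.
apply: (@le_trans _ _ (\int[mu]_u \int[mu]_y
  (\1_(`]0%R, 1%R] : set R) u * (f y * Psi u (f y)) * W y)%:E)%E).
  apply: ge0_le_integral; first exact: measurableT.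
  - by move=> u _; apply: integral_ge0 => x _; exact: integral_ge0.
  - apply: (@measurable_fun_fubini_tonelli_F _ _ _ _ _ mu _ mg) => z; exact: integral_ge0.
  - by apply: (@measurable_fun_fubini_tonelli_F _ _ _ _ _ mu _ mPsi2) => z; exact: P2_ge0.
  move=> u _ /=.
  have mHu : measurable_fun setT (fun z : R * R =>
      (Q u z.1 z.2 * (f z.2 * Psi u (f z.2)) * W z.2 * W z.1)%:E).
    apply: (measurableT_comp mH (_ : measurable_fun setT (fun z : R * R => ((u, z.1), z.2)))).
    apply: measurable_fun_pair => //.
    exact: (measurable_fun_pair (measurable_cst u) measurable_fst).
  rewrite (@fubini_tonelli _ _ _ _ _ mu mu _ mHu); last by move=> z; exact: H_ge0.
  apply: ge0_le_integral; first exact: measurableT.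
  - by move=> y _; exact: integral_ge0.
  - by apply: (@measurable_fun_fubini_tonelli_G _ _ _ _ _ mu _ mHu) => z; exact: H_ge0.
  - apply: (measurableT_comp mPsi2 (_ : measurable_fun setT (fun y : R => (u, y)))).
    exact: pair1_measurable.
  move=> y _ /=.
  have [u01|u01] := boolP (0 < u <= 1); last first.
    rewrite (eq_integral (fun=> 0%E)); last by move=> x _; rewrite Q_out// !mul0r.
    by rewrite integral0 lee_fin !mulr_ge0// Psi_ge0.
  have -> : (\int[mu]_x (Q u x y * (f y * Psi u (f y)) * W y * W x)%:E =
    \int[mu]_x ((f y * Psi u (f y) * W y) * (Q u x y * W x))%:E)%E.
    by apply: eq_integral => x _; congr EFin; ring.
  have c0 : 0 <= f y * Psi u (f y) * W y by rewrite !mulr_ge0// Psi_ge0.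
  rewrite integralZ_EFin//; last 2 first.
  - exact: mQWx.
  - by move=> x; rewrite mulr_ge0.
  rewrite indicE mem_set ?mul1r; last by rewrite /= in_itv.
  by rewrite -[leRHS]mule1 lee_wpmul2l// lee_fin.
rewrite (@fubini_tonelli _ _ _ _ _ mu mu _ mPsi2); last by move=> z; exact: P2_ge0.
apply: (@le_trans _ _ (\int[mu]_y (hls_C * (f y `^ p * W y))%:E)%E); last first.
  have mfp : measurable_fun setT (fun y => f y `^ p * W y).
    by apply: measurable_funM => //; exact: (measurableT_comp (measurable_powR _)).
  rewrite integralZ_EFin//; last by move=> y; rewrite mulr_ge0 ?powR_ge0.
  by rewrite -[leRHS]mule1 lee_wpmul2l ?lee_fin.
apply: ge0_le_integral; first exact: measurableT.
- by move=> y _; exact: integral_ge0.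
- by apply: (@measurable_fun_fubini_tonelli_G _ _ _ _ _ mu _ mPsi2) => z; exact: P2_ge0.
- apply/measurable_EFinP; apply: measurable_funM => //; apply: measurable_funM => //.
  exact: (measurableT_comp (measurable_powR _)).
move=> y _ /=; rewrite [leRHS](_ : _ = ((W y)%:E * (hls_C * f y `^ p)%:E)%E); last first.
  by rewrite -EFinM; congr EFin; ring.
have -> : (\int[mu]_u (\1_(`]0%R, 1%R] : set R) u * (f y * Psi u (f y)) * W y)%:E =
  \int[mu]_u (W y * (\1_(`]0%R, 1%R] : set R) u * (f y * Psi u (f y))))%:E)%E.
  by apply: eq_integral => u _; congr EFin; ring.
rewrite integralZ_EFin//; last 2 first.
- apply: measurable_funM; first exact: measurable_indic.
  by apply: measurable_funM => //; exact: measurable_Psi.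
- by move=> u; rewrite !mulr_ge0// Psi_ge0.
by rewrite lee_wpmul2l ?lee_fin// Psi_int.
Qed.

End Operator.
End HLS.

(** * Subordination *)

Section Subordination.
Variables (R : realType) (alpha : R).
Hypothesis alpha_gt0 : 0 < alpha.
Local Notation mu := (@lebesgue_measure R).

Lemma measurable_expN (g : R -> R) : measurable_fun setT g ->
  measurable_fun setT (fun u => expR (- g u)).
Proof.
move=> mg; have m2 : measurable_fun setT (fun u => - g u) by exact: measurableT_comp mg.
exact: (measurableT_comp (@measurable_expR R) m2).
Qed.

Lemma measurable_expNpow (c b : R) (D : set R) :
  measurable_fun D (fun u : R => expR (- ((c * u) `^ b))).
Proof.
apply: measurable_funTS; apply: measurable_expN.
by apply: (measurableT_comp (measurable_powR b)); exact: measurable_funM.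
Qed.

(** Set to 0 for [u <= 0], so that integrals over [u > 0] become integrals over the line. *)
Definition rr (u : R) : R := expR (- (u `^ alpha^-1)) * \1_(`]0%R, +oo[ : set R) u.

Lemma rrE u : 0 < u -> rr u = expR (- (u `^ alpha^-1)).
Proof. by move=> u0; rewrite /rr indicE mem_set ?mulr1//= in_itv/= u0. Qed.

Lemma rr_out u : u <= 0 -> rr u = 0.
Proof. by move=> u0; rewrite /rr indicE memNset ?mulr0//= in_itv/= andbT; apply/negP; rewrite -leNgt. Qed.

Lemma rr_gt0 u : 0 < u -> 0 < rr u.
Proof. by move=> u0; rewrite rrE// expR_gt0. Qed.

Lemma rr_ge0 u : 0 <= rr u.
Proof. by rewrite mulr_ge0// expR_ge0. Qed.

Lemma rr_lt1 u : rr u < 1.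
Proof.
have [u0|u0] := ltP 0 u; last by rewrite rr_out.
by rewrite rrE// -expR0 ltr_expR oppr_lt0 powR_gt0.
Qed.

Lemma rr_01 u : 0 <= rr u < 1. Proof. by rewrite rr_ge0 rr_lt1. Qed.

Lemma measurable_rr : measurable_fun setT rr.
Proof.
apply: measurable_funM; last exact: measurable_indic.
by apply: measurable_expN; exact: measurable_powR.
Qed.

(** [1 - exp(-x) >= x / (1 + x) >= x / 2] for [0 < x <= 1], with [x = u^(1/alpha)]. *)
Lemma rr_half u : 0 < u <= 1 -> u `^ alpha^-1 / 2 <= 1 - rr u.
Proof.
move=> /andP[u0 u1]; rewrite rrE//; set x := u `^ _.
have x0 : 0 < x by rewrite powR_gt0.
have x1 : x <= 1.
  rewrite /x -[leRHS](powRr0 u) ger_powR ?u0//.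
  by rewrite invr_ge0 ltW.
have e1 : expR (- x) <= (1 + x)^-1.
  by rewrite expRN lef_pV2 ?posrE ?expR_gt0 ?addr_gt0// expR_ge1Dx.
apply: (@le_trans _ _ (1 - (1 + x)^-1)); last by rewrite lerD2l lerN2.
have -> : 1 - (1 + x)^-1 = x / (1 + x) by field; rewrite gt_eqF// addr_gt0.
by rewrite ler_pM2l// lef_pV2 ?posrE ?addr_gt0//; lra.
Qed.

(** The reason for the exponent [1/alpha]: a power becomes a dilation by [n^alpha], so the integral
    of [rr^n] scales like [n^(-alpha)]. *)
Lemma rr_scale (n : nat) u : (0 < n)%N -> rr u ^+ n = rr (n%:R `^ alpha * u).
Proof.
move=> n0; have n1 : 0 < n%:R `^ alpha :> R by rewrite powR_gt0// ltr0n.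
have [u0|u0] := ltP 0 u; last first.
  by rewrite !rr_out// ?expr0n ?gtn_eqF// mulr_ge0_le0// ltW.
rewrite !rrE ?mulr_gt0// -expRM_natl powRM ?(ltW u0) ?(ltW n1)// -powRrM.
by rewrite divff ?gt_eqF// powRr1// mulrN.
Qed.

Lemma rr_continuous_itv : {within `[0%R, +oo[, continuous (fun u : R => expR (- (u `^ alpha^-1)))}.
Proof.
have E : {in (`[0%R, +oo[%classic : set R), (fun u : R => expR (- (`|u| `^ alpha^-1))) =1
   (fun u : R => expR (- (u `^ alpha^-1)))}.
  by move=> u; rewrite inE /= in_itv/= andbT => u0; rewrite ger0_norm.
apply: (subspace_eq_continuous E).
apply: continuous_subspaceT => u; apply: (@continuous_comp _ _ _ (fun u : R => - (`|u| `^ alpha^-1)) expR).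
  by apply: cvgN; apply: continuous_abspow; rewrite invr_gt0.
exact: continuous_expR.
Qed.

Lemma int_rr_itv : (\int[mu]_u (rr u)%:E =
  \int[mu]_(u in `[0%R, +oo[) (expR (- (u `^ alpha^-1)))%:E)%E.
Proof.
rewrite -integral_itv_obnd_cbnd; last first.
  apply/measurable_EFinP; apply: measurable_funTS.
  by apply: measurable_expN; exact: measurable_powR.
rewrite [RHS]integral_mkcond; apply: eq_integral => u _; rewrite patchE /rr indicE.
by case: ifPn => _; rewrite ?mulr1 ?mulr0.
Qed.

Lemma int_rr_scale (c : R) : 0 < c ->
  (\int[mu]_u (rr u)%:E = c%:E * \int[mu]_u (rr (c * u))%:E)%E.
Proof.
move=> c0.
have -> : (\int[mu]_u (rr (c * u))%:E =
    \int[mu]_(u in `[0%R, +oo[) (expR (- ((c * u) `^ alpha^-1)))%:E)%E.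
  rewrite -integral_itv_obnd_cbnd; last first.
    by apply/measurable_EFinP; exact: measurable_expNpow.
  rewrite [RHS]integral_mkcond; apply: eq_integral => u _; rewrite patchE.
  have [u0|u0] := ltP 0 u.
    by rewrite mem_set ?rrE ?mulr_gt0//= in_itv/= u0.
  rewrite memNset ?rr_out ?pmulr_rle0//=.
  by rewrite in_itv/= andbT; apply/negP; rewrite -leNgt.
rewrite int_rr_itv.
have dF : (fun u : R => c * u)^`()%classic = cst c.
  apply/funext => u; rewrite derive1E.
  have d : is_derive u 1 (fun u : R => c * u) c.
    have d := is_deriveZ c (is_derive_id u 1).
    by refine (is_derive_eq d _); rewrite /GRing.scale/= mulr1.
  by rewrite derive_val.
have := @increasing_ge0_integration_by_substitutiony _ (fun u : R => c * u)
  (fun u => expR (- (u `^ alpha^-1))) 0.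
rewrite mulr0 dF => -> //.
- rewrite -ge0_integralZl//.
  + apply: eq_integral => u _; rewrite -EFinM; congr EFin.
    by rewrite fctE /= mulrC.
  + by apply/measurable_EFinP; exact: measurable_expNpow.
  + by rewrite lee_fin ltW.
- by move=> x y _ _ xy; rewrite ltr_pM2l.
- by move=> x _; exact: cst_continuous.
- exact: is_cvg_cst.
- exact: is_cvg_cst.
- split.
    by move=> x _; apply: derivableM; [exact: derivable_cst|exact: derivable_id].
  by apply: cvg_at_right_filter; apply: cvgM; [exact: cvg_cst|exact: cvg_id].
- by apply: gt0_cvgMry => //; exact: cvg_id.
- exact: rr_continuous_itv.
Qed.

Lemma int_rr_lty : (\int[mu]_u (rr u)%:E < +oo)%E.
Proof.
(* [m > 2 alpha], so that [exp x >= x^m / m!] with [x = u^(1/alpha)] yields decay like [u^(-2)]. *)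
pose m := (Num.truncn (2 * alpha)).+1.
pose C : R := m`!%:R.
have C0 : 0 < C by rewrite ltr0n fact_gt0.
have key u : 1 <= u -> rr u <= C * u `^ (- 2).
  move=> u1; have u0 : 0 < u := lt_le_trans ltr01 u1.
  rewrite rrE//; set x := u `^ _.
  have x1 : 1 <= x.
    rewrite /x -[leLHS](powRr0 u) ler_powR//.
    by rewrite invr_ge0 ltW.
  have x0 : 0 < x := lt_le_trans ltr01 x1.
  have e1 : x ^+ m / C <= expR x.
    by apply: le_trans (expR_ge1Dxn (Num.truncn (2 * alpha)) (ltW x0)); rewrite -/m -/C lerDr.
  have e2 : u `^ 2 <= x ^+ m.
    have -> : u = x `^ alpha by rewrite /x -powRrM mulVf ?gt_eqF// powRr1// ltW.
    rewrite -powRrM -powR_mulrn ?(ltW x0)// ler_powR// mulrC ltW//.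
    rewrite /m; have := @truncnS_gt _ (2 * alpha); exact.
  rewrite expRN powRN ler_pdivlMr ?powR_gt0// mulrC ler_pdivrMr ?expR_gt0//.
  apply: (le_trans e2); rewrite -ler_pdivrMl// mulrC; exact: e1.
apply: (@le_lt_trans _ _ (\int[mu]_u (\1_(`[0%R, 1%R] : set R) u +
  C * (\1_(`[1%R, +oo[ : set R) u * u `^ (- 2)))%:E)%E).
  apply: le_integral_EFin.
  - exact: measurable_rr.
  - apply: measurable_funD; first exact: measurable_indic.
    apply: measurable_funM => //; apply: measurable_funM => //; exact: measurable_indic.
  - exact: rr_ge0.
  - move=> u; have [u0|u0] := ltP 0 u; last first.
      by rewrite rr_out// addr_ge0// mulr_ge0 ?(ltW C0)// mulr_ge0// powR_ge0.
    have [u1|u1] := leP 1 u.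
      rewrite [X in _ <= _ + _ * (X * _)]indicE mem_set ?mul1r; last by rewrite /= in_itv/= u1.
      by rewrite (le_trans (key _ u1))// lerDr.
    rewrite [X in _ <= X + _]indicE mem_set; last by rewrite /= in_itv/= !ltW.
    by rewrite (le_trans (ltW (rr_lt1 u)))// lerDl mulr_ge0 ?(ltW C0)// mulr_ge0// powR_ge0.
rewrite integralD_ge0_EFin//; last 2 first.
- apply: measurable_funM => //; apply: measurable_funM => //; exact: measurable_indic.
- by move=> u; rewrite mulr_ge0 ?(ltW C0)// mulr_ge0// powR_ge0.
rewrite integral_indic_itv// lte_add_pinfty ?ltry//.
rewrite integralZ_EFin ?(ltW C0)//; last 2 first.
- apply: measurable_funM => //; exact: measurable_indic.
- by move=> u; rewrite mulr_ge0// powR_ge0.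
rewrite lte_mul_pinfty ?lee_fin ?(ltW C0)//.
have -> : (\int[mu]_u (\1_(`[1%R, +oo[ : set R) u * u `^ (- 2))%:E =
  \int[mu]_(u in `[1%R, +oo[) (u `^ (- 2))%:E)%E.
  rewrite [RHS]integral_mkcond; apply: eq_integral => u _; rewrite patchE indicE.
  by case: ifPn => _; rewrite ?mul1r ?mul0r.
have dF (u : R) : 0 < u -> is_derive u 1 (fun u : R => - u `^ (-1)) (u `^ (- 2)).
  move=> u0; have d := is_deriveN (is_derive1_powR (-1) u0).
  refine (is_derive_eq d _); rewrite mulN1r opprK; congr (_ `^ _); ring.
rewrite (@ge0_continuous_FTC2y _ (fun u => u `^ (- 2)) (fun u => - u `^ (-1)) 1 0).
- by rewrite -EFinB ltry.
- by move=> x _; exact: powR_ge0.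
- apply: derivable_within_continuous => u; rewrite in_itv/= andbT => u1.
  by apply: derivable_powR; rewrite in_itv/= andbT (lt_le_trans ltr01).
- rewrite -[X in _ --> X]oppr0; apply: cvgN.
  apply/cvgrPdist_le => e e0.
  apply: filterS2 (nbhs_pinfty_gt (num_real 0)) (nbhs_pinfty_ge (num_real e^-1)) => x x0 xe.
  rewrite sub0r normrN ger0_norm ?powR_ge0// powR_inv1 ?(ltW x0)//.
  by rewrite -[leRHS]invrK lef_pV2 ?posrE ?invr_gt0.
- by move=> x x1; have d := dF x (lt_trans ltr01 x1); exact: ex_derive.
- have d := dF 1 ltr01; apply: cvg_at_right_filter.
  suff c : {for 1, continuous (fun u : R => - u `^ (-1))} by exact: c.
  by apply/differentiable_continuous/derivable1_diffP; exact: ex_derive.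
- move=> x; rewrite in_itv/= andbT => x1; rewrite derive1E.
  by have d := dF x (lt_trans ltr01 x1); rewrite derive_val.
Qed.

Definition ca : R := \int[mu]_u rr u.

Lemma integrable_rr : mu.-integrable setT (EFin \o rr).
Proof.
apply/integrableP; split; first by apply/measurable_EFinP; exact: measurable_rr.
under eq_integral do rewrite /= ger0_norm ?rr_ge0//.
exact: int_rr_lty.
Qed.

Lemma caE : (ca%:E = \int[mu]_u (rr u)%:E)%E.
Proof. by rewrite /ca /Rintegral fineK//; exact: integrable_fin_num integrable_rr. Qed.

Lemma ca_gt0 : 0 < ca.
Proof.
rewrite -lte_fin caE.
apply: (@lt_le_trans _ _ (\int[mu]_u (expR (- 1) * \1_(`]0%R, 1%R] : set R) u)%:E)%E).
  rewrite integralZ_EFin ?expR_ge0//.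
  by rewrite integral_indic_itv// -EFinM lte_fin subr0 mulr1 expR_gt0.
apply: le_integral_EFin.
- apply: measurable_funM => //; exact: measurable_indic.
- exact: measurable_rr.
- by move=> u; rewrite mulr_ge0 ?expR_ge0.
- move=> u; rewrite indicE; have [uI|uI] := boolP (u \in _); last by rewrite mulr0 rr_ge0.
  move: uI; rewrite inE /= in_itv/= mulr1 => /andP[u0 u1].
  rewrite rrE// ler_expR lerN2 -[leRHS](powRr0 u) ger_powR ?u0//.
  by rewrite invr_ge0 ltW.
Qed.

Lemma int_rr_exp n : (0 < n)%N ->
  mu.-integrable setT (fun u => (rr u ^+ n)%:E) /\
  \int[mu]_u (rr u ^+ n) = n%:R `^ (- alpha) * ca.
Proof.
move=> n0; have n1 : 0 < n%:R `^ alpha :> R by rewrite powR_gt0// ltr0n.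
split.
  apply: (le_integrable measurableT _ _ integrable_rr).
    by apply/measurable_EFinP; apply: measurable_funX; exact: measurable_rr.
  move=> u _ /=; rewrite lee_fin !ger0_norm ?exprn_ge0 ?rr_ge0//.
  by rewrite -[leRHS]expr1 ler_wiXn2l// ?rr_ge0// ltW// rr_lt1.
have E := int_rr_scale n1; rewrite -caE in E.
rewrite /Rintegral; under eq_integral do rewrite rr_scale//.
move: E; case: (\int[mu]_u (rr (n%:R `^ alpha * u))%:E)%E => [r| |] //.
- by rewrite -EFinM => -[->]; rewrite powRN mulrA mulVf ?mul1r// gt_eqF.
- by rewrite gt0_muley// lte_fin.
- by rewrite gt0_muleNy// lte_fin.
Qed.

End Subordination.

(** * The fractional integral of a real function *)

Lemma le_1Dpow (R : realType) (x r : R) : 0 <= x -> 1 <= r -> x <= 1 + x `^ r.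
Proof.
move=> x0 r1; have [x1|x1] := leP x 1; first by rewrite (le_trans x1)// lerDl powR_ge0.
rewrite (@le_trans _ _ (x `^ r))// ?lerDr// -[leLHS]powRr1//.
by rewrite ler_powR// ltW.
Qed.

Lemma le_1Dpowe (R : realType) (x : \bar R) (r : R) : (0 <= x)%E -> 1 <= r ->
  (x <= 1 + x `^ r)%E.
Proof.
case: x => [x| |] //; first by rewrite lee_fin => x0 r1; rewrite poweR_EFin -EFinD lee_fin le_1Dpow.
by move=> _ r1; rewrite poweRyr ?addey ?leey// gt_eqF// (lt_le_trans ltr01).
Qed.

(** Integrability is assumed only after multiplication by [c]. On the fibres below, [c] is a value
    of the test function times the weight and may vanish. *)
Lemma Rintegral_scaler d (T : measurableType d) (R : realType)
    (m : {measure set T -> \bar R}) (F : T -> R) (c : R) :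
  m.-integrable setT (fun u => (F u * c)%:E) ->
  \int[m]_u (F u * c) = (\int[m]_u F u) * c.
Proof.
have [->|c0] := eqVneq c 0.
  by move=> _; rewrite mulr0; under eq_Rintegral do rewrite mulr0; rewrite Rintegral_cst// mul0r.
move=> i; rewrite RintegralZr//.
have := integrableZr measurableT c^-1 i; apply: eq_integrable => // u _ /=.
by rewrite -EFinM mulfK.
Qed.

Lemma powR_add_le (R : realType) (a b r : R) : 0 <= a -> 0 <= b -> 0 <= r ->
  (a + b) `^ r <= 2 `^ r * (a `^ r + b `^ r).
Proof.
move=> a0 b0 r0.
have key c : 0 <= c -> a <= c -> b <= c -> (a + b) `^ r <= 2 `^ r * c `^ r.
  move=> c0 ac bc; rewrite -powRM//; apply: ge0_ler_powR; rewrite ?nnegrE ?addr_ge0 ?mulr_ge0//.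
  lra.
have [ab|/ltW ab] := leP a b.
- by rewrite (le_trans (key b _ _ _))// ler_wpM2l ?powR_ge0// lerDr powR_ge0.
- by rewrite (le_trans (key a _ _ _))// ler_wpM2l ?powR_ge0// lerDl powR_ge0.
Qed.

Section FracInt.
Variables (R : realType) (k alpha p q : R).
Hypothesis k_gt0 : 0 < k.
Hypothesis alpha_gt0 : 0 < alpha.
Hypothesis p_gt1 : 1 < p.
Hypothesis pD : p < (2 * k + 1) / alpha.
Hypothesis pqD : q^-1 = p^-1 - alpha / (2 * k + 1).
Local Notation mu := (@lebesgue_measure R).
Local Notation hn := (hn k).
Local Notation wgt := (wgt k).
Local Notation intW := (intW k).
Local Notation IW := (IW k).
Local Notation Pk := (Pk k).
Local Notation rr := (rr alpha).
Local Notation ca := (ca alpha).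
Local Notation N1 := (N1 k).
Local Notation D := ((2 * k + 1) / alpha).

Let d_gt0 : 0 < 2 * k + 1. Proof. by rewrite addr_gt0// mulr_gt0. Qed.

Lemma IW_EFin h : intW h -> ((IW h)%:E = \int[mu]_x (h x * wgt x)%:E)%E.
Proof. by move=> hh; rewrite /IW /Rintegral fineK//; exact: integrable_fin_num hh. Qed.

(** The absolute value gives nonnegativity at every point, as the abstract inequality demands; for
    the kernel itself it is known almost everywhere only. *)
Definition Qk (u x y : R) : R := `|Pk (rr u) x y| * \1_(`]0%R, 1%R] : set R) u.
Definition QB : R := Zc k * 2 `^ (2 * k + 1).

Lemma QkE u x y : 0 < u <= 1 -> Qk u x y = `|Pk (rr u) x y|.
Proof. by move=> u01; rewrite /Qk indicE mem_set ?mulr1//= in_itv. Qed.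

Lemma Qk_out u x y : ~~ (0 < u <= 1) -> Qk u x y = 0.
Proof. by move=> u01; rewrite /Qk indicE memNset ?mulr0//= in_itv; apply/negP. Qed.

Lemma Qk_ge0 u x y : 0 <= Qk u x y. Proof. by rewrite mulr_ge0. Qed.

Lemma QB_ge0 : 0 <= QB. Proof. by rewrite mulr_ge0 ?powR_ge0// ltW// Zc_gt0. Qed.

Lemma measurable_Qk : measurable_fun setT (fun z : (R * R) * R => Qk z.1.1 z.1.2 z.2).
Proof.
have m11 : measurable_fun setT (fun z : (R * R) * R => z.1.1).
  by apply: (measurableT_comp measurable_fst).
have m12 : measurable_fun setT (fun z : (R * R) * R => z.1.2).
  by apply: (measurableT_comp measurable_snd).
apply: measurable_funM.
  apply: measurableT_comp => //; apply: measurable_Pk => //.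
  - by move=> t; exact: rr_01.
  - exact: (measurableT_comp (measurable_rr alpha)).
by apply: (measurableT_comp _ m11); exact: measurable_indic.
Qed.

(** The factor [2^(2k+1)] in [QB] comes from [1 - rr u >= u^(1/alpha) / 2]. *)
Lemma Qk_le u x y : 0 < u <= 1 -> Qk u x y <= QB * u `^ (- D).
Proof.
move=> u01; have /andP[u0 u1] := u01; rewrite QkE//.
apply: (le_trans (Pk_le k_gt0 x y (rr_01 alpha u))).
rewrite /Br /QB -mulrA ler_wpM2l ?(ltW (Zc_gt0 k_gt0))//.
have a0 : 0 < u `^ alpha^-1 by rewrite powR_gt0.
have -> : 2 `^ (2 * k + 1) * u `^ (- D) = (u `^ alpha^-1 / 2) `^ (- (2 * k + 1)).
  rewrite powRM ?invr_ge0 ?(ltW a0)// powRV// opprK mulrC; congr (_ * _).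
  by rewrite -powRrM mulrN mulrC.
rewrite !powRN lef_pV2 ?posrE ?powR_gt0 ?divr_gt0 ?subr_gt0 ?rr_lt1//.
apply: ge0_ler_powR; rewrite ?nnegrE ?(ltW d_gt0)//.
- by rewrite divr_ge0// ltW.
- by rewrite subr_ge0 ltW// rr_lt1.
- exact: rr_half.
Qed.

Lemma Qk_int2 u x : (\int[mu]_y (Qk u x y * wgt y)%:E <= 1)%E.
Proof.
have [u01|u01] := boolP (0 < u <= 1); last first.
  rewrite (eq_integral (fun=> 0%E)) ?integral0//.
  by move=> y _; rewrite Qk_out// mul0r.
have r01 : 0 < rr u < 1.
  by move/andP : u01 => [u0 _]; rewrite rr_gt0//= rr_lt1.
under eq_integral do rewrite QkE//.
rewrite -IW_EFin; last by apply: intW_norm; apply: intW_Pk => //; exact: rr_01.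
by have := Pk_L1 k_gt0 x r01; rewrite /N1 => ->.
Qed.

Lemma Qk_int1 u y : (\int[mu]_x (Qk u x y * wgt x)%:E <= 1)%E.
Proof.
by under eq_integral do rewrite /Qk Pk_sym; exact: Qk_int2.
Qed.

Let D_gt0 : 0 < D. Proof. by rewrite divr_gt0. Qed.
Let pqD' : q^-1 = p^-1 - D^-1. Proof. by rewrite pqD invf_div. Qed.
Let p_gt0 : 0 < p. Proof. exact: lt_trans p_gt1. Qed.
Let q_gt0 : 0 < q. Proof. by rewrite -invr_gt0 pqD' subr_gt0 ltf_pV2 ?posrE. Qed.
Let q_gt1 : 1 < q.
Proof.
rewrite (lt_trans p_gt1)// -[ltLHS]invrK -[ltRHS]invrK ltf_pV2 ?posrE ?invr_gt0//.
by rewrite pqD' ltrBlDr ltrDl invr_gt0.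
Qed.

Section Fixed.
Variable f : R -> R.
Hypothesis mf : measurable_fun setT f.
Hypothesis hf : intW f.
Hypothesis f_le1 : (\int[mu]_y (`|f y| `^ p * wgt y)%:E <= 1)%E.

Let F : R -> R := fun y => `|f y|.
Let mF : measurable_fun setT F. Proof. exact: measurableT_comp mf. Qed.
Let F_ge0 y : 0 <= F y. Proof. exact: normr_ge0. Qed.

Local Notation Pop := (Pop wgt Qk F).
Local Notation Top := (Top wgt Qk F).

Definition HC : R := 3 * hls_C QB D p q.

Lemma Top_int : (\int[mu]_x (Top x `^ q * (wgt x)%:E) <= HC%:E)%E.
Proof.
apply: hls_final => //.
- exact: measurable_wgt.
- exact: wgt_ge0.
- exact: measurable_Qk.
- exact: Qk_ge0.
- exact: Qk_out.
- exact: QB_ge0.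
- exact: Qk_le.
- exact: Qk_int2.
- exact: Qk_int1.
Qed.

(** [P_(r(u)) f] without its mean. Level 0 carries no power of [r(u)], so it would not be integrable
    over [u > 0]; it is also the level that [I^alpha] kills. *)
Definition Nf (u x : R) : R := IW (fun y => Pk (rr u) x y * f y) - Znf k f 0 x.
Definition Nterm (u x : R) (n : nat) : R := (n != 0%N)%:R * (rr u ^+ n * Znf k f n x).

Lemma Nf_cvg u x : (fun N => \sum_(n < N) Nterm u x n) @ \oo --> Nf u x.
Proof.
have [_ c] := Pk_int k_gt0 x (rr_01 alpha u) hf.
rewrite -cvg_shiftS; rewrite -cvg_shiftS in c.
have -> : [sequence \sum_(n < N.+1) Nterm u x n]_N =
   (fun N => \sum_(n < N.+1) rr u ^+ n * Znf k f n x - Znf k f 0 x).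
  apply/funext => N; rewrite /= !big_ord_recl /Nterm /= expr0 mul0r add0r mul1r addrAC subrr add0r.
  by apply: eq_bigr => i _; rewrite mul1r.
by apply: cvgB; [exact: c|exact: cvg_cst].
Qed.

Lemma Nterm_le u x n : `|Nterm u x n| <= rr u ^+ n * (hn n)^-1 * N1 f.
Proof.
have e0 := exprn_ge0 n (rr_ge0 alpha u).
rewrite normrM -[leRHS]mul1r ler_pM//; first by case: (n != 0%N); rewrite ?normr1 ?normr0.
by rewrite normrM (ger0_norm e0) -mulrA ler_wpM2l//; exact: Znf_le.
Qed.

Lemma Nsum_le u x N : `|\sum_(n < N) Nterm u x n| <= Br k (rr u) * N1 f.
Proof.
by have [_ /(_ N)] := dom_series k_gt0 (rr_01 alpha u) (N1_ge0 k f) (Nterm_le u x).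
Qed.

Lemma measurable_Znf n : measurable_fun setT (Znf k f n).
Proof.
apply: measurable_funM => //; apply: measurable_funD.
  by apply: measurable_funM => //; exact: measurable_gE.
apply: measurable_funM => //; apply: measurable_funM => //; exact: measurable_gO.
Qed.

Lemma measurable_Nsum N : measurable_fun setT
  (fun z : R * R => \sum_(n < N) Nterm z.1 z.2 n).
Proof.
apply: measurable_sum => n; apply: measurable_funM => //; apply: measurable_funM.
  by apply: measurable_funX; exact: (measurableT_comp (measurable_rr alpha)).
exact: (measurableT_comp (measurable_Znf n)).
Qed.

Lemma measurable_Nf : measurable_fun setT (fun z : R * R => Nf z.1 z.2).
Proof. by apply: (measurable_fun_cvg measurable_Nsum) => z _; exact: Nf_cvg. Qed.

Lemma measurable_Nfx u : measurable_fun setT (Nf u).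
Proof.
apply: (measurableT_comp measurable_Nf (_ : measurable_fun setT (fun x : R => (u, x)))).
exact: pair1_measurable.
Qed.

Lemma measurable_Nfu x : measurable_fun setT (Nf ^~ x).
Proof.
apply: (measurableT_comp measurable_Nf (_ : measurable_fun setT (fun u : R => (u, x)))).
exact: pair2_measurable.
Qed.

(** The first summand controls the mean for [u <= 1], the second is the majorant at [r = exp(-1)]
    for [u > 1]. *)
Definition Mc : R := (hn 0)^-1 + expR 1 * Br k (expR (- 1)).
Definition wu (u : R) : R := \1_(`]0%R, 1%R] : set R) u + rr u.

Lemma wu_ge0 u : 0 <= wu u. Proof. by rewrite addr_ge0 ?rr_ge0. Qed.

Lemma Br_ge0 r : 0 <= Br k r.
Proof. by rewrite mulr_ge0 ?powR_ge0// ltW// Zc_gt0. Qed.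

Lemma Mc_ge0 : 0 <= Mc.
Proof.
by rewrite addr_ge0 ?invr_ge0 ?(ltW (hn_gt0 k_gt0 0))// mulr_ge0 ?expR_ge0 ?Br_ge0.
Qed.

(** For [0 < u <= 1] this is the kernel plus the mean. For other [u], [rr u <= exp(-1)] and only
    levels [n >= 1] occur, so one factor [rr u] can be split off and the rest compared with the
    series at [r = exp(-1)]. *)
Lemma Nf_le u x : (`|Nf u x|%:E <= Pop u x + (Mc * N1 f * wu u)%:E)%E.
Proof.
have P0 : (0 <= Pop u x)%E by apply: Pop_ge0 => //; [exact: wgt_ge0|exact: Qk_ge0].
have n0 := N1_ge0 k f.
have [u01|u01] := boolP (0 < u <= 1).
  have [iP _] := Pk_int k_gt0 x (rr_01 alpha u) hf.
  have -> : Pop u x = (N1 (fun y => Pk (rr u) x y * f y))%:E.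
    rewrite /Pop IW_EFin; last exact: intW_norm.
    by apply: eq_integral => y _; rewrite QkE// -normrM.
  rewrite -EFinD lee_fin; apply: le_trans (ler_normB _ _) _.
  apply: lerD; first exact: IW_norm_le.
  apply: le_trans (Znf_le k_gt0 0 x hf) _.
  rewrite mulrAC; apply: ler_wpM2r => //.
  rewrite /wu indicE mem_set//=.
  rewrite -[leLHS]mulr1; apply: ler_pM => //.
  - by rewrite invr_ge0 ltW// hn_gt0.
  - by rewrite lerDl mulr_ge0 ?expR_ge0 ?Br_ge0.
  - by rewrite lerDl rr_ge0.
have re : rr u <= expR (- 1).
  have [u0|u0] := ltP 0 u; last by rewrite rr_out ?expR_ge0.
  rewrite u0/= -ltNge in u01.
  rewrite rrE// ler_expR lerN2 -[leLHS](powRr0 u) ler_powR ?(ltW u01)//.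
  by rewrite invr_ge0 ltW.
have e01 : 0 <= expR (- (1 : R)) < 1 by rewrite expR_ge0/= -expR0 ltr_expR oppr_lt0.
have r0 := rr_ge0 alpha u.
have C0 : 0 <= expR 1 * rr u * N1 f by rewrite !mulr_ge0 ?expR_ge0.
have := @dom_series _ _ k_gt0 _ (Nterm u x) _ e01 C0.
case=> [n|_ _].
  case: n => [|n].
    by rewrite /Nterm mul0r normr0 !mulr_ge0 ?exprn_ge0 ?expR_ge0 ?invr_ge0// ltW// hn_gt0.
  apply: le_trans (Nterm_le _ _ _) _.
  have -> : expR (- 1) ^+ n.+1 * (hn n.+1)^-1 * (expR 1 * rr u * N1 f) =
    (expR (- 1) ^+ n.+1 * (expR 1 * rr u)) * (hn n.+1)^-1 * N1 f by ring.
  apply: ler_wpM2r => //; apply: ler_wpM2r.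
    by rewrite invr_ge0 ltW// hn_gt0.
  rewrite !exprS mulrC.
  have -> : expR (- 1) * expR (- 1) ^+ n * (expR 1 * rr u) =
    (expR (- 1) * expR 1) * (expR (- 1) ^+ n * rr u) by ring.
  rewrite -expRD addNr expR0 mul1r ler_wpM2r//.
  by rewrite lerXn2r ?nnegrE ?expR_ge0.
rewrite (cvg_lim _ (@Nf_cvg u x))// => h.
rewrite -[leLHS]add0e leeD// lee_fin (le_trans h)//.
have -> : Br k (expR (- 1)) * (expR 1 * rr u * N1 f) =
  expR 1 * Br k (expR (- 1)) * N1 f * rr u by ring.
have A0 : 0 <= expR 1 * Br k (expR (- 1)) * N1 f.
  by apply: mulr_ge0 => //; apply: mulr_ge0; [exact: expR_ge0|exact: Br_ge0].
apply: ler_pM => //.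
- by apply: ler_wpM2r => //; rewrite lerDr invr_ge0 ltW// hn_gt0.
- by rewrite lerDr.
Qed.

Lemma measurable_wu : measurable_fun setT wu.
Proof. by apply: measurable_funD; [exact: measurable_indic|exact: measurable_rr]. Qed.

Lemma int_wu : (\int[mu]_u (wu u)%:E = (1 + ca)%:E)%E.
Proof.
rewrite integralD_ge0_EFin//; first by rewrite integral_indic_itv// subr0 -caE.
- exact: measurable_rr.
- exact: rr_ge0.
Qed.

Definition Kf : R := Mc * N1 f * (1 + ca).

Lemma Kf_ge0 : 0 <= Kf.
Proof. by rewrite !mulr_ge0 ?Mc_ge0 ?N1_ge0// addr_ge0// ltW// ca_gt0. Qed.

Let mPopu x : measurable_fun setT (fun u => Pop u x).
Proof.
by apply: measurable_Pop_u => //; [exact: measurable_wgt|exact: wgt_ge0|exact: measurable_Qk|exact: Qk_ge0].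
Qed.

Lemma Nf_int_le x : (\int[mu]_u `|Nf u x|%:E <= Top x + Kf%:E)%E.
Proof.
have n0 := N1_ge0 k f.
have mw : measurable_fun setT (fun u => (Mc * N1 f * wu u)%:E).
  by apply/measurable_EFinP; apply: measurable_funM; [exact: measurable_cst|exact: measurable_wu].
have P0 u : (0 <= Pop u x)%E by apply: Pop_ge0 => //; [exact: wgt_ge0|exact: Qk_ge0].
apply: (@le_trans _ _ (\int[mu]_u (Pop u x + (Mc * N1 f * wu u)%:E))%E).
  apply: ge0_le_integral; first exact: measurableT.
  - by move=> u _; rewrite lee_fin.
  - by apply/measurable_EFinP; apply: measurableT_comp => //; exact: measurable_Nfu.
  - by apply: emeasurable_funD; [exact: mPopu|exact: mw].
  - by move=> u _; exact: Nf_le.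
rewrite ge0_integralD//; [|exact: mPopu|]; last first.
  by move=> u _; rewrite lee_fin !mulr_ge0 ?Mc_ge0 ?wu_ge0.
rewrite integralZ_EFin ?mulr_ge0 ?Mc_ge0//; last 2 first.
- exact: measurable_wu.
- exact: wu_ge0.
by rewrite int_wu.
Qed.

(** The candidate for [I^alpha f]: division by [ca] normalises the integral of [rr^n] to
    [n^(-alpha)]. *)
Definition Gf (x : R) : R := ca^-1 * \int[mu]_u Nf u x.

Lemma Gf_le x : ((`|Gf x|)%:E <= ca^-1%:E * (Top x + Kf%:E))%E.
Proof.
have c0 : 0 <= ca^-1 by rewrite invr_ge0 ltW// ca_gt0.
rewrite normrM (ger0_norm c0) EFinM lee_wpmul2l ?lee_fin//.
apply: le_trans (Nf_int_le x).
have := @le_abse_integral _ _ _ mu setT (fun u => (Nf u x)%:E) measurableT.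
have mN : measurable_fun setT (fun u => (Nf u x)%:E).
  by apply/measurable_EFinP; exact: measurable_Nfu.
move=> /(_ mN); apply: le_trans; rewrite /Rintegral.
by case: (\int[mu]_u (Nf u x)%:E)%E => //= *; rewrite normr0 leey.
Qed.

Lemma measurable_Gf : measurable_fun setT Gf.
Proof.
apply: measurable_funM => //.
have mN : measurable_fun setT (fun z : R * R => (Nf z.1 z.2)%:E).
  by apply/measurable_EFinP; exact: measurable_Nf.
rewrite /Rintegral; apply: (measurableT_comp (fine_measurable measurableT)).
under eq_fun do rewrite integralE.
apply: emeasurable_funB.
- have m1 := @measurable_fun_fubini_tonelli_G _ _ _ _ _ mu _ (measurable_funepos mN) (fun z => funepos_ge0 _ z).
  rewrite (_ : (fun x => _) = fubini_G mu ((fun z : R * R => (Nf z.1 z.2)%:E)^\+)%E); first exact: m1.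
  by apply/funext => x; apply: eq_integral => u _; rewrite !funeposE.
- have m1 := @measurable_fun_fubini_tonelli_G _ _ _ _ _ mu _ (measurable_funeneg mN) (fun z => funeneg_ge0 _ z).
  rewrite (_ : (fun x => _) = fubini_G mu ((fun z : R * R => (Nf z.1 z.2)%:E)^\-)%E); first exact: m1.
  by apply/funext => x; apply: eq_integral => u _; rewrite !funenegE.
Qed.

Let mTop : measurable_fun setT Top.
Proof.
apply: (@measurable_fun_fubini_tonelli_G _ _ _ _ _ mu (fun z => Pop z.1 z.2)).
  by apply: measurable_Pop2 => //; [exact: measurable_wgt|exact: wgt_ge0|exact: measurable_Qk|exact: Qk_ge0].
by move=> z; apply: Pop_ge0 => //; [exact: wgt_ge0|exact: Qk_ge0].
Qed.

Let Top_ge0' x : (0 <= Top x)%E.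
Proof. by apply: Top_ge0 => //; [exact: wgt_ge0|exact: Qk_ge0]. Qed.

Let mW : measurable_fun setT (fun x => (wgt x)%:E).
Proof. by apply/measurable_EFinP; exact: measurable_wgt. Qed.

Let W0 x : (0 <= (wgt x)%:E)%E. Proof. by rewrite lee_fin wgt_ge0. Qed.

Let mTopq : measurable_fun setT (fun x => Top x `^ q * (wgt x)%:E)%E.
Proof.
apply: emeasurable_funM; last exact: mW.
exact: (measurableT_comp (measurable_poweR _) mTop).
Qed.

Let mTopK c : measurable_fun setT (fun x => (Top x + c%:E) * (wgt x)%:E)%E.
Proof.
apply: emeasurable_funM; last exact: mW.
by apply: emeasurable_funD; [exact: mTop|exact: measurable_cst].
Qed.

Lemma intW_cst (c : R) : intW (fun=> c).
Proof. by apply: (@bounded_intW _ _ k_gt0 _ `|c|) => //; exact: measurable_cst. Qed.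

Lemma cO0 h : cO k 0 h = 0.
Proof.
rewrite /cO (eq_IW k (g := fun=> 0 * 0)); last by move=> x; rewrite gO0 !mul0r.
by rewrite IWZ ?mul0r//; exact: intW_cst.
Qed.

Lemma int_cstW (c : R) : (\int[mu]_x (c * wgt x)%:E = (c * IW (fun=> 1))%:E)%E.
Proof. by rewrite -IWZ ?IW_EFin; [under [in RHS]eq_integral do rewrite mulr1|exact: intW_cst|exact: intW_cst]. Qed.

(** [Top <= 1 + Top^q] and the weight has finite mass; this supplies the absolute convergence behind
    Fubini. *)
Lemma TopK_lty (c : R) : 0 <= c -> (\int[mu]_x ((Top x + c%:E) * (wgt x)%:E) < +oo)%E.
Proof.
move=> c0; have c1 : 0 <= 1 + c by rewrite addr_ge0.
have mc : measurable_fun setT (fun x => ((1 + c) * wgt x)%:E).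
  by apply/measurable_EFinP; exact: measurable_Mwgt.
apply: (@le_lt_trans _ _ (\int[mu]_x (((1 + c) * wgt x)%:E + Top x `^ q * (wgt x)%:E))%E).
  apply: ge0_le_integral; first exact: measurableT.
  - by move=> x _; rewrite mule_ge0// adde_ge0.
  - exact: mTopK.
  - by apply: emeasurable_funD; [exact: mc|exact: mTopq].
  - move=> x _; rewrite (EFinM (1 + c) (wgt x)) -ge0_muleDl ?lee_fin ?poweR_ge0// lee_wpmul2r//.
    have -> : ((1 + c)%:E + Top x `^ q = (1 + Top x `^ q) + c%:E)%E.
      by rewrite EFinD addeAC.
    by apply: leeD => //; apply: le_1Dpowe => //; exact: ltW.
rewrite ge0_integralD//; last 2 first.
- by move=> x _; rewrite lee_fin mulr_ge0 ?wgt_ge0.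
- by move=> x _; rewrite mule_ge0 ?poweR_ge0.
by rewrite int_cstW lte_add_pinfty ?ltry// (le_lt_trans Top_int)// ltry.
Qed.

Lemma measurable_NfW : measurable_fun setT (fun z : R * R => (`|Nf z.1 z.2| * wgt z.2)%:E).
Proof.
apply/measurable_EFinP; apply: measurable_funM.
  by apply: measurableT_comp => //; exact: measurable_Nf.
by apply: measurableT_comp; [exact: measurable_wgt|exact: measurable_snd].
Qed.

Lemma Nf_int2 : (\int[mu]_x \int[mu]_u (`|Nf u x| * wgt x)%:E < +oo)%E.
Proof.
apply: le_lt_trans (TopK_lty Kf_ge0).
have mN := measurable_NfW.
apply: ge0_le_integral; first exact: measurableT.
- by move=> x _; apply: integral_ge0 => u _; rewrite lee_fin mulr_ge0 ?wgt_ge0.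
- by apply: (@measurable_fun_fubini_tonelli_G _ _ _ _ _ mu _ mN) => z; rewrite lee_fin mulr_ge0 ?wgt_ge0.
- exact: mTopK.
- move=> x _; under eq_integral do rewrite mulrC.
  rewrite integralZ_EFin ?wgt_ge0//; last first.
    by apply: measurableT_comp => //; exact: measurable_Nfu.
  by rewrite muleC lee_wpmul2r//; exact: Nf_int_le.
Qed.

Lemma intW_Gf : intW Gf.
Proof.
have c0 : 0 <= ca^-1 by rewrite invr_ge0 ltW// ca_gt0.
apply/integrableP; split.
  apply/measurable_EFinP; exact: measurable_Mwgt measurable_Gf.
apply: (@le_lt_trans _ _ (\int[mu]_x (ca^-1%:E * ((Top x + Kf%:E) * (wgt x)%:E)))%E).
  apply: ge0_le_integral; first exact: measurableT.
  - by move=> x _; rewrite lee_fin.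
  - apply/measurable_EFinP; apply: measurableT_comp => //.
    exact: measurable_Mwgt measurable_Gf.
  - by apply: emeasurable_funM; [exact: measurable_cst|exact: mTopK].
  - move=> x _; rewrite /= normrM (ger0_norm (wgt_ge0 k x)) EFinM muleA lee_wpmul2r//.
    exact: Gf_le.
rewrite ge0_integralZl//; last 2 first.
- exact: mTopK.
- by move=> x _; rewrite mule_ge0// adde_ge0// lee_fin Kf_ge0.
by rewrite lte_mul_pinfty ?lee_fin//; exact: (TopK_lty Kf_ge0).
Qed.

(** * The candidate tested against bounded functions *)

Section Test.
Variables (v : R -> R) (M : R).
Hypothesis mv : measurable_fun setT v.
Hypothesis vM : forall x, `|v x| <= M.

Lemma Nf_prod_integrable : (mu \x mu)%E.-integrable setT
  (fun z : R * R => (Nf z.1 z.2 * (v z.2 * wgt z.2))%:E).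
Proof.
have mN : measurable_fun setT (fun z : R * R => (Nf z.1 z.2 * (v z.2 * wgt z.2))%:E).
  apply/measurable_EFinP; apply: measurable_funM; first exact: measurable_Nf.
  apply: measurable_funM.
    by apply: measurableT_comp; [exact: mv|exact: measurable_snd].
  by apply: measurableT_comp; [exact: measurable_wgt|exact: measurable_snd].
have mN' := measurable_NfW.
have M0 : 0 <= M := le_trans (normr_ge0 (v 0)) (vM 0).
apply/(integrable21ltyP mu mu mN).
apply: (@le_lt_trans _ _ (\int[mu]_x (M%:E * \int[mu]_u (`|Nf u x| * wgt x)%:E))%E); last first.
  rewrite ge0_integralZl//; last 2 first.
  - by apply: (@measurable_fun_fubini_tonelli_G _ _ _ _ _ mu _ mN') => z; rewrite lee_fin mulr_ge0 ?wgt_ge0.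
  - by move=> x _; apply: integral_ge0 => u _; rewrite lee_fin mulr_ge0 ?wgt_ge0.
  by rewrite lte_mul_pinfty ?lee_fin//; exact: Nf_int2.
have mNx x : measurable_fun setT (fun u => `|Nf u x| * wgt x).
  by apply: measurable_funM => //; apply: measurableT_comp => //; exact: measurable_Nfu.
apply: ge0_le_integral; first exact: measurableT.
- by move=> x _; apply: integral_ge0.
- have mN2 := measurableT_comp (@abse_measurable R _) mN.
  by apply: (@measurable_fun_fubini_tonelli_G _ _ _ _ _ mu _ mN2) => z; exact: abse_ge0.
- apply: emeasurable_funM; first exact: measurable_cst.
  by apply: (@measurable_fun_fubini_tonelli_G _ _ _ _ _ mu _ mN') => z; rewrite lee_fin mulr_ge0 ?wgt_ge0.
- move=> x _; rewrite -integralZ_EFin//; last 2 first.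
  + exact: mNx.
  + by move=> u; rewrite mulr_ge0 ?wgt_ge0.
  apply: le_integral_EFin.
  + have mN1 : measurable_fun setT (fun u => Nf u x * (v x * wgt x)).
      by apply: measurable_funM => //; exact: measurable_Nfu.
    have mN3 : measurable_fun setT (fun u => `|Nf u x * (v x * wgt x)|).
      exact: measurableT_comp.
    exact: mN3.
  + by apply: measurable_funM; [exact: measurable_cst|exact: mNx].
  + by move=> u.
  + move=> u /=; rewrite normrM (normrM (v x)) (ger0_norm (wgt_ge0 k x)) mulrCA; apply: ler_wpM2r => //.
    by rewrite mulr_ge0 ?wgt_ge0.
Qed.

Lemma Nf_bound u x : `|Nf u x| <= Br k (rr u) * N1 f.
Proof.
have [_ _] := dom_series k_gt0 (rr_01 alpha u) (N1_ge0 k f) (Nterm_le u x).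
by rewrite (cvg_lim _ (@Nf_cvg u x)).
Qed.

Lemma intW_vNf u : intW (fun x => v x * Nf u x).
Proof.
apply: (intWM mv vM); apply: (@bounded_intW _ _ k_gt0 _ (Br k (rr u) * N1 f)).
  exact: measurable_Nfx.
by move=> x; exact: Nf_bound.
Qed.

(** Fubini for [Nf u x * v x * W x]. The inner integral over [u] is known to exist for almost every
    [x], hence the comparison of integrands almost everywhere. *)
Lemma IW_Gf : IW (fun x => v x * Gf x) = ca^-1 * \int[mu]_u IW (fun x => v x * Nf u x).
Proof.
have c0 : ca != 0 by rewrite gt_eqF// ca_gt0.
have iG := intWM mv vM intW_Gf.
apply: (mulfI c0); rewrite mulrA divff// mul1r -IWZ//.
have iN := Nf_prod_integrable.
transitivity (fine (\int[mu]_x \int[mu]_u (Nf u x * (v x * wgt x))%:E)%E).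
  rewrite /IW /Rintegral; congr fine; apply: ae_eq_integral.
  - exact: measurableT.
  - exact: measurable_int (intWZ ca iG).
  - exact: (measurable_fubini_G iN).
  - have FF : Filter (nbhs (almost_everywhere mu)) by exact: ae_filter_ringOfSetsType.
    apply: filterS (ae_integrable2 iN) => x /= ix _.
    have := Rintegral_scaler ix; rewrite /Rintegral => Ex.
    rewrite -[RHS]fineK; last exact: integrable_fin_num ix.
    congr EFin; rewrite Ex /Gf.
    have -> : ca * (v x * (ca^-1 * \int[mu]_u Nf u x)) * wgt x =
      (ca * ca^-1) * ((\int[mu]_u Nf u x) * (v x * wgt x)) by ring.
    by rewrite (divff c0) mul1r.
rewrite -(Fubini iN) /Rintegral; congr fine; apply: eq_integral => u _.
rewrite IW_EFin; last exact: intW_vNf.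
by apply: eq_integral => x _; congr EFin; ring.
Qed.
End Test.

Section Expand.
Variables (N : nat) (a b : nat -> R).
Let P := \sum_(n < N) (a n)%:P * geg k n.
Let P' := \sum_(n < N) (b n)%:P * (geg k n)^`().
Let ab n := a n * cE k n f + b n * cO k n f.

Lemma IW_tp_Znf n : IW (fun x => tp P P' x * Znf k f n x) = if (n < N)%N then ab n else 0.
Proof.
have iE := intW_gE n (intW_tp k_gt0 P P').
have iO := intW_gO n (intW_tp k_gt0 P P').
have -> : IW (fun x => tp P P' x * Znf k f n x) =
  IW (fun x => ((hn n)^-1 * cE k n f) * (gE k n x * tp P P' x) +
    ((hn n)^-1 * (glam k n)^-1 * cO k n f) * (gO k n x * tp P P' x)).
  by apply: eq_IW => x; rewrite /Znf; ring.
rewrite IWD; [|exact: intWZ|exact: intWZ].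
rewrite IWZ// IWZ// -/(cE k n (tp P P')) -/(cO k n (tp P P')) (cE_sum k_gt0) (cO_sum k_gt0).
case: ifPn => nN; last by rewrite !mulr0 addr0.
have h0 : hn n != 0 by rewrite gt_eqF// hn_gt0.
rewrite /ab; case: n h0 {nN iE iO} => [|n] h0.
  by rewrite cO0 !mulr0 mul0r !addr0; field.
have l0 : glam k n.+1 != 0 by rewrite gt_eqF// glam_gt0.
by field; rewrite h0 l0.
Qed.

Lemma IW_tp_Nf u : IW (fun x => tp P P' x * Nf u x) =
  \sum_(n < N) (n != 0%N :> nat)%:R * (rr u ^+ n * ab n).
Proof.
have [M hM] := bounded_tp P P'.
have iv := intW_tp k_gt0 P P'; have mv := @measurable_tp R P P'.
have mNs K : measurable_fun setT (fun x => \sum_(n < K) Nterm u x n).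
  apply: (measurableT_comp (measurable_Nsum K) (_ : measurable_fun setT (fun x : R => (u, x)))).
  exact: pair1_measurable.
have [] := @dominated_Rcvg _ _ _ mu
  (fun K x => tp P P' x * (\sum_(n < K) Nterm u x n) * wgt x)
  (fun x => tp P P' x * Nf u x * wgt x) (fun x => `|tp P P' x * wgt x| * (Br k (rr u) * N1 f)).
- move=> K; apply: measurable_Mwgt.
  by apply: measurable_funM; [exact: mv|exact: mNs].
- apply: measurable_Mwgt.
  by apply: measurable_funM; [exact: mv|exact: measurable_Nfx].
- apply: aeW => x; apply: cvgM; last exact: cvg_cst.
  by apply: cvgM; [exact: cvg_cst|exact: Nf_cvg].
- have := integrableZr measurableT (Br k (rr u) * N1 f) (integrable_abse iv).
  by apply: eq_integrable.
- by move=> K x; rewrite mulrAC normrM ler_wpM2l//; exact: Nsum_le.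
move=> _ c; rewrite -/(IW _) in c *; rewrite -(cvg_lim _ c)//; apply: cvg_lim => //.
pose Fn n := (n != 0%N :> nat)%:R * (rr u ^+ n * ab n).
apply/cvgrPdist_lt => e e0; near=> K.
have NK : (N <= K)%N by near: K; exact: nbhs_infty_ge.
have hZ n : intW (fun x => tp P P' x * Znf k f n x).
  apply: (intWM mv hM); apply: (@bounded_intW _ _ k_gt0 _ ((hn n)^-1 * N1 f)).
    exact: measurable_Znf.
  by move=> x; exact: Znf_le.
suff -> : \int[mu]_x (tp P P' x * (\sum_(n < K) Nterm u x n) * wgt x) = \sum_(n < N) Fn n.
  by rewrite subrr normr0.
have hZ' n : intW (fun x => ((n != 0%N :> nat)%:R * rr u ^+ n) * (tp P P' x * Znf k f n x)).
  exact: intWZ.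
transitivity (IW (fun x => \sum_(n < K) ((n != 0%N :> nat)%:R * rr u ^+ n) * (tp P P' x * Znf k f n x))).
  apply: eq_IW => x; rewrite mulr_sumr; apply: eq_bigr => n _; rewrite /Nterm; ring.
have [_ ->] := IW_sum k_gt0 (fun n : 'I_K => hZ' n).
rewrite (big_ord_widen K Fn NK) [RHS]big_mkcond; apply: eq_bigr => n _.
rewrite IWZ// IW_tp_Znf /Fn; case: ifPn; rewrite ?mulr0// => _.
by rewrite mulrA.
Unshelve. all: by end_near. Qed.

(** Integrating [rr^n] over [u] produces [n^(-alpha) ca], so [Gf] has exactly the coefficients
    prescribed for [I^alpha f]. *)
Lemma IW_tp_Gf : IW (fun x => tp P P' x * Gf x) =
  \sum_(n < N) (n != 0%N :> nat)%:R * (n%:R `^ (- alpha) * ab n).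
Proof.
have [M hM] := bounded_tp P P'.
rewrite (IW_Gf (@measurable_tp R P P') hM).
have c0 : ca != 0 by rewrite gt_eqF// ca_gt0.
under eq_Rintegral do rewrite IW_tp_Nf.
have h (n : nat) : mu.-integrable setT (fun u => ((n != 0%N :> nat)%:R * (rr u ^+ n * ab n))%:E) /\
  \int[mu]_u ((n != 0%N :> nat)%:R * (rr u ^+ n * ab n)) =
  ca * ((n != 0%N :> nat)%:R * (n%:R `^ (- alpha) * ab n)).
  case: n => [|n].
    split.
      have := integrableZl measurableT 0 (integrable_rr alpha_gt0).
      by apply: eq_integrable => // u _ /=; rewrite mul0r mul0e.
    by rewrite /= mul0r mulr0; under eq_Rintegral do rewrite mul0r; rewrite Rintegral_cst// mul0r.
  have [i E] := int_rr_exp alpha_gt0 (ltn0Sn n).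
  split.
    have := integrableZr measurableT (ab n.+1) i.
    by apply: eq_integrable => // u _ /=; rewrite mul1r EFinM.
  under eq_Rintegral do rewrite mul1r.
  rewrite RintegralZr// E /= mul1r; ring.
suff E : \int[mu]_u (\sum_(n < N) (n != 0%N :> nat)%:R * (rr u ^+ n * ab n)) =
    \sum_(n < N) ca * ((n != 0%N :> nat)%:R * (n%:R `^ (- alpha) * ab n)).
  by rewrite E -mulr_sumr mulrA mulVf// mul1r.
elim: (N) => [|K IH].
  rewrite big_ord0; under eq_Rintegral do rewrite big_ord0.
  by rewrite Rintegral_cst// mul0r.
have isum : mu.-integrable setT (fun u => (\sum_(n < K) (n != 0%N :> nat)%:R * (rr u ^+ n * ab n))%:E).
  under eq_fun do rewrite -sumEFin.
  by apply: integrable_sum => // n _; exact: (h n).1.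
rewrite big_ord_recr /= -IH -(h K).2 -RintegralD//; last exact: (h K).1.
by apply: eq_Rintegral => u _; rewrite big_ord_recr.
Qed.
End Expand.

(** From [|Gf| <= (Top + K) / ca] and [(s + t)^q <= 2^q (s^q + t^q)]: [HC] bounds the integral of
    [Top^q], and the other summand is that of [K^q]. Inside [K], [N1 f] is replaced by the mass of
    the weight plus 1. *)
Definition FC : R :=
  (ca^-1 `^ q * 2 `^ q) * (HC + (Mc * (IW (fun=> 1) + 1) * (1 + ca)) `^ q * IW (fun=> 1)).

Lemma N1_le : N1 f <= IW (fun=> 1) + 1.
Proof.
have m2 : measurable_fun setT (fun x => `|f x| `^ p * wgt x).
  exact: measurable_powMwgt.
rewrite -lee_fin /N1 IW_EFin; last exact: intW_norm.
apply: (@le_trans _ _ (\int[mu]_x (1 * wgt x + `|f x| `^ p * wgt x)%:E)%E).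
  apply: le_integral_EFin.
  - by exact: measurable_Mwgt.
  - apply: measurable_funD; last exact: m2.
    by exact: measurable_Mwgt.
  - by move=> x; rewrite mulr_ge0 ?wgt_ge0.
  - by move=> x; rewrite -mulrDl ler_wpM2r ?wgt_ge0// le_1Dpow// ltW.
rewrite integralD_ge0_EFin//; last 3 first.
- by exact: measurable_Mwgt.
- by move=> x; rewrite mulr_ge0 ?wgt_ge0.
- by move=> x; rewrite mulr_ge0 ?wgt_ge0 ?powR_ge0.
by rewrite int_cstW mul1r EFinD leeD.
Qed.

Lemma Kf_le : Kf <= Mc * (IW (fun=> 1) + 1) * (1 + ca).
Proof.
have c0 : 0 <= 1 + ca by rewrite addr_ge0// ltW// ca_gt0.
by rewrite ler_wpM2r// ler_wpM2l ?Mc_ge0// N1_le.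
Qed.

Lemma Gf_pow_int : (\int[mu]_x (`|Gf x| `^ q * wgt x)%:E <= FC%:E)%E.
Proof.
set K := Mc * (IW (fun=> 1) + 1) * (1 + ca).
have c0 : 0 <= ca^-1 by rewrite invr_ge0 ltW// ca_gt0.
have q0 := ltW q_gt0.
have A0 : 0 <= ca^-1 `^ q * 2 `^ q by rewrite mulr_ge0 ?powR_ge0.
have KW : measurable_fun setT (fun x => (K `^ q * wgt x)%:E).
  by apply/measurable_EFinP; exact: measurable_Mwgt.
have T0 x : (0 <= Top x `^ q * (wgt x)%:E)%E by rewrite mule_ge0 ?poweR_ge0.
have K0 x : (0 <= (K `^ q * wgt x)%:E)%E by rewrite lee_fin mulr_ge0 ?powR_ge0 ?wgt_ge0.
apply: (@le_trans _ _ (\int[mu]_x ((ca^-1 `^ q * 2 `^ q)%:E *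
   (Top x `^ q * (wgt x)%:E + (K `^ q * wgt x)%:E)))%E).
  apply: ge0_le_integral; first exact: measurableT.
  - by move=> x _; rewrite lee_fin mulr_ge0 ?powR_ge0 ?wgt_ge0.
  - by apply/measurable_EFinP; exact: measurable_powMwgt measurable_Gf.
  - apply: emeasurable_funM; first exact: measurable_cst.
    by apply: emeasurable_funD; [exact: mTopq|exact: KW].
  - move=> x _.
    have -> : (Top x `^ q * (wgt x)%:E + (K `^ q * wgt x)%:E =
       (Top x `^ q + (K `^ q)%:E) * (wgt x)%:E)%E.
      by rewrite (EFinM (K `^ q) (wgt x)) -ge0_muleDl ?poweR_ge0 ?lee_fin ?powR_ge0.
    rewrite (EFinM (`|Gf x| `^ q) (wgt x)) muleA; apply: lee_wpmul2r => //.
    have := Gf_le x; have := Top_ge0' x; case: (Top x) => [t| |] // t0.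
      rewrite lee_fin in t0.
      rewrite -EFinD -EFinM lee_fin => h.
      rewrite poweR_EFin -EFinD -EFinM lee_fin -mulrA.
      apply: (@le_trans _ _ ((ca^-1 * (t + K)) `^ q)).
        apply: ge0_ler_powR; rewrite ?nnegrE//.
        - by rewrite mulr_ge0// addr_ge0// (le_trans Kf_ge0 Kf_le).
        - by apply: (le_trans h); rewrite ler_wpM2l// lerD2l Kf_le.
      have Kge0 : 0 <= K := le_trans Kf_ge0 Kf_le.
      rewrite powRM ?addr_ge0// ler_wpM2l ?powR_ge0//.
      exact: powR_add_le.
    move=> _; rewrite poweRyr ?gt_eqF// addye// muleC gt0_mulye ?leey//.
    by rewrite lte_fin mulr_gt0 ?powR_gt0// invr_gt0 ca_gt0.
rewrite ge0_integralZl//; last 2 first.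
- by apply: emeasurable_funD; [exact: mTopq|exact: KW].
- by move=> x _; rewrite adde_ge0.
rewrite [FC%:E]EFinM; apply: lee_wpmul2l; first by rewrite lee_fin.
rewrite ge0_integralD//.
by rewrite int_cstW [leRHS]EFinD leeD// Top_int.
Qed.

Variable g : R -> R.
Hypothesis mg : measurable_fun setT g.
Hypothesis hg : intW g.
Hypothesis g0 : cE k 0 g = 0.
Hypothesis gE_ : forall n, (0 < n)%N -> cE k n g = n%:R `^ (- alpha) * cE k n f.
Hypothesis gO_ : forall n, (0 < n)%N -> cO k n g = n%:R `^ (- alpha) * cO k n f.

Lemma IW_tp_eq P P' : IW (fun x => tp P P' x * g x) = IW (fun x => tp P P' x * Gf x).
Proof.
have [N [a [b [-> ->]]]] := trig_expand k_gt0 P P'.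
rewrite IW_tp_Gf.
have iE n : intW (fun x => a n * (gE k n x * g x) + b n * (gO k n x * g x)).
  by apply: intWD; apply: intWZ; [exact: intW_gE|exact: intW_gO].
transitivity (IW (fun x => \sum_(n < N) (a n * (gE k n x * g x) + b n * (gO k n x * g x)))).
  apply: eq_IW => x; rewrite /tp !horner_sum mulr_sumr -big_split /= mulr_suml.
  apply: eq_bigr => n _; rewrite /gE /gO !hE; ring.
have [_ ->] := IW_sum k_gt0 (fun n : 'I_N => iE n).
apply: eq_bigr => n _.
rewrite IWD; [|exact/intWZ/intW_gE|exact/intWZ/intW_gO].
rewrite IWZ ?IWZ; [|exact: intW_gO|exact: intW_gE].
rewrite -/(cE k n g) -/(cO k n g).
case: n => -[|n] nN /=.
  by rewrite g0 cO0 !mulr0 addr0 mul0r.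
by rewrite gE_// gO_//; ring.
Qed.

(** Both functions have the same integral against every trigonometric polynomial, so the positivity
    criterion applies to their difference and to its opposite. *)
Lemma g_ae_eq : {ae mu, forall x, g x * wgt x = Gf x * wgt x}.
Proof.
have mk (u v : R -> R) : intW u -> intW v ->
    (forall P P', IW (fun x => tp P P' x * u x) = IW (fun x => tp P P' x * v x)) ->
    {ae mu, forall x, 0 <= (u x - v x) * wgt x}.
  move=> hu hv uv.
  have huv : intW (fun x => u x - v x).
    by apply: eq_intW (intWD hu (intWZ (- 1) hv)) => x; rewrite mulN1r.
  apply: ae_ge0_of_trig => //.
  - by move=> x Dx; rewrite wgt_out// mulr0.
  - move=> P P' _.
    have [M hM] := bounded_tp P P'; have mtp := @measurable_tp R P P'.
    suff -> : \int[mu]_x ((u x - v x) * wgt x * tp P P' x) = 0 by [].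
    transitivity (IW (fun x => tp P P' x * u x + (- 1) * (tp P P' x * v x))).
      by apply: eq_Rintegral => x _; ring.
    rewrite IWD; [|exact: (intWM mtp hM)|exact/intWZ/(intWM mtp hM)].
    by rewrite IWZ ?uv ?mulN1r ?subrr//; exact: (intWM mtp hM).
have h1 := mk g Gf hg intW_Gf IW_tp_eq.
have h2 := mk Gf g intW_Gf hg (fun P P' => esym (IW_tp_eq P P')).
have FF : Filter (nbhs (almost_everywhere mu)) by exact: ae_filter_ringOfSetsType.
apply: filterS2 h1 h2 => x; rewrite !mulrBl !subr_ge0 => l1 l2.
by apply/le_anti; rewrite l1 l2.
Qed.

Lemma frac_int_bound : (\int[mu]_x (`|g x| `^ q * wgt x)%:E <= FC%:E)%E.
Proof.
apply: le_trans Gf_pow_int.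
have mm (h : R -> R) : measurable_fun setT h -> measurable_fun setT (fun x => (`|h x| `^ q * wgt x)%:E).
  by move=> mh; apply/measurable_EFinP; exact: measurable_powMwgt.
apply: ae_ge0_le_integral.
- exact: measurableT.
- by move=> x _; rewrite lee_fin mulr_ge0 ?powR_ge0 ?wgt_ge0.
- exact: mm.
- by move=> x _; rewrite lee_fin mulr_ge0 ?powR_ge0 ?wgt_ge0.
- exact: (mm _ measurable_Gf).
have FF : Filter (nbhs (almost_everywhere mu)) by exact: ae_filter_ringOfSetsType.
apply: filterS g_ae_eq => x e _; rewrite lee_fin.
have [w0|w0] := eqVneq (wgt x) 0; first by rewrite w0 !mulr0.
by have := mulIf w0 e => ->.
Qed.

End Fixed.
End FracInt.

(** * Identification of the functions E_n *)

Section GramSchmidt.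
Variables (R : realFieldType) (V : lmodType R) (B : V -> V -> R).
Hypothesis B_lin : forall a u v w, B (a *: u + v) w = a * B u w + B v w.
Hypothesis B_sym : forall u v, B u v = B v u.
Hypothesis B_psd : forall u, 0 <= B u u.

Lemma form0l w : B 0 w = 0.
Proof. by have := B_lin 1 0 0 w; rewrite scaler0 addr0 mul1r => /eqP; rewrite -subr_eq0 opprD addrA subrr add0r oppr_eq0 => /eqP. Qed.

Lemma formZl a u w : B (a *: u) w = a * B u w.
Proof. by have := B_lin a u 0 w; rewrite addr0 form0l addr0. Qed.

Lemma formDl u v w : B (u + v) w = B u w + B v w.
Proof. by have := B_lin 1 u v w; rewrite scale1r mul1r. Qed.

Lemma form_suml (I : Type) (l : seq I) (F : I -> V) w :
  B (\sum_(i <- l) F i) w = \sum_(i <- l) B (F i) w.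
Proof.
elim: l => [|i l IH]; first by rewrite !big_nil form0l.
by rewrite !big_cons formDl IH.
Qed.

(** [B (t v + u) (t v + u)] is affine in [t] and never negative, so its slope vanishes. *)
Lemma form_isotropic u v : B v v = 0 -> B u v = 0.
Proof.
move=> v0.
have h t : 0 <= B u u + 2 * t * B u v.
  have := B_psd (t *: v + u); rewrite B_lin [B v _]B_sym [B u _]B_sym !B_lin v0 [B v u]B_sym; lra.
have [->//|n0] := eqVneq (B u v) 0.
have := h (- (B u u + 1) / (2 * B u v)).
have -> : 2 * (- (B u u + 1) / (2 * B u v)) * B u v = - (B u u + 1) by field.
lra.
Qed.

(** The form is only positive semidefinite, so the residue [w1] of the head against the tail may be
    isotropic; it is then orthogonal to everything and any multiple will do. Otherwise a suitable
    multiple of [w1] corrects the head without spoiling the tail. *)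
Lemma gram_schmidt (I : eqType) (e : I -> V) (l : seq I) (w : V) : uniq l ->
  exists c : I -> R, forall j, j \in l -> B (w + \sum_(i <- l) c i *: e i) (e j) = 0.
Proof.
elim: l w => [|i l IH] w; first by exists (fun=> 0).
move=> /= /andP[il ul].
have [c0 h0] := IH w ul; have [c1 h1] := IH (e i) ul.
set w0 := w + _ in h0; set w1 := e i + _ in h1.
have rest u : (forall j, j \in l -> B u (e j) = 0) -> B u (e i) = B u w1.
  move=> hu; rewrite /w1 B_sym [RHS]B_sym formDl form_suml big_seq big1 ?addr0// => j jl.
  by rewrite formZl B_sym hu// mulr0.
have E11 := rest _ h1; have E01 := rest _ h0.
pose t := - (B w0 w1 / B w1 w1).
have tE : B w0 w1 + t * B w1 w1 = 0.
  have [z|nz] := eqVneq (B w1 w1) 0; first by rewrite (form_isotropic w0 z) z mulr0 addr0.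
  by rewrite /t mulNr divfK// subrr.
exists (fun j => if j == i then t else c0 j + t * c1 j) => j.
have -> : w + \sum_(i0 <- i :: l) (if i0 == i then t else c0 i0 + t * c1 i0) *: e i0 =
    t *: w1 + w0.
  rewrite big_cons eqxx /w0 /w1 scalerDr scaler_sumr.
  rewrite (eq_big_seq (fun j => c0 j *: e j + t *: (c1 j *: e j))); last first.
    move=> i' i'l; rewrite ifF ?scalerDl ?scalerA//.
    by apply: contraNF il => /eqP <-.
  rewrite big_split /= addrCA -[RHS]addrA; congr (_ + _).
  by rewrite addrA addrC.
rewrite inE => /orP[/eqP ->|jl]; rewrite B_lin; last by rewrite h1// h0// mulr0 addr0.
by rewrite E11 E01 addrC.
Qed.

End GramSchmidt.

(** * Exponentials as Chebyshev pairs *)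

Section Chebyshev.
Variable R : realType.

(* the Chebyshev pairs [(T_n, U_(n-1))], so that [chebU 0 = 0] *)
Fixpoint cheb (n : nat) : {poly R} * {poly R} :=
  if n is m.+1 then
    ('X * (cheb m).1 - (1 - 'X^2) * (cheb m).2, (cheb m).1 + 'X * (cheb m).2)
  else (1, 0).
Definition chebT n := (cheb n).1.
Definition chebU n := (cheb n).2.

Lemma chebTS n : chebT n.+1 = 'X * chebT n - (1 - 'X^2) * chebU n. Proof. by []. Qed.
Lemma chebUS n : chebU n.+1 = chebT n + 'X * chebU n. Proof. by []. Qed.
Lemma chebT0 : chebT 0 = 1. Proof. by []. Qed.
Lemma chebU0 : chebU 0 = 0. Proof. by []. Qed.

Lemma cheb_trig n x : cos (n%:R * x) = (chebT n).[cos x] /\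
  sin (n%:R * x) = sin x * (chebU n).[cos x].
Proof.
elim: n => [|n [IH1 IH2]].
  by rewrite mul0r cos0 sin0 chebT0 chebU0 !hE mulr0.
rewrite -natr1 mulrDl mul1r cosD sinD IH1 IH2 chebTS chebUS !hE ?expr2.
split; last by ring.
by rewrite -(sin2cos2' x) ?expr2; ring.
Qed.

Lemma cheb_size n : (size (chebT n) <= n.+1)%N /\ (size (chebU n) <= n)%N.
Proof.
elim: n => [|n [IH1 IH2]]; first by rewrite chebT0 chebU0 size_poly1 size_poly0.
have s1 (p : {poly R}) m : (size p <= m)%N -> (size ('X * p)%R <= m.+1)%N.
  move=> pm; have [->|p0] := eqVneq p 0; first by rewrite mulr0 size_poly0.
  by rewrite mulrC size_mulX.
rewrite chebTS chebUS; split.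
  have -> : (1 - 'X^2) * chebU n = chebU n - 'X * ('X * chebU n) by ring.
  rewrite opprB addrA.
  rewrite (leq_trans (size_polyD _ _))// geq_max size_polyN (leq_trans IH2) ?andbT//; last exact: leqW.
  by rewrite (leq_trans (size_polyD _ _))// geq_max !s1// s1.
by rewrite (leq_trans (size_polyD _ _))// geq_max IH1 s1.
Qed.

Lemma cheb_coef n : (chebT n.+1)`_n.+1 = 2 ^+ n /\ (chebU n.+1)`_n = 2 ^+ n.
Proof.
elim: n => [|n [IH1 IH2]].
  by rewrite chebTS chebUS chebT0 chebU0 !mulr0 subr0 addr0 mulr1 coefX coef1.
have [s1 s2] := cheb_size n.+1.
rewrite chebTS chebUS; split.
  have -> : 'X * chebT n.+1 - (1 - 'X^2) * chebU n.+1 =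
    'X * chebT n.+1 + 'X * ('X * chebU n.+1) - chebU n.+1 by ring.
  rewrite coefB coefD !coefXM /= IH1 IH2 [X in _ - X]nth_default ?(leq_trans s2)// subr0 exprS; ring.
by rewrite coefD coefXM /= IH1 IH2 exprS; ring.
Qed.

Lemma cheb_parity n : chebT n \Po - 'X = (-1) ^+ n * chebT n /\
  chebU n \Po - 'X = - (-1) ^+ n * chebU n.
Proof.
elim: n => [|n [IH1 IH2]].
  by rewrite chebT0 chebU0 comp_poly0 comp_polyC mulr0 expr0 mul1r.
have E : (1 - 'X^2) \Po - 'X = 1 - 'X^2 :> {poly R}.
  by rewrite rmorphB rmorph1 /= expr2 comp_polyM comp_polyX; ring.
rewrite chebTS chebUS comp_polyB comp_polyD !comp_polyM E !comp_polyX IH1 IH2 [(-1) ^+ n.+1]exprS.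
by split; ring.
Qed.

Lemma size_chebT n : size (chebT n) = n.+1.
Proof.
case: n => [|n]; first by rewrite chebT0 size_poly1.
apply/eqP; rewrite eqn_leq (cheb_size _).1 /= ltnNge; apply/negP => s.
have := (cheb_coef n).1; rewrite nth_default// => /esym/eqP.
by rewrite expf_eq0 pnatr_eq0 andbF.
Qed.

Lemma size_chebU n : size (chebU n.+1) = n.+1.
Proof.
apply/eqP; rewrite eqn_leq (cheb_size _).2 /= ltnNge; apply/negP => s.
have := (cheb_coef n).2; rewrite nth_default// => /esym/eqP.
by rewrite expf_eq0 pnatr_eq0 andbF.
Qed.

Definition cvec (j : int) : {poly R} * {poly R} :=
  match j with Posz n => (chebT n, chebU n) | Negz n => (chebT n.+1, - chebU n.+1) end.

Lemma cvecN n : cvec (- n%:Z) = (chebT n, - chebU n).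
Proof. by case: n => [|n] //=; rewrite chebU0 oppr0. Qed.

Lemma cvec1 j : (cvec j).1 = chebT (absz j). Proof. by case: j. Qed.

(** The factor [i] on the odd part is what lets pairs of real polynomials represent the exponentials
    and their real combinations. *)
Definition pfun (v : {poly R} * {poly R}) (x : R) : R[i] :=
  Complex v.1.[cos x] (sin x * v.2.[cos x]).

Lemma expi_pfun j x : expi j x = pfun (cvec j) x.
Proof.
case: j => n; rewrite /expi /pfun /=.
  by have [<- <-] := cheb_trig n x.
have [<- _] := cheb_trig n.+1 x.
rewrite NegzE hE mulrN; have [_ <-] := cheb_trig n.+1 x.
by rewrite rmorphN /= !mulNr cosN sinN.
Qed.

Definition Epair (n : int) (c : int -> R) := cvec n + \sum_(j <- trirange n) c j *: cvec j.

Lemma pfunD u v x : pfun (u + v) x = pfun u x + pfun v x.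
Proof. by rewrite /pfun /= !hE mulrDr. Qed.

Lemma pfunZ a v x : pfun (a *: v) x = Complex a 0 * pfun v x.
Proof.
rewrite /pfun /= !hornerZ; apply/eqP; rewrite eq_complex /=; apply/andP; split; apply/eqP; ring.
Qed.

Lemma Efun_pfun n c x : Efun n c x = pfun (Epair n c) x.
Proof.
rewrite /Efun /Epair pfunD expi_pfun; congr (_ + _).
elim: (trirange n) => [|j l IH]; last by rewrite !big_cons pfunD pfunZ IH expi_pfun.
by rewrite !big_nil /pfun /= horner0 mulr0.
Qed.

End Chebyshev.

(** * The functions E_n as Gegenbauer pairs *)

Section Identification.
Variables (R : realType) (k : R).
Hypothesis k_gt0 : 0 < k.
Local Notation mu := (@lebesgue_measure R).
Local Notation Mp := (Mp k).
Local Notation IW := (IW k).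
Local Notation intW := (intW k).
Local Notation geg := (geg k).
Local Notation hn := (hn k).
Local Notation chebT := (@chebT R).
Local Notation chebU := (@chebU R).
Implicit Types (u v w : {poly R} * {poly R}).

Definition pform u v : R := Mp (u.1 * v.1 + (1 - 'X^2) * (u.2 * v.2)).

Lemma pform_lin a u v w : pform (a *: u + v) w = a * pform u w + pform v w.
Proof.
rewrite /pform -(MpZ k_gt0) -(MpD k_gt0) /=; congr (Mp _).
by rewrite -!mul_polyC; ring.
Qed.

Lemma pform_sym u v : pform u v = pform v u.
Proof. by rewrite /pform; congr (Mp _); ring. Qed.

Lemma pform_psd u : 0 <= pform u u.
Proof.
apply: IW_ge0 => x; rewrite !hE ?expr2 -(sin2cos2' x).
have -> : u.1.[cos x] * u.1.[cos x] + sin x * sin x * (u.2.[cos x] * u.2.[cos x]) =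
  u.1.[cos x] ^+ 2 + (sin x * u.2.[cos x]) ^+ 2 by ring.
by rewrite addr_ge0// sqr_ge0.
Qed.

(** The imaginary part of the product is an odd function, so it integrates to zero. *)
Lemma ipk_pfun u v : ipk k (pfun u) (pfun v) = Complex (pform u v) 0.
Proof.
have E1 x : complex.Re (pfun u x * conjc (pfun v x)) =
    (u.1 * v.1 + (1 - 'X^2) * (u.2 * v.2)).[cos x].
  by rewrite /pfun /= !hE ?expr2 -(sin2cos2' x); ring.
have E2 x : complex.Im (pfun u x * conjc (pfun v x)) = tp 0 (u.2 * v.1 - u.1 * v.2) x.
  by rewrite /pfun /= tp0E !hE; ring.
rewrite /ipk; congr Complex.
  by rewrite -IWE /pform /Mp; apply: eq_IW => x; rewrite E1.
by rewrite -IWE (eq_IW k E2) IW_tp// (Mp0 k_gt0).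
Qed.

Lemma trirange_uniq n : uniq (trirange n).
Proof.
by rewrite filter_uniq// map_inj_uniq ?iota_uniq// => i j /addIr [].
Qed.

Lemma mem_trirange j n : (j \in trirange n) = tri j n.
Proof.
rewrite mem_filter andb_idr// => t; apply/mapP.
have jn : (absz j <= absz n)%N.
  by move: t => /orP[/andP[/ltnW]//|/andP[/eqP ->]].
exists (absz (j + (absz n)%:Z)).
  rewrite mem_iota add0n leq0n /= ltnS mul2n -addnn; have := jn.
  by case: j {t jn} => j; rewrite ?NegzE; lia.
by have := jn; case: j {t jn} => j; rewrite ?NegzE; lia.
Qed.

Lemma EcondE n c : Econd k n c <-> forall j, tri j n -> pform (Epair n c) (cvec R j) = 0.
Proof.
have E j : ipk k (Efun n c) (expi j) = Complex (pform (Epair n c) (cvec R j)) 0.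
  rewrite -ipk_pfun; congr (ipk k _ _); apply/funext => x.
    exact: Efun_pfun.
  exact: expi_pfun.
split=> h j /h; rewrite E; first by case.
by move=> ->.
Qed.

(** [Ecoef] is a choice by [xget]; Gram-Schmidt shows that there is a solution to choose. *)
Lemma Econd_Ecoef n : Econd k n (Ecoef k n).
Proof.
suff [c hc] : exists c : int -> R, Econd k n c by exact: (xgetPex _ (ex_intro _ c hc)).
have [c hc] := gram_schmidt pform_lin pform_sym pform_psd (cvec R) (cvec R n) (trirange_uniq n).
by exists c; apply/EcondE => j; rewrite -mem_trirange => /hc.
Qed.

(** Integration by parts with an even power expresses an odd moment through the previous one; the
    first moment vanishes by the same formula. *)
Lemma Mp_odd m : Mp 'X^(m.*2.+1) = 0.
Proof.
elim: m => [|m IH].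
  have := Mp_byparts k_gt0 1; rewrite derivC mulr0 (Mp0 k_gt0) (MpZ k_gt0) mulr1 => /eqP.
  rewrite mulf_eq0 => /orP[|/eqP//].
  by rewrite gt_eqF// addr_gt0// mulr_gt0.
have := Mp_byparts k_gt0 'X^(m.+1.*2).
rewrite derivXn (MpZ k_gt0) -exprS.
have -> : (1 - 'X^2) * ('X^(m.+1.*2.-1) *+ m.+1.*2) =
   (m.+1.*2%:R)%:P * 'X^(m.*2.+1) - (m.+1.*2%:R)%:P * 'X^(m.+1.*2.+1) :> {poly R}.
  rewrite doubleS /= -[(_ *+ _)]mulr_natl polyC_natr.
  have -> : 'X^(m.*2.+3) = 'X^2 * 'X^(m.*2.+1) :> {poly R} by rewrite -exprD.
  ring.
rewrite (MpB k_gt0) !(MpZ k_gt0) IH mulr0 sub0r => /eqP.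
rewrite -subr_eq0 opprK -mulrDl mulf_eq0 => /orP[|/eqP//].
by rewrite gt_eqF// addr_gt0// ?addr_gt0 ?mulr_gt0// ltr0n.
Qed.

Lemma Mp_compN (P : {poly R}) : Mp (P \Po - 'X) = Mp P.
Proof.
rewrite comp_polyE -[in RHS](coefK P) poly_def !(Mp_sum k_gt0); apply: eq_bigr => i _.
rewrite -!mul_polyC !(MpZ k_gt0); congr (_ * _).
have -> : (- 'X) ^+ i = ((-1) ^+ i)%:P * 'X^i :> {poly R}.
  elim: (nat_of_ord i) => [|n IH]; first by rewrite !expr0 mulr1.
  by rewrite ![_ ^+ n.+1]exprS IH polyCM polyCN; ring.
rewrite (MpZ k_gt0) -signr_odd; have [oi|_] := boolP (odd i); last by rewrite mul1r.
have -> : nat_of_ord i = (i./2).*2.+1 by rewrite -[LHS]odd_double_half oi.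
by rewrite Mp_odd mulr0.
Qed.

Lemma Mp_antisym (P : {poly R}) : P \Po - 'X = - P -> Mp P = 0.
Proof. by move=> E; have := Mp_compN P; rewrite E (MpN k_gt0); lra. Qed.

Lemma odd_sgn m j : (j <= m)%N -> odd (m - j)%N -> (-1) ^+ m * (-1) ^+ j = -1 :> {poly R}.
Proof.
move=> jm; rewrite oddB// -exprD -signr_odd oddD => ->.
by rewrite expr1.
Qed.

(** For [j] of the parity of [m], adding and subtracting the conditions for [j] and [- j] separates
    the even from the odd part. For the other parity both integrands are odd polynomials. *)
Lemma pair_orth m (A B : {poly R}) :
  A \Po - 'X = (-1) ^+ m * A -> B \Po - 'X = - (-1) ^+ m * B ->
  (forall j, (j < m)%N -> ~~ odd (m - j)%N ->
     pform (A, B) (cvec R j) = 0 /\ pform (A, B) (cvec R (- j%:Z)) = 0) ->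
  forall j, (j < m)%N -> Mp (A * chebT j) = 0 /\ Mp ((1 - 'X^2) * (B * chebU j)) = 0.
Proof.
move=> pA pB h j jm; have [oj|ej] := boolP (odd (m - j)%N); last first.
  have [] := h j jm ej; rewrite cvecN /pform /= !(MpD k_gt0).
  have -> : (1 - 'X^2) * (B * - chebU j) = - ((1 - 'X^2) * (B * chebU j)) by ring.
  by rewrite (MpN k_gt0); split; lra.
have [pT pU] := cheb_parity R j; have sg := odd_sgn (ltnW jm) oj.
split; apply: Mp_antisym; rewrite !rmorphM ?rmorphB /= ?rmorphM ?rmorph1 /= ?comp_polyX ?pA ?pB ?pT ?pU.
  have -> : (-1) ^+ m * A * ((-1) ^+ j * chebT j) = (-1) ^+ m * (-1) ^+ j * (A * chebT j) by ring.
  by rewrite sg mulN1r.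
have -> : (1 - - 'X * - 'X) * (- (-1) ^+ m * B * (- (-1) ^+ j * chebU j)) =
  (-1) ^+ m * (-1) ^+ j * ((1 - 'X^2) * (B * chebU j)) by ring.
by rewrite sg mulN1r.
Qed.

(** Expand in [geg] and [geg']: a lower basis element is a combination of Chebyshev polynomials of
    lower index, so its coefficient vanishes and only the top one survives. *)
Lemma pair_geg m (A B : {poly R}) : (size A <= m.+2)%N -> (size B <= m.+1)%N ->
  (forall j, (j < m.+1)%N -> Mp (A * chebT j) = 0 /\ Mp ((1 - 'X^2) * (B * chebU j)) = 0) ->
  exists a b, A = a%:P * geg m.+1 /\ B = b%:P * (geg m.+1)^`().
Proof.
move=> sA sB h.
have [a EA] := size_basis_expand (size_geg k_gt0) sA.
have [b EB] := size_basis_expand (F := fun j => (geg j.+1)^`()) (size_geg_deriv k_gt0) sB.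
have a0 i : (i < m.+1)%N -> a i = 0.
  move=> im; have hi0 : hn i != 0 by rewrite gt_eqF// hn_gt0.
  apply: (mulIf hi0); rewrite mul0r.
  have [d Ed] := size_basis_expand (@size_chebT R) (eq_leq (size_geg k_gt0 i)).
  have E1 : Mp (A * geg i) = 0.
    rewrite Ed mulr_sumr (Mp_sum k_gt0) big1// => j _.
    rewrite mulrCA (MpZ k_gt0) (h j _).1 ?mulr0//.
    exact: leq_trans (ltn_ord j) im.
  rewrite -E1 EA mulr_suml (Mp_sum k_gt0) (bigD1 (Ordinal (leqW im)))//= big1.
    by rewrite addr0 -mulrA (MpZ k_gt0).
  move=> j ji; rewrite -mulrA (MpZ k_gt0) (Mp_orth k_gt0) ?mulr0//.
have b0 i : (i < m)%N -> b i = 0.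
  move=> im; have hi0 : glam k i.+1 * hn i.+1 != 0.
    by rewrite gt_eqF// mulr_gt0 ?glam_gt0 ?hn_gt0.
  apply: (mulIf hi0); rewrite mul0r.
  have [d Ed] := size_basis_expand (F := fun j => chebU j.+1) (@size_chebU R) (eq_leq (size_geg_deriv k_gt0 i)).
  have E1 : Mp ((1 - 'X^2) * (B * (geg i.+1)^`())) = 0.
    rewrite Ed !mulr_sumr (Mp_sum k_gt0) big1// => j _.
    have -> : (1 - 'X^2) * (B * ((d j)%:P * chebU j.+1)) =
      (d j)%:P * ((1 - 'X^2) * (B * chebU j.+1)) by ring.
    rewrite (MpZ k_gt0) (h j.+1 _).2 ?mulr0//.
    by rewrite ltnS (leq_ltn_trans _ im)// -ltnS.
  rewrite -E1 EB mulr_suml mulr_sumr (Mp_sum k_gt0) (bigD1 (Ordinal (leqW im)))// big1.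
    by rewrite [RHS]addr0 -[nat_of_ord (Ordinal _)]/i -[in RHS]mulrA [in RHS]mulrCA (MpZ k_gt0) Mp_deriv_sqr.
  move=> j ji; rewrite -mulrA mulrCA (MpZ k_gt0) (Mp_orth_deriv k_gt0) ?mulr0//.
exists (a m.+1), (b m); split.
  by rewrite EA big_ord_recr /= big1 ?add0r// => j _; rewrite a0// polyC0 mul0r.
by rewrite EB big_ord_recr /= big1 ?add0r// => j _; rewrite b0// polyC0 mul0r.
Qed.

(** The order puts [m] below [- m], so all lower terms have smaller absolute value except [e_m] in
    the expansion of [E_(-m)]. *)
Lemma tri_lt_parity m (n j : int) : (0 < m)%N -> absz n = m -> tri j n ->
  [/\ (absz j < m)%N & ~~ odd (m - absz j)] \/ (j = m%:Z /\ n = - m%:Z).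
Proof.
move=> m0 nm /orP[/andP[]|/andP[/eqP jn nj]]; first by rewrite nm; left.
by right; lia.
Qed.

Lemma cvec_size m (j : int) : (absz j < m)%N ->
  (size (cvec R j).1 <= m)%N /\ (size (cvec R j).2 <= m.-1)%N.
Proof.
move=> jm; have [s1 s2] := cheb_size R (absz j).
have -> : size (cvec R j).2 = size (chebU (absz j)) by case: (j) => // i; rewrite /= size_polyN.
by rewrite cvec1 (leq_trans s1)// (leq_trans s2)//; case: m jm.
Qed.

Lemma cvec_parity (j : int) : (cvec R j).1 \Po - 'X = (-1) ^+ absz j * (cvec R j).1 /\
  (cvec R j).2 \Po - 'X = - (-1) ^+ absz j * (cvec R j).2.
Proof.
have [h1 h2] := cheb_parity R (absz j); rewrite cvec1 h1; split=> //.
by case: j {h1} h2 => i //= h2; rewrite rmorphN /= h2 mulrN.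
Qed.

Lemma tri_sgn m (n j : int) : (0 < m)%N -> absz n = m -> tri j n -> (-1) ^+ absz j = (-1) ^+ m :> {poly R}.
Proof.
move=> m0 nm t; have [[jm e]|[-> _]] := tri_lt_parity m0 nm t; last by rewrite absz_nat.
rewrite -(subnK (ltnW jm)) exprD -[_ ^+ (m - _)]signr_odd (negbTE e).
by rewrite expr0 mul1r.
Qed.

Section Epm.
Variables (m : nat) (n : int) (c : int -> R).
Hypothesis nm : absz n = m.+1.

Lemma Epair_parity :
  (Epair n c).1 \Po - 'X = (-1) ^+ m.+1 * (Epair n c).1 /\
  (Epair n c).2 \Po - 'X = - (-1) ^+ m.+1 * (Epair n c).2.
Proof.
rewrite /Epair; have : forall j, j \in trirange n -> tri j n by move=> j; rewrite mem_trirange.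
elim: (trirange n) => [_|j l IH lt]; first by rewrite big_nil addr0; have := cvec_parity n; rewrite nm.
have [|h1 h2] := IH; first by move=> i il; apply: lt; rewrite inE il orbT.
have [p1 p2] := cvec_parity j.
rewrite (tri_sgn (ltn0Sn m) nm (lt j (mem_head _ _))) in p1 p2.
rewrite big_cons addrCA; set w := (X in c j *: cvec R j + X).
have h1' : w.1 \Po - 'X = (-1) ^+ m.+1 * w.1 by exact: h1.
have h2' : w.2 \Po - 'X = - (-1) ^+ m.+1 * w.2 by exact: h2.
clearbody w; rewrite /= !comp_polyD !comp_polyZ h1' h2' p1 p2 -!mul_polyC; split; ring.
Qed.

(* the coefficient of [e_(m+1)] among the lower terms, present only if [n < 0] *)
Let kap := \sum_(j <- trirange n) (if j == m.+1%:Z then c j else 0).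

(** Only [e_n], and [e_(m+1)] when [n < 0], reach the top degree; the sign in the odd component is
    that of the sine part of [e_n]. *)
Lemma Epair_top :
  [/\ (size (Epair n c).1 <= m.+2)%N, (size (Epair n c).2 <= m.+1)%N,
      (Epair n c).1`_m.+1 = (1 + kap) * 2 ^+ m &
      (Epair n c).2`_m = ((if 0 <= n then 1 else -1) + kap) * 2 ^+ m].
Proof.
have [t1 t2] := cheb_coef R m.
rewrite /Epair /kap; have : forall j, j \in trirange n -> tri j n by move=> j; rewrite mem_trirange.
elim: (trirange n) => [_|j l IH lt].
  rewrite !big_nil !addr0 cvec1 nm size_chebT t1 mul1r.
  case: n nm => i /= Ei; first by rewrite Ei size_chebU t2 mul1r.
  by rewrite Ei size_polyN size_chebU coefN t2 mulN1r.
have [|h1 h2 h3 h4] := IH; first by move=> i il; apply: lt; rewrite inE il orbT.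
have tj := tri_lt_parity (ltn0Sn m) nm (lt j (mem_head _ _)).
have [s1 s2] : (size (cvec R j).1 <= m.+2)%N /\ (size (cvec R j).2 <= m.+1)%N.
  have [|s1 s2] := @cvec_size m.+2 j; last by split.
  by case: tj => [[/leqW//]|[-> _]].
rewrite !big_cons addrCA; set w := (X in c j *: cvec R j + X).
rewrite /=; split.
- by rewrite (leq_trans (size_polyD _ _))// geq_max [X in _ && X]h1 andbT (leq_trans (size_scale_leq _ _)).
- by rewrite (leq_trans (size_polyD _ _))// geq_max [X in _ && X]h2 andbT (leq_trans (size_scale_leq _ _)).
- rewrite coefD coefZ (h3 : w.1`_m.+1 = _) cvec1; case: tj => [[jm _]|[-> _]].
    rewrite nth_default ?size_chebT// ifF; first by ring.
    by apply/eqP => E; rewrite E absz_nat ltnn in jm.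
  by rewrite eqxx absz_nat t1; ring.
- rewrite coefD coefZ (h4 : w.2`_m = _); case: tj => [[jm _]|[-> _]].
    have [_ s3] := cvec_size jm.
    rewrite nth_default// [if j == _ then _ else _]ifF; first by rewrite mulr0 !add0r.
    by apply/eqP => E; rewrite E absz_nat ltnn in jm.
  by rewrite eqxx t2 -mulrDl addrCA.
Qed.

Hypothesis hc : Econd k n c.

Lemma Epair_geg : exists a b, Epair n c = (a%:P * geg m.+1, b%:P * (geg m.+1)^`()).
Proof.
have [s1 s2 _ _] := Epair_top; have [p1 p2] := Epair_parity.
have h := (EcondE n c).1 hc.
have [|a [b [Ea Eb]]] := @pair_geg m (Epair n c).1 (Epair n c).2 s1 s2; last first.
  by exists a, b; rewrite -Ea -Eb; case: (Epair n c).
apply: pair_orth => // j jm ej; rewrite -surjective_pairing.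
by split; apply: h; rewrite /tri nm ?abszN absz_nat jm ej.
Qed.

End Epm.

(** In units of [2^m] the top coefficients are [(1, 1)] for [E_(m+1)] and [(1 + z, z - 1)] for
    [E_(-m-1)]. Their determinant is [-2] whatever [z] is, so the two functions span the whole
    level. *)
Lemma Epair_two m : exists a b a' b', [/\ Epair m.+1%:Z (Ecoef k m.+1%:Z) = (a%:P * geg m.+1, b%:P * (geg m.+1)^`()),
  Epair (- m.+1%:Z) (Ecoef k (- m.+1%:Z)) = (a'%:P * geg m.+1, b'%:P * (geg m.+1)^`()) &
  a * b' - a' * b != 0].
Proof.
have n1 : absz m.+1%:Z = m.+1 by rewrite absz_nat.
have n2 : absz (- m.+1%:Z) = m.+1 by rewrite abszN absz_nat.
have [a [b E]] := Epair_geg n1 (@Econd_Ecoef m.+1%:Z).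
have [a' [b' E']] := Epair_geg n2 (@Econd_Ecoef (- m.+1%:Z)).
have [_ _ ] := Epair_top (Ecoef k m.+1%:Z) n1.
have [_ _ ] := Epair_top (Ecoef k (- m.+1%:Z)) n2.
set c := Ecoef k m.+1 in E *; set c' := Ecoef k (- m.+1%:Z) in E' *.
set z := \sum_(j <- _) _; set z' := \sum_(j <- _) _.
rewrite E E' /= !coefCM => e1 e2 e3 e4.
exists a, b, a', b'; split=> //.
have z0 : z' = 0.
  rewrite /z' big_seq big1// => j; rewrite mem_trirange => t; case: ifPn => // /eqP jE.
  by move: t; rewrite jE /tri ltnn eqxx ltxx.
rewrite z0 !addr0 !mul1r in e3 e4.
have c0 : 2 ^+ m != 0 :> R by rewrite expf_eq0 pnatr_eq0 andbF.
apply/eqP => det.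
have : (a * b' - a' * b) * ((geg m.+1)`_m.+1 * (geg m.+1)^`()`_m) = - 2 * 2 ^+ m * 2 ^+ m.
  have -> : (a * b' - a' * b) * ((geg m.+1)`_m.+1 * (geg m.+1)^`()`_m) =
    (a * (geg m.+1)`_m.+1) * (b' * (geg m.+1)^`()`_m) -
    (a' * (geg m.+1)`_m.+1) * (b * (geg m.+1)^`()`_m) by ring.
  by rewrite e1 e2 e3 e4; ring.
rewrite det mul0r => /esym/eqP; rewrite !mulf_eq0 (negbTE c0) orbF oppr_eq0 pnatr_eq0.
by rewrite orbF.
Qed.

End Identification.

(** * Complex functions and the theorem *)

Section ComplexParts.
Variables (R : realType) (k : R).
Hypothesis k_gt0 : 0 < k.
Local Notation mu := (@lebesgue_measure R).
Local Notation wgt := (wgt k).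
Local Notation intW := (intW k).
Local Notation IW := (IW k).
Implicit Types (h : R -> R[i]) (z : R[i]).

Lemma cabs_Re z : `|complex.Re z| <= cabs z.
Proof. by rewrite -sqrtr_sqr ler_sqrt ?lerDl ?addr_ge0 ?sqr_ge0. Qed.

Lemma cabs_Im z : `|complex.Im z| <= cabs z.
Proof. by rewrite -sqrtr_sqr ler_sqrt ?lerDr ?addr_ge0 ?sqr_ge0. Qed.

Lemma cabs_ge0 z : 0 <= cabs z. Proof. exact: Num.Theory.sqrtr_ge0. Qed.

Lemma cabs_le z : cabs z <= `|complex.Re z| + `|complex.Im z|.
Proof.
have s0 : 0 <= `|complex.Re z| + `|complex.Im z| by rewrite addr_ge0.
rewrite -(ger0_norm s0) -sqrtr_sqr ler_sqrt ?sqr_ge0//.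
rewrite sqrrD !real_normK ?num_real//.
by rewrite addrAC lerDl mulrn_wge0// mulr_ge0.
Qed.

(* extension by zero off [-pi, pi], so that measurability makes sense on the line *)
Definition rst (h : R -> R) (x : R) : R := h x * \1_(@Dpi R) x.

Lemma rst_in (h : R -> R) x : Dpi x -> rst h x = h x.
Proof. by move=> Dx; rewrite /rst indicE mem_set// mulr1. Qed.

Lemma rst_out (h : R -> R) x : ~ Dpi x -> rst h x = 0.
Proof. by move=> Dx; rewrite /rst indicE memNset// mulr0. Qed.

Lemma measurable_rst (h : R -> R) : measurable_fun (@Dpi R) h -> measurable_fun setT (rst h).
Proof.
move=> mh; rewrite (_ : rst h = h \_ (@Dpi R)).
  by apply/(measurable_restrictT h (@measurable_Dpi R)).
by apply/funext => x; rewrite patchE /rst indicE; case: ifPn => _; rewrite ?mulr1 ?mulr0.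
Qed.

Lemma eq_IW_Dpi (F G : R -> R) : (forall x, Dpi x -> F x = G x) -> IW F = IW G.
Proof.
move=> FG; apply: eq_Rintegral => x _; have [Dx|Dx] := pselect (Dpi x); first by rewrite FG.
by rewrite wgt_out// !mulr0.
Qed.

Definition measC h := measurable_fun (@Dpi R) (fun x => complex.Re (h x)) /\
  measurable_fun (@Dpi R) (fun x => complex.Im (h x)).

Lemma measurable_cabs h : measC h -> measurable_fun setT (rst (fun x => cabs (h x))).
Proof.
move=> [m1 m2]; apply: measurable_rst.
have ms : measurable_fun setT (@Num.sqrt R).
  by apply: continuous_measurable_fun; exact: sqrt_continuous.
have m3 : measurable_fun (@Dpi R) (fun x => complex.Re (h x) ^+ 2 + complex.Im (h x) ^+ 2).
  by apply: measurable_funD; apply: measurable_funX.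
exact: (measurableT_comp ms m3).
Qed.

Lemma LpintE r h : (Lpint k r h = \int[mu]_x (rst (fun x => cabs (h x)) x `^ r * wgt x)%:E)%E.
Proof.
rewrite /Lpint integral_mkcond; apply: eq_integral => x _; rewrite patchE.
have [Dx|Dx] := pselect (Dpi x); first by rewrite mem_set// rst_in// wgt_in.
by rewrite memNset// wgt_out// mulr0.
Qed.

Section Part.
Variables (pr : R[i] -> R) (h : R -> R[i]).
Hypothesis pr_le : forall z, `|pr z| <= cabs z.
Hypothesis mh : measC h.
Hypothesis mpr : measurable_fun (@Dpi R) (fun x => pr (h x)).
Let hp := rst (fun x => pr (h x)).

Lemma rst_part_le x : `|hp x| <= rst (fun x => cabs (h x)) x.
Proof.
have [Dx|Dx] := pselect (Dpi x); first by rewrite /hp !rst_in.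
by rewrite /hp !rst_out// normr0.
Qed.

Lemma measurable_cabs_pow r : measurable_fun setT (fun x => rst (fun x => cabs (h x)) x `^ r * wgt x).
Proof.
apply: measurable_Mwgt; exact: (measurableT_comp (measurable_powR _) (measurable_cabs mh)).
Qed.

Lemma Lp_part r : 0 <= r -> (\int[mu]_x (`|hp x| `^ r * wgt x)%:E <= Lpint k r h)%E.
Proof.
move=> r0; rewrite LpintE; apply: le_integral_EFin.
- by apply: measurable_powMwgt; exact: measurable_rst.
- exact: measurable_cabs_pow.
- by move=> x; rewrite mulr_ge0 ?powR_ge0 ?wgt_ge0.
- move=> x; rewrite ler_wpM2r ?wgt_ge0//.
  apply: ge0_ler_powR; rewrite ?nnegrE//; last exact: rst_part_le.
  exact: le_trans (rst_part_le x).
Qed.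

(** [|h| <= 1 + |h|^2], and the weight has finite mass. *)
Lemma intW_part : (Lpint k 2 h < +oo)%E -> intW hp.
Proof.
move=> h2; have mhp : measurable_fun setT hp by exact: measurable_rst.
apply/integrableP; split.
  by apply/measurable_EFinP; exact: measurable_Mwgt.
apply: (@le_lt_trans _ _ (\int[mu]_x (1 * wgt x + `|hp x| `^ 2 * wgt x)%:E)%E).
  under eq_integral do rewrite /=.
  apply: le_integral_EFin.
  - apply: measurableT_comp => //.
    by exact: measurable_Mwgt.
  - apply: measurable_funD.
      by exact: measurable_Mwgt.
    exact: measurable_powMwgt.
  - by [].
  - move=> x; rewrite normrM (ger0_norm (wgt_ge0 k x)) -mulrDl ler_wpM2r ?wgt_ge0//.
    by rewrite le_1Dpow// ler1n.
rewrite integralD_ge0_EFin; last 4 first.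
- by exact: measurable_Mwgt.
- exact: measurable_powMwgt.
- by move=> x; rewrite mulr_ge0 ?wgt_ge0.
- by move=> x; rewrite mulr_ge0 ?powR_ge0 ?wgt_ge0.
rewrite int_cstW// lte_add_pinfty ?ltry//.
by apply: le_lt_trans h2; apply: Lp_part.
Qed.

End Part.

Local Notation re h := (rst (fun x => complex.Re (h x))).
Local Notation im h := (rst (fun x => complex.Im (h x))).

(** Conjugating [i sin] pairs the even coefficient of the real part with the odd coefficient of the
    imaginary part, and conversely with a minus sign. *)
Lemma ipk_parts h m (a b : R) : intW (re h) -> intW (im h) ->
  ipk k h (pfun (a%:P * geg k m, b%:P * (geg k m)^`())) =
  Complex (a * cE k m (re h) + b * cO k m (im h))
          (a * cE k m (im h) - b * cO k m (re h)).
Proof.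
move=> h1 h2; rewrite /ipk; congr Complex.
  rewrite -IWE -!IWZ; [|exact: intW_gO|exact: intW_gE].
  rewrite -IWD; [|exact/intWZ/intW_gE|exact/intWZ/intW_gO].
  apply: eq_IW_Dpi => x Dx; rewrite !rst_in// /gE /gO /pfun.
  by case: (h x) => u v /=; rewrite !hE; ring.
rewrite -IWE -mulNr -!IWZ; [|exact: intW_gO|exact: intW_gE].
rewrite -IWD; [|exact/intWZ/intW_gE|exact/intWZ/intW_gO].
apply: eq_IW_Dpi => x Dx; rewrite !rst_in// /gE /gO /pfun.
by case: (h x) => u v /=; rewrite !hE; ring.
Qed.

Lemma Ek_pfun n : Ek k n = pfun (Epair n (Ecoef k n)).
Proof. by apply/funext => x; exact: Efun_pfun. Qed.

Lemma scaleC (w x y : R) : Complex w 0 * Complex x y = Complex (w * x) (w * y) :> R[i].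
Proof. by apply/eqP; rewrite eq_complex /= !mul0r subr0 addr0 !eqxx. Qed.

Lemma linear2 (a b a' b' x y : R) : a * b' - a' * b != 0 ->
  a * x + b * y = 0 -> a' * x + b' * y = 0 -> x = 0 /\ y = 0.
Proof.
move=> d e1 e2; split; apply: (mulfI d); rewrite mulr0.
  have -> : (a * b' - a' * b) * x = b' * (a * x + b * y) - b * (a' * x + b' * y) by ring.
  by rewrite e1 e2 !mulr0 subr0.
have -> : (a * b' - a' * b) * y = a * (a' * x + b' * y) - a' * (a * x + b * y) by ring.
by rewrite e1 e2 !mulr0 subr0.
Qed.

Section Relations.
Variables (alpha : R) (f g : R -> R[i]).
Hypothesis f1 : intW (re f).
Hypothesis f2 : intW (im f).
Hypothesis g1 : intW (re g).
Hypothesis g2 : intW (im g).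
Hypothesis fg : isFracInt k alpha f g.

Lemma frac_coef n : (0 < n)%N -> let w := n%:R `^ (- alpha) in
  [/\ cE k n (re g) = w * cE k n (re f), cE k n (im g) = w * cE k n (im f),
      cO k n (re g) = w * cO k n (re f) & cO k n (im g) = w * cO k n (im f)].
Proof.
case: n => // m _ w.
have [a [b [a' [b' [E E' d]]]]] := Epair_two k_gt0 m.
have h1 := fg m.+1%:Z; have h2 := fg (- m.+1%:Z).
have n0 : (m.+1%:Z == 0) = false by [].
rewrite n0 absz_nat -/w in h1; rewrite oppr_eq0 n0 abszN absz_nat -/w in h2.
rewrite !Ek_pfun E !ipk_parts// in h1; rewrite !Ek_pfun E' !ipk_parts// in h2.
move: h1 h2; rewrite !scaleC => -[r1 i1] [r2 i2].
have [X1 Y1] := @linear2 a b a' b' (cE k m.+1 (re g) - w * cE k m.+1 (re f))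
  (cO k m.+1 (im g) - w * cO k m.+1 (im f)) d ltac:(lra) ltac:(lra).
have [X2 Y2] := @linear2 a b a' b' (cE k m.+1 (im g) - w * cE k m.+1 (im f))
  (w * cO k m.+1 (re f) - cO k m.+1 (re g)) d ltac:(lra) ltac:(lra).
by split; lra.
Qed.

Lemma frac_coef0 : cE k 0 (re g) = 0 /\ cE k 0 (im g) = 0.
Proof.
have h := fg 0; rewrite eqxx Ek_pfun in h.
have E : Epair 0 (Ecoef k 0) = (1%:P * geg k 0, 0%:P * (geg k 0)^`()).
  by rewrite /Epair big_nil addr0 /= mul1r polyC0 mul0r.
by rewrite E ipk_parts// !mul1r !mul0r !subr0 !addr0 in h; case: h.
Qed.

End Relations.
End ComplexParts.

(** * Homogeneity and passage to norms *)

Section Main.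
Variables (R : realType) (k alpha p q : R).
Hypothesis k_gt0 : 0 < k.
Hypothesis alpha_gt0 : 0 < alpha.
Hypothesis p_gt1 : 1 < p.
Hypothesis pD : p < (2 * k + 1) / alpha.
Hypothesis pqD : q^-1 = p^-1 - alpha / (2 * k + 1).
Local Notation mu := (@lebesgue_measure R).
Local Notation wgt := (wgt k).
Local Notation intW := (intW k).
Local Notation FC := (FC k alpha p q).

Lemma int_pow_scale (h : R -> R) (s r : R) : 0 <= s -> measurable_fun setT h ->
  (\int[mu]_x (`|s * h x| `^ r * wgt x)%:E =
   (s `^ r)%:E * \int[mu]_x (`|h x| `^ r * wgt x)%:E)%E.
Proof.
move=> s0 mh; rewrite -integralZ_EFin ?powR_ge0//.
- by apply: eq_integral => x _; rewrite normrM (ger0_norm s0) powRM// mulrA.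
- exact: measurable_powMwgt.
- by move=> x; rewrite mulr_ge0 ?powR_ge0 ?wgt_ge0.
Qed.

(** The bound for norm at most 1, applied to [f / s] and [g / s]. Writing [|FC|] avoids discussing
    the sign of [FC]. *)
Lemma frac_int_scaled (f g : R -> R) (s : R) : 0 < s ->
  measurable_fun setT f -> intW f -> (\int[mu]_x (`|f x| `^ p * wgt x)%:E <= (s `^ p)%:E)%E ->
  measurable_fun setT g -> intW g -> cE k 0 g = 0 ->
  (forall n, (0 < n)%N -> cE k n g = n%:R `^ (- alpha) * cE k n f) ->
  (forall n, (0 < n)%N -> cO k n g = n%:R `^ (- alpha) * cO k n f) ->
  (\int[mu]_x (`|g x| `^ q * wgt x)%:E <= (`|FC| * s `^ q)%:E)%E.
Proof.
move=> s0 mf hf fp mg hg g0 gE_ gO_.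
have sV : 0 <= s^-1 by rewrite invr_ge0 ltW.
have scE n h : intW h -> cE k n (fun x => s^-1 * h x) = s^-1 * cE k n h.
  move=> hh; rewrite /cE -IWZ; last exact: intW_gE.
  by apply: eq_IW => x; rewrite mulrCA.
have scO n h : intW h -> cO k n (fun x => s^-1 * h x) = s^-1 * cO k n h.
  move=> hh; rewrite /cO -IWZ; last exact: intW_gO.
  by apply: eq_IW => x; rewrite mulrCA.
have sp r : s^-1 `^ r * s `^ r = 1.
  by rewrite -powRM ?(ltW s0)// mulVf ?powR1// gt_eqF.
have f1 : (\int[mu]_x (`|s^-1 * f x| `^ p * wgt x)%:E <= 1)%E.
  have -> : (1 = (s^-1 `^ p * s `^ p)%:E)%E by rewrite sp.
  by rewrite int_pow_scale// EFinM lee_wpmul2l ?lee_fin ?powR_ge0.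
have ms (h : R -> R) : measurable_fun setT h -> measurable_fun setT (fun x => s^-1 * h x).
  by move=> mh; apply: measurable_funM.
have := @frac_int_bound _ _ _ _ _ k_gt0 alpha_gt0 p_gt1 pD pqD _ (ms _ mf) (intWZ _ hf) f1
  _ (ms _ mg) (intWZ _ hg).
rewrite scE// g0 mulr0 => /(_ erefl) b.
have {b} : (\int[mu]_x (`|s^-1 * g x| `^ q * wgt x)%:E <= FC%:E)%E.
  by apply: b => n n0; rewrite ?scE// ?scO// ?gE_// ?gO_//; rewrite mulrCA.
rewrite int_pow_scale// => b.
have E : (\int[mu]_x (`|g x| `^ q * wgt x)%:E =
  (s `^ q)%:E * ((s^-1 `^ q)%:E * \int[mu]_x (`|g x| `^ q * wgt x)%:E))%E.
  by rewrite muleA -EFinM mulrC sp mul1e.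
rewrite E mulrC EFinM lee_wpmul2l ?lee_fin ?powR_ge0//.
by apply: (le_trans b); rewrite lee_fin ler_norm.
Qed.

Let p_gt0 : 0 < p. Proof. exact: lt_trans p_gt1. Qed.

Let q_gt0 : 0 < q.
Proof.
have d0 : 0 < 2 * k + 1 by rewrite addr_gt0// mulr_gt0.
by rewrite -invr_gt0 pqD subr_gt0 -[ltLHS]invrK invf_div ltf_pV2 ?posrE// divr_gt0.
Qed.

(** The modulus dominates both parts, so each satisfies the real statement; [|z| <= |Re z| + |Im z|]
    recombines them at the price of [2^q]. *)
Lemma Lpint_frac (f g : R -> R[i]) (s : R) : 0 < s ->
  inLp k 2 f -> (Lpint k p f <= (s `^ p)%:E)%E -> inLp k 2 g -> isFracInt k alpha f g ->
  (Lpint k q g <= (2 `^ q * (`|FC| + `|FC|) * s `^ q)%:E)%E.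
Proof.
move=> s0 [mf1 mf2 f2] fp [mg1 mg2 g2] fg.
have mf : measC f by []. have mg : measC g by [].
have [p0 q0] : 0 <= p /\ 0 <= q by rewrite !ltW.
have if1 := intW_part k_gt0 (@cabs_Re R) mf mf1 f2.
have if2 := intW_part k_gt0 (@cabs_Im R) mf mf2 f2.
have ig1 := intW_part k_gt0 (@cabs_Re R) mg mg1 g2.
have ig2 := intW_part k_gt0 (@cabs_Im R) mg mg2 g2.
have [z1 z2] := frac_coef0 ig1 ig2 fg.
have co := frac_coef k_gt0 if1 if2 ig1 ig2 fg.
have b1 : (\int[mu]_x (`|rst (fun x => complex.Re (g x)) x| `^ q * wgt x)%:E <= (`|FC| * s `^ q)%:E)%E.
  apply: (frac_int_scaled s0 (measurable_rst mf1) if1 _ (measurable_rst mg1) ig1 z1).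
  - by apply: le_trans fp; apply: Lp_part => //; exact: cabs_Re.
  - by move=> n /co[].
  - by move=> n /co[].
have b2 : (\int[mu]_x (`|rst (fun x => complex.Im (g x)) x| `^ q * wgt x)%:E <= (`|FC| * s `^ q)%:E)%E.
  apply: (frac_int_scaled s0 (measurable_rst mf2) if2 _ (measurable_rst mg2) ig2 z2).
  - by apply: le_trans fp; apply: Lp_part => //; exact: cabs_Im.
  - by move=> n /co[].
  - by move=> n /co[].
have m1 := measurable_powMwgt k q (measurable_rst mg1).
have m2 := measurable_powMwgt k q (measurable_rst mg2).
rewrite LpintE.
apply: (@le_trans _ _ (\int[mu]_x (2 `^ q * (`|rst (fun x => complex.Re (g x)) x| `^ q * wgt x +
   `|rst (fun x => complex.Im (g x)) x| `^ q * wgt x))%:E)%E).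
  apply: le_integral_EFin.
  - exact: measurable_cabs_pow.
  - by apply: measurable_funM; [exact: measurable_cst|exact: measurable_funD].
  - by move=> x; rewrite mulr_ge0 ?powR_ge0 ?wgt_ge0.
  - move=> x; have [Dx|Dx] := pselect (Dpi x); last first.
      by rewrite wgt_out// !mulr0 addr0 mulr0.
    rewrite !rst_in// -mulrDl mulrA ler_wpM2r ?wgt_ge0//.
    apply: (@le_trans _ _ ((`|complex.Re (g x)| + `|complex.Im (g x)|) `^ q)); last exact: powR_add_le.
    by apply: ge0_ler_powR; rewrite ?nnegrE ?cabs_ge0 ?addr_ge0//; exact: cabs_le.
have nn (h : R -> R) x : 0 <= `|h x| `^ q * wgt x by rewrite mulr_ge0 ?powR_ge0 ?wgt_ge0.
rewrite integralZ_EFin ?powR_ge0//; [|exact: measurable_funD|by move=> x; rewrite addr_ge0 ?nn].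
rewrite -mulrA EFinM; apply: lee_wpmul2l; first by rewrite lee_fin powR_ge0.
rewrite integralD_ge0_EFin//.
by rewrite mulrDl EFinD; apply: leeD; [exact: b1|exact: b2].
Qed.

Lemma Lpnorm_frac (f g : R -> R[i]) : inLp k 2 f -> inLp k p f -> inLp k 2 g ->
  isFracInt k alpha f g ->
  (Lpnorm k q g <= ((2 `^ q * (`|FC| + `|FC|)) `^ q^-1)%:E * Lpnorm k p f)%E.
Proof.
move=> f2 [_ _ fp] g2 fg.
set A := 2 `^ q * (`|FC| + `|FC|).
have A0 : 0 <= A by rewrite mulr_ge0 ?powR_ge0 ?addr_ge0.
have L0 : (0 <= Lpint k p f)%E.
  by apply: integral_ge0 => x _; rewrite lee_fin mulr_ge0 ?powR_ge0 ?wk_ge0.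
have G0 : (0 <= Lpint k q g)%E.
  by apply: integral_ge0 => x _; rewrite lee_fin mulr_ge0 ?powR_ge0 ?wk_ge0.
rewrite /Lpnorm; move: fp L0; case E : (Lpint k p f) => [L| |] // _; rewrite lee_fin => L0.
rewrite poweR_EFin; set a := L `^ p^-1.
have a0 : 0 <= a by rewrite powR_ge0.
(* [s] has to be positive while the norm [a] may be 0, so the estimate is taken for every [s > a]
   before letting [s] tend to [a]. *)
have key s : a < s -> (Lpint k q g `^ q^-1 <= (A `^ q^-1 * s)%:E)%E.
  move=> as_; have s0 : 0 < s := le_lt_trans a0 as_.
  have h : (Lpint k q g <= (A * s `^ q)%:E)%E.
    apply: Lpint_frac fg => //; rewrite E lee_fin.
    have -> : L = a `^ p by rewrite /a -powRrM mulVf ?powRr1// gt_eqF.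
    by apply: ge0_ler_powR; rewrite ?nnegrE ?(ltW p_gt0) ?(ltW s0)// ltW.
  have -> : (A `^ q^-1 * s)%:E = ((A * s `^ q)%:E `^ q^-1)%E.
    rewrite poweR_EFin powRM ?powR_ge0// -powRrM divff ?powRr1 ?(ltW s0)//.
    by rewrite gt_eqF.
  apply: gt0_ler_poweR => //; first by rewrite invr_ge0 ltW.
    by rewrite in_itv/= G0 leey.
  by rewrite in_itv/= leey andbT lee_fin mulr_ge0 ?powR_ge0.
rewrite -EFinM; apply/lee_addgt0Pr => e e0.
set B := A `^ q^-1; have B0 : 0 <= B by rewrite powR_ge0.
(* The increment has denominator [B + 1], as [B] may vanish. *)
have d0 : 0 < e / (B + 1) by rewrite divr_gt0// ltr_wpDl.
apply: (le_trans (key (a + e / (B + 1)) _)); first by rewrite ltrDl.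
rewrite -EFinD lee_fin -/B mulrDr lerD2l mulrCA -[leRHS]mulr1 ler_pM2l//.
by rewrite ler_pdivrMr ?mul1r ?lerDl// ltr_wpDl.
Qed.

End Main.

Theorem mainTheorem11 (R : realType) (k alpha p q : R) :
  0 < k -> 0 < alpha -> 1 < p -> p < (2 * k + 1) / alpha ->
  q^-1 = p^-1 - alpha / (2 * k + 1) ->
  exists C : R, forall f g : R -> R[i],
    inLp k 2 f -> inLp k p f ->
    inLp k 2 g -> isFracInt k alpha f g ->
    (Lpnorm k q g <= C%:E * Lpnorm k p f)%E.
Proof.
move=> k0 a0 p1 pD pqD; eexists => f g f2 fp g2 fg.
exact: (Lpnorm_frac k0 a0 p1 pD pqD).
Qed.
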